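(* The symmetries of (Cplx) for the Bismut curvature tensor are preserved by any Hermitian curvature flow acting on a linear Hopf manifold equipped with a metric $g(\alpha,\beta)$ (with real $\alpha>0$, $\beta>-\alpha$) as initial metric; that is, the evolved metrics have Bismut curvature tensor satisfying (Cplx) for as long as the flow exists.
   Context: A linear Hopf manifold of complex dimension $n$ is $M^n=(\mathbb C^n\setminus\{0\})/\!\sim$, where $(z_1,\dots,z_n)\sim(a_1z_1,\dots,a_nz_n)$ for a fixed $a\in\mathbb C^n\setminus\{0\}$ with $|a_1|=\dots=|a_n|\ne1$, with its natural complex structure. For real $\alpha>0$, $\beta>-\alpha$, $g(\alpha,\beta)$ is the Hermitian metric $g(\alpha,\beta)_{i\bar j}=\alpha\frac{\delta_{ij}}{|z|^2}+\beta\frac{\bar z_iz_j}{|z|^4}$. The Bismut connection $\nabla^+$ of a Hermitian manifold $(M,g,J)$ is the unique Hermitian connection ($\nabla^+g=0$, $\nabla^+J=0$) with totally skew-symmetric torsion; $\Omega^B$ is its curvature tensor with all indices lowered by $g$. (Cplx) is the condition $\Omega^B\in\wedge^{1,1}M\otimes\wedge^{1,1}M$. A Hermitian curvature flow (HCF) is $\frac{\partial}{\partial t}g=-S+Q$ with $Q=aQ^1+bQ^2+cQ^3+dQ^4$ for real constants $a,b,c,d$, where, with $\Omega^{Ch}$ and $T=T^{Ch}$ the curvature and torsion of the Chern connection (torsion indices lowered by $g$, $T_{ik\bar n}=T_{ik}^pg_{p\bar n}$, $T_{\bar j\bar l m}=\overline{T_{jl\bar m}}$), $S_{i\bar j}=g^{k\bar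 l}\Omega^{Ch}_{k\bar li\bar j}$, and $Q^1_{i\bar j}=g^{k\bar l}g^{m\bar n}T_{ik\bar n}T_{\bar j\bar lm}$, $Q^2_{i\bar j}=g^{k\bar l}g^{m\bar n}T_{km\bar j}T_{\bar l\bar ni}$, $Q^3_{i\bar j}=g^{k\bar l}g^{m\bar n}T_{ik\bar l}T_{\bar j\bar nm}$, $Q^4_{i\bar j}=\frac12g^{k\bar l}g^{m\bar n}(T_{mk\bar l}T_{\bar n\bar ji}+T_{mi\bar j}T_{\bar n\bar lk})$. *)

(* Defs.v *)
(* Complex numbers are R[i] for an arbitrary R : realType. *)
From HB Require Import structures.
From mathcomp Require Import all_boot all_order all_algebra.
From mathcomp Require Import complex.
From mathcomp Require Import all_classical all_reals all_analysis.

Set Implicit Arguments.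
Unset Strict Implicit.
Unset Printing Implicit Defensive.

Import Order.TTheory GRing.Theory Num.Theory.
Import numFieldNormedType.Exports.

Local Open Scope classical_set_scope.
Local Open Scope complex_scope.
Local Open Scope ring_scope.

(* C^n is identified with R^n x R^n through z = x + i y, and all differentiation
   is real differentiation in the coordinates (x, y). *)
Definition cvec (R : realType) (n : nat)
    (p : 'rV[R]_n * 'rV[R]_n) : 'rV[R[i]]_n :=
  \row_k (p.1 0 k +i* p.2 0 k).

Definition rvec (R : realType) (n : nat)
    (z : 'rV[R[i]]_n) : 'rV[R]_n * 'rV[R]_n :=
  (map_mx (@complex.Re R) z, map_mx (@complex.Im R) z).

(* C^oo on the open set U of a finite-dimensional space V: every iterated
   directional derivative is Frechet differentiable at every point of U. *)
Definition smooth_on (R : realType) (V : normedModType R) (U : set V)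
    (f : V -> R) : Prop :=
  forall (vs : seq V) (p : V), U p ->
    differentiable
      (foldr (fun (v : V) (h : V -> R^o) => fun q => 'D_v h q) f vs : V -> R^o)
      p.

Definition csmooth_on (R : realType) (V : normedModType R) (U : set V)
    (f : V -> R[i]) : Prop :=
  smooth_on U (fun p => complex.Re (f p)) /\
  smooth_on U (fun p => complex.Im (f p)).

(* Derivative of f at z along the real direction v of C^n = R^n x R^n. *)
Definition real_deriv (R : realType) (n : nat) (v : 'rV[R[i]]_n)
    (f : 'rV[R[i]]_n -> R[i]) (z : 'rV[R[i]]_n) : R[i] :=
  'D_(rvec v) (fun p => complex.Re (f (cvec p)) : R^o) (rvec z)
  +i* 'D_(rvec v) (fun p => complex.Im (f (cvec p)) : R^o) (rvec z).

Definition time_deriv (R : realType) (f : R -> R[i]) (t : R) : R[i] :=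
  derive1 (fun s : R => complex.Re (f s) : R^o) t
  +i* derive1 (fun s : R => complex.Im (f s) : R^o) t.

(* The complexified tangent bundle is framed by inl k |-> d/dz_k and
   inr k |-> d/d(conj z_k).  Tensors and connections are extended
   complex-linearly and given by their components in this frame. *)
Definition frame (n : nat) : finType := ('I_n + 'I_n)%type.

Definition bar (n : nat) (A : frame n) : frame n :=
  match A with inl k => inr k | inr k => inl k end.

(* true on T^{1,0}, false on T^{0,1} *)
Definition holo (n : nat) (A : frame n) : bool :=
  match A with inl _ => true | inr _ => false end.

(* Wirtinger derivatives (d/dx -+ i d/dy) / 2. *)
Definition frame_deriv (R : realType) (n : nat) (A : frame n)
    (f : 'rV[R[i]]_n -> R[i]) (z : 'rV[R[i]]_n) : R[i] :=
  match A with
  | inl k => (real_deriv (delta_mx 0 k) f z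
              - 'i%C * real_deriv ('i%C *: delta_mx 0 k) f z) / 2%:R
  | inr k => (real_deriv (delta_mx 0 k) f z
              + 'i%C * real_deriv ('i%C *: delta_mx 0 k) f z) / 2%:R
  end.

(* The eigenvalue of J on a frame vector. *)
Definition Jval (R : realType) (n : nat) (A : frame n) : R[i] :=
  if holo A then 'i%C else - 'i%C.

(* h i j stands for h_{i \bar j}. *)
Definition metric (R : realType) (n : nat) : Type :=
  'rV[R[i]]_n -> 'M[R[i]]_n.

(* G A B = g(e_A, e_B), the complex-bilinear extension of the metric. *)
Definition metric_cpt (R : realType) (n : nat) (g : metric R n)
    (A B : frame n) (z : 'rV[R[i]]_n) : R[i] :=
  match A, B with
  | inl i, inr j => g z i j
  | inr j, inl i => g z i j
  | _, _ => 0
  end.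

(* g^{k \bar l}, characterized by \sum_l g^{k \bar l} g_{i \bar l} = delta_{ik};
   hence the transposition. *)
Definition ginv (R : realType) (n : nat) (g : metric R n) (z : 'rV[R[i]]_n)
    (k l : 'I_n) : R[i] := invmx (g z) l k.

Definition hermitian_metric (R : realType) (n : nat) (g : metric R n) : Prop :=
  [/\ forall i j, csmooth_on [set p | cvec p != 0] (fun p => g (cvec p) i j),
      forall z : 'rV[R[i]]_n, z != 0 -> forall i j, g z j i = (g z i j)^* &
      forall z : 'rV[R[i]]_n, z != 0 -> forall v : 'rV[R[i]]_n, v != 0 ->
        0 < \sum_i \sum_j g z i j * v 0 i * (v 0 j)^*].

(** * Linear Hopf manifolds *)

Definition hopf_multiplier (R : realType) (n : nat) (a : 'rV[R[i]]_n) : Prop :=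
  [/\ a != 0,
      forall i j : 'I_n, `|a 0 i| = `|a 0 j| &
      forall i : 'I_n, `|a 0 i| != 1].

Definition hopf_map (R : realType) (n : nat) (a z : 'rV[R[i]]_n) : 'rV[R[i]]_n :=
  \row_i (a 0 i * z 0 i).

(* C^n \ {0} -> M is a holomorphic covering with deck group generated by
   hopf_map a, so a Hermitian metric on M is a Hermitian metric on C^n \ {0}
   equal to its own pullback by hopf_map a. *)
Definition hopf_hermitian_metric (R : realType) (n : nat) (a : 'rV[R[i]]_n)
    (g : metric R n) : Prop :=
  hermitian_metric g /\
  forall z : 'rV[R[i]]_n, z != 0 -> forall i j,
    g z i j = g (hopf_map a z) i j * a 0 i * (a 0 j)^*.

Definition sqnorm (R : realType) (n : nat) (z : 'rV[R[i]]_n) : R[i] :=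
  \sum_k `|z 0 k| ^+ 2.

Definition hopf_g (R : realType) (n : nat) (alpha beta : R) : metric R n :=
  fun z => \matrix_(i, j)
    (alpha%:C * ((i == j)%:R / sqnorm z)
     + beta%:C * ((z 0 i)^* * z 0 j / sqnorm z ^+ 2)).

(** * Hermitian connections *)

(* Gam A B D z is the e_D-component of nabla_{e_A} e_B at z. *)
Definition connection (R : realType) (n : nat) : Type :=
  frame n -> frame n -> frame n -> 'rV[R[i]]_n -> R[i].

(* The frame fields commute, so T(e_A, e_B) = nabla_A e_B - nabla_B e_A. *)
Definition torsion (R : realType) (n : nat) (Gam : connection R n)
    (A B D : frame n) (z : 'rV[R[i]]_n) : R[i] :=
  Gam A B D z - Gam B A D z.

Definition torsion_low (R : realType) (n : nat) (g : metric R n)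
    (Gam : connection R n) (A B D : frame n) (z : 'rV[R[i]]_n) : R[i] :=
  \sum_E torsion Gam A B E z * metric_cpt g E D z.

(* e_D-component of nabla_A nabla_B e_C - nabla_B nabla_A e_C. *)
Definition curvature (R : realType) (n : nat) (Gam : connection R n)
    (A B C D : frame n) (z : 'rV[R[i]]_n) : R[i] :=
  frame_deriv A (Gam B C D) z - frame_deriv B (Gam A C D) z
  + \sum_E (Gam B C E z * Gam A E D z - Gam A C E z * Gam B E D z).

(* Omega_{ABCD} = g(R(e_A, e_B) e_C, e_D) *)
Definition curvature_low (R : realType) (n : nat) (g : metric R n)
    (Gam : connection R n) (A B C D : frame n) (z : 'rV[R[i]]_n) : R[i] :=
  \sum_E curvature Gam A B C E z * metric_cpt g E D z.

(* Respectively: Gam is the extension of a real connection, nabla g = 0,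
   nabla J = 0. *)
Definition hermitian_connection (R : realType) (n : nat) (g : metric R n)
    (Gam : connection R n) : Prop :=
  forall z : 'rV[R[i]]_n, z != 0 ->
  [/\ forall A B D, Gam (bar A) (bar B) (bar D) z = (Gam A B D z)^*,
      forall A B C, frame_deriv A (metric_cpt g B C) z
        = \sum_E Gam A B E z * metric_cpt g E C z
          + \sum_E Gam A C E z * metric_cpt g B E z &
      forall A B D, Jval R B * Gam A B D z = Gam A B D z * Jval R D].

(* The two definitions below determine Gam at each point of C^n \ {0} by g and
   its first derivatives there; smoothness of Gam and its invariance under the
   deck group follow, and are not required separately. *)
Definition bismut_connection (R : realType) (n : nat) (g : metric R n)
    (Gam : connection R n) : Prop :=
  hermitian_connection g Gam /\
  forall z : 'rV[R[i]]_n, z != 0 -> forall A B D,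
    torsion_low g Gam A B D z = - torsion_low g Gam B A D z /\
    torsion_low g Gam A B D z = - torsion_low g Gam A D B z.

(* The (0,1)-part of nabla is the Dolbeault operator: d/dz_j is a local
   holomorphic frame of T^{1,0}. *)
Definition chern_connection (R : realType) (n : nat) (g : metric R n)
    (Gam : connection R n) : Prop :=
  hermitian_connection g Gam /\
  forall z : 'rV[R[i]]_n, z != 0 -> forall (i j : 'I_n) (D : frame n),
    Gam (inr i) (inl j) D z = 0.

(* Om lies in wedge^{1,1} (x) wedge^{1,1}. *)
Definition in_wedge11_wedge11 (R : realType) (n : nat)
    (Om : frame n -> frame n -> frame n -> frame n -> R[i]) : Prop :=
  [/\ forall A B C D, Om A B C D = - Om B A C D,
      forall A B C D, Om A B C D = - Om A B D C,
      forall A B C D, holo A = holo B -> Om A B C D = 0 &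
      forall A B C D, holo C = holo D -> Om A B C D = 0].

(* The Bismut connection exists and its curvature satisfies (Cplx); as it is
   unique, quantifying over every Bismut connection is harmless. *)
Definition bismut_Cplx (R : realType) (n : nat) (g : metric R n) : Prop :=
  (exists Gam, bismut_connection g Gam) /\
  forall Gam, bismut_connection g Gam -> forall z : 'rV[R[i]]_n, z != 0 ->
    in_wedge11_wedge11 (fun A B C D => curvature_low g Gam A B C D z).

(** * Hermitian curvature flows *)

(* T_{ik \bar n} *)
Definition Tlow (R : realType) (n : nat) (g : metric R n)
    (Gam : connection R n) (z : 'rV[R[i]]_n) (i k m : 'I_n) : R[i] :=
  torsion_low g Gam (inl i) (inl k) (inr m) z.

(* T_{\bar j \bar l m} *)
Definition Tlow_bar (R : realType) (n : nat) (g : metric R n)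
    (Gam : connection R n) (z : 'rV[R[i]]_n) (j l m : 'I_n) : R[i] :=
  (Tlow g Gam z j l m)^*.

Definition hcf_S (R : realType) (n : nat) (g : metric R n)
    (Gam : connection R n) (z : 'rV[R[i]]_n) (i j : 'I_n) : R[i] :=
  \sum_k \sum_l ginv g z k l
    * curvature_low g Gam (inl k) (inr l) (inl i) (inr j) z.

Definition hcf_Q1 (R : realType) (n : nat) (g : metric R n)
    (Gam : connection R n) (z : 'rV[R[i]]_n) (i j : 'I_n) : R[i] :=
  \sum_k \sum_l \sum_m \sum_p ginv g z k l * ginv g z m p
    * (Tlow g Gam z i k p * Tlow_bar g Gam z j l m).

Definition hcf_Q2 (R : realType) (n : nat) (g : metric R n)
    (Gam : connection R n) (z : 'rV[R[i]]_n) (i j : 'I_n) : R[i] :=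
  \sum_k \sum_l \sum_m \sum_p ginv g z k l * ginv g z m p
    * (Tlow g Gam z k m j * Tlow_bar g Gam z l p i).

Definition hcf_Q3 (R : realType) (n : nat) (g : metric R n)
    (Gam : connection R n) (z : 'rV[R[i]]_n) (i j : 'I_n) : R[i] :=
  \sum_k \sum_l \sum_m \sum_p ginv g z k l * ginv g z m p
    * (Tlow g Gam z i k l * Tlow_bar g Gam z j p m).

Definition hcf_Q4 (R : realType) (n : nat) (g : metric R n)
    (Gam : connection R n) (z : 'rV[R[i]]_n) (i j : 'I_n) : R[i] :=
  2%:R^-1 * \sum_k \sum_l \sum_m \sum_p ginv g z k l * ginv g z m p
    * (Tlow g Gam z m k l * Tlow_bar g Gam z p j i
       + Tlow g Gam z m i j * Tlow_bar g Gam z p l k).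

(* g is smooth on M x [0, T) up to the boundary t = 0: it is smooth on an open
   set containing (C^n \ {0}) x [0, T).  The values of g at t < 0 are only a
   smooth extension; they need not be metrics nor solve the flow equation. *)
Definition smooth_family (R : realType) (n : nat) (T : \bar R)
    (g : R -> metric R n) : Prop :=
  exists U : set (R^o * ('rV[R]_n * 'rV[R]_n)),
    [/\ open U,
        forall (t : R) (z : 'rV[R[i]]_n),
          0 <= t -> (t%:E < T)%E -> z != 0 -> U (t, rvec z) &
        forall i j, csmooth_on U (fun p => g p.1 (cvec p.2) i j)].

(* A solution on [0, T), 0 < T <= +oo, of dg/dt = - S + Q on the linear Hopf
   manifold of multiplier a, with Q = c1 Q^1 + c2 Q^2 + c3 Q^3 + c4 Q^4. *)
Definition hcf_on_hopf (R : realType) (n : nat) (a : 'rV[R[i]]_n)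
    (c1 c2 c3 c4 : R) (T : \bar R) (g : R -> metric R n) : Prop :=
  smooth_family T g /\
  forall t : R, 0 <= t -> (t%:E < T)%E ->
    hopf_hermitian_metric a (g t) /\
    exists Gam, chern_connection (g t) Gam /\
      forall z : 'rV[R[i]]_n, z != 0 -> forall i j,
        time_deriv (fun s => g s z i j) t =
          - hcf_S (g t) Gam z i j
          + (c1%:C * hcf_Q1 (g t) Gam z i j + c2%:C * hcf_Q2 (g t) Gam z i j
             + c3%:C * hcf_Q3 (g t) Gam z i j + c4%:C * hcf_Q4 (g t) Gam z i j).

(* Main.v *)
Require Import Defs.
From HB Require Import structures.
From mathcomp Require Import all_boot all_order all_algebra.
From mathcomp Require Import perm spectral complex.
From mathcomp Require Import all_classical all_reals all_analysis.
From mathcomp Require Import ring lra.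
Set Implicit Arguments.
Unset Strict Implicit.
Unset Printing Implicit Defensive.
Import Order.TTheory GRing.Theory Num.Theory.
Import numFieldNormedType.Exports.
Local Open Scope classical_set_scope.
Local Open Scope complex_scope.
Local Open Scope ring_scope.

(** The metrics [g(alpha, beta)] are exactly the Hermitian metrics on [C^n] minus
    the origin that are invariant under [z |-> z A] for all [A] with
    [A A^* = s 1]: this group acts transitively, and the stabilizer of a base
    point leaves only two real parameters ([symmetric_metric]). So the theorem
    splits into two facts: the flow preserves this symmetry, and the Bismut
    curvature of every [g(alpha, beta)] satisfies (Cplx).

    Preservation of symmetry is a consequence of uniqueness: the pullback of a
    solution by a linear map commuting with the deck group is a solution
    ([pullm_solution]), and it has the same initial value. The maps at hand do
    not all commute with the deck transformation [diag a]. However the rotation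
    [diag (|a_i| / a_i)] does; once the solution is known to be invariant under
    it, the homothety of ratio [|a_i|] is a deck transformation too
    ([flow_dilation]), and it commutes with everything.

    Uniqueness ([hcf_unique]) comes from the maximum principle. In coordinates the
    Chern connection disappears ([chern_hcf]) and the flow reads
    [d_t g_{i \bar j} = g^{k \bar l} d_k d_{\bar l} g_{i \bar j} + F], with [F]
    polynomial in the inverse of [g] and quadratic in its first derivatives. If [h]
    is the difference of two solutions, then [|h|^2] satisfies
    [d_t |h|^2 <= L |h|^2 + K |h|^2] for the Laplacian [L] of one of them
    ([parabolic_inequality]): the gradient term produced by [L |h|^2] absorbs the
    first-order terms. The function [|z|^4 |h|^2] is invariant under the deck
    group, hence is controlled by its values on a compact annulus
    ([orbit_annulus]), where all the coefficients are bounded, and comparison with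
    the barrier [c e^{Kt} |z|^-4] shows that it remains zero.

    For the curvature, the Bismut connection of a Hermitian metric is given by an
    explicit formula in the first derivatives of the metric ([bismut_lower],
    [bismut_exists]). For [g(alpha, beta)] let [Pi] be the projection of [T^{1,0}]
    onto the orthogonal complement of the radial field. The components of the
    curvature along two vectors of the same type vanish, and
    [Omega_{a \bar b j \bar l} = alpha |z|^-4 (Pi_{jb} Pi_{al} - (1 + 2 beta / alpha) Pi_{jl} Pi_{ab})]
    ([hopf_curvE], [bismut_hopf_low]), from which the symmetries can be read off
    because [Pi] is Hermitian. *)

Local Arguments frame_deriv : simpl never.

(** * Differential calculus for complex-valued functions *)

Section ComplexCalculus.
Variables (R : realType) (V : normedModType R).
Implicit Types (f g : V -> R[i]) (p v : V).

(** [csmooth_on] and [real_deriv] work on real and imaginary parts separately;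
    [cdiff] and [cderiv] package the two parts so that the usual rules hold for
    complex-valued functions. *)
Definition cdiff f p : Prop :=
  differentiable (fun q => complex.Re (f q) : R^o) p /\
  differentiable (fun q => complex.Im (f q) : R^o) p.

Definition cderiv v f p : R[i] :=
  'D_v (fun q => complex.Re (f q) : R^o) p +i*
  'D_v (fun q => complex.Im (f q) : R^o) p.

Lemma cReD (x y : R[i]) : complex.Re (x + y) = complex.Re x + complex.Re y.
Proof. by case: x y => [a b] [c d]. Qed.
Lemma cImD (x y : R[i]) : complex.Im (x + y) = complex.Im x + complex.Im y.
Proof. by case: x y => [a b] [c d]. Qed.
Lemma cReM (x y : R[i]) : complex.Re (x * y) =
  complex.Re x * complex.Re y - complex.Im x * complex.Im y.
Proof. by case: x y => [a b] [c d]. Qed.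
Lemma cImM (x y : R[i]) : complex.Im (x * y) =
  complex.Re x * complex.Im y + complex.Im x * complex.Re y.
Proof. by case: x y => [a b] [c d]. Qed.
Lemma Re_conj (x : R[i]) : complex.Re x^* = complex.Re x.
Proof. by case: x. Qed.
Lemma Im_conj (x : R[i]) : complex.Im x^* = - complex.Im x.
Proof. by case: x. Qed.
Lemma complex_eqP (x y : R[i]) :
  complex.Re x = complex.Re y -> complex.Im x = complex.Im y -> x = y.
Proof. by case: x y => [a b] [c d] /= -> ->. Qed.

Lemma cdiffD f g p : cdiff f p -> cdiff g p -> cdiff (fun q => f q + g q) p.
Proof.
move=> [fr fi] [gr gi]; split.
  under eq_fun do rewrite cReD; exact: differentiableD.
by under eq_fun do rewrite cImD; exact: differentiableD.
Qed.

Lemma cdiffM f g p : cdiff f p -> cdiff g p -> cdiff (fun q => f q * g q) p.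
Proof.
move=> [fr fi] [gr gi]; split.
  under eq_fun do rewrite cReM.
  by apply: differentiableB; apply: differentiableM.
under eq_fun do rewrite cImM.
by apply: differentiableD; apply: differentiableM.
Qed.

Lemma cdiff_cst (c : R[i]) p : cdiff (fun=> c) p.
Proof. by split; apply: differentiable_cst. Qed.

Lemma cdiff_conj f p : cdiff f p -> cdiff (fun q => (f q)^*) p.
Proof.
move=> [fr fi]; split; first by under eq_fun do rewrite Re_conj.
by under eq_fun do rewrite Im_conj; apply: differentiableN.
Qed.

Lemma cdiffB f g p : cdiff f p -> cdiff g p -> cdiff (fun q => f q - g q) p.
Proof.
move=> df dg; under eq_fun do rewrite -mulN1r.
by apply: cdiffD => //; apply: cdiffM => //; exact: cdiff_cst.
Qed.

Lemma cderivD f g p v : cdiff f p -> cdiff g p ->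
  cderiv v (fun q => f q + g q) p = cderiv v f p + cderiv v g p.
Proof.
move=> [fr fi] [gr gi]; apply: complex_eqP; rewrite /cderiv ?cReD ?cImD /=.
  under eq_fun do rewrite cReD.
  by rewrite (deriveD (diff_derivable fr) (diff_derivable gr)).
under eq_fun do rewrite cImD.
by rewrite (deriveD (diff_derivable fi) (diff_derivable gi)).
Qed.

Lemma is_derive_mulr (f g : V -> R) p v :
  derivable (f : V -> R^o) p v -> derivable (g : V -> R^o) p v ->
  is_derive p v (fun q => f q * g q : R^o)
    ('D_v (f : V -> R^o) p * g p + f p * 'D_v (g : V -> R^o) p).
Proof.
move=> df dg; split; first exact: derivableM.
apply: etrans (deriveM df dg) _; rewrite addrC; congr (_ + _); exact: mulrC.
Qed.

Lemma cderivM f g p v : cdiff f p -> cdiff g p ->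
  cderiv v (fun q => f q * g q) p = cderiv v f p * g p + f p * cderiv v g p.
Proof.
move=> [/(@diff_derivable _ _ _ _ _ v) fr /(@diff_derivable _ _ _ _ _ v) fi].
move=> [/(@diff_derivable _ _ _ _ _ v) gr /(@diff_derivable _ _ _ _ _ v) gi].
have [rr Err] := is_derive_mulr fr gr; have [ii Eii] := is_derive_mulr fi gi.
have [ri Eri] := is_derive_mulr fr gi; have [ir Eir] := is_derive_mulr fi gr.
apply: complex_eqP.
  rewrite cReD !cReM /cderiv /=; under eq_fun do rewrite cReM.
  by apply: etrans (deriveB rr ii) _; rewrite Err Eii opprD addrACA.
rewrite cImD !cImM /cderiv /=; under eq_fun do rewrite cImM.
by apply: etrans (deriveD ri ir) _; rewrite Eri Eir addrACA.
Qed.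

Lemma cderiv_cst (c : R[i]) p v : cderiv v (fun=> c) p = 0.
Proof. by apply: complex_eqP; rewrite /cderiv /= derive_cst. Qed.

Lemma cderivB f g p v : cdiff f p -> cdiff g p ->
  cderiv v (fun q => f q - g q) p = cderiv v f p - cderiv v g p.
Proof.
move=> df dg; under eq_fun do rewrite -mulN1r.
rewrite cderivD //; last by apply: cdiffM => //; exact: cdiff_cst.
by rewrite (@cderivM (fun=> -1) g) ?cderiv_cst ?mul0r ?add0r ?mulN1r //; exact: cdiff_cst.
Qed.

Lemma cderiv_conj f p v : cdiff f p ->
  cderiv v (fun q => (f q)^*) p = (cderiv v f p)^*.
Proof.
move=> [fr fi]; apply: complex_eqP; rewrite ?Re_conj ?Im_conj /cderiv /=.
  by under eq_fun do rewrite Re_conj.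
by under eq_fun do rewrite Im_conj; rewrite deriveN //; exact: diff_derivable.
Qed.

Lemma cdiffV f p : cdiff f p -> f p != 0 -> cdiff (fun q => (f q)^-1) p.
Proof.
move=> [fr fi] fp0.
have n0 : complex.Re (f p) ^+ 2 + complex.Im (f p) ^+ 2 != 0.
  apply: contra fp0; rewrite paddr_eq0 ?sqr_ge0 // !sqrf_eq0.
  by case: (f p) => a b /= /andP[/eqP-> /eqP->].
have dn : differentiable (fun q =>
   (complex.Re (f q) ^+ 2 + complex.Im (f q) ^+ 2)^-1 : R^o) p.
  apply: differentiableV => //; under eq_fun do rewrite !expr2.
  by apply: differentiableD; apply: differentiableM.
have Re_inv (x : R[i]) : complex.Re x^-1 =
    complex.Re x * (complex.Re x ^+ 2 + complex.Im x ^+ 2)^-1.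
  by case: x.
have Im_inv (x : R[i]) : complex.Im x^-1 =
    - (complex.Im x * (complex.Re x ^+ 2 + complex.Im x ^+ 2)^-1).
  by case: x.
split.
  by under eq_fun do rewrite Re_inv; apply: differentiableM.
by under eq_fun do rewrite Im_inv; apply/differentiableN/differentiableM.
Qed.

Lemma cdiff_sum (I : Type) (r : seq I) (F : I -> V -> R[i]) p :
  (forall i, cdiff (F i) p) -> cdiff (fun q => \sum_(i <- r) F i q) p.
Proof.
move=> dF; elim: r => [|i r IH].
  by under eq_fun do rewrite big_nil; apply: cdiff_cst.
under eq_fun do rewrite big_cons.
exact: cdiffD.
Qed.

Lemma cderiv_sum (I : Type) (r : seq I) (F : I -> V -> R[i]) p v :
  (forall i, cdiff (F i) p) ->
  cderiv v (fun q => \sum_(i <- r) F i q) p = \sum_(i <- r) cderiv v (F i) p.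
Proof.
move=> dF; elim: r => [|i r IH].
  by under eq_fun do rewrite big_nil; rewrite cderiv_cst big_nil.
rewrite big_cons; under eq_fun do rewrite big_cons.
by rewrite cderivD ?IH //; exact: cdiff_sum.
Qed.

Lemma cderiv_near f g p v : (\near p, f p = g p) -> cderiv v f p = cderiv v g p.
Proof.
move=> fg; rewrite /cderiv; congr (_ +i* _); apply: near_eq_derive;
  by near=> q; rewrite (near fg q _).
Unshelve. all: by end_near. Qed.

(** The difference [k - h] vanishes near [p], so it is differentiable with zero
    differential there, and [k = (k - h) + h]. *)
Lemma near_differentiable (h k : V -> R^o) p : (\near p, h p = k p) ->
  differentiable h p -> differentiable k p.
Proof.
move=> hk dh.
pose e : V -> R^o := k \- h.
have e0 : \forall q \near p, e q = 0.
  by near=> q; rewrite /e /= (near hk q _) ?subrr.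
have ep : e p = 0 by exact: (nbhs_singleton e0).
have E : e \o shift p = cst (e p) + \0 +o_ 0 id.
  apply/eqaddoP => _/posnumP[eps].
  have := e0; rewrite (near_shift 0) subr0 => e0'.
  near=> x.
  have ex : e (x + p) = 0 by exact: (near e0' x _).
  suff -> : (e \o shift p - (cst (e p) + \0)) x = 0.
    by rewrite normr0 mulr_ge0.
  by apply: etrans (_ : e (x + p) - (e p + 0) = 0) => //; rewrite ex ep addr0 subrr.
have de : differentiable e p.
  apply/diff_locallyP.
  have D0 : 'd e p = \0 :> (V -> R^o).
    by apply: (@diff_unique _ _ _ e \0) => //; exact: cst_continuous.
  by rewrite D0; split => //; exact: cst_continuous.
have -> : k = e + h by apply/funext => x; rewrite /e fctE /= subrK.
exact: differentiableD.
Unshelve. all: by end_near. Qed.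

Lemma cdiff_near f g p : (\near p, f p = g p) -> cdiff f p -> cdiff g p.
Proof.
move=> fg [fr fi]; split; [apply: near_differentiable fr|
  apply: near_differentiable fi]; by near=> q; rewrite (near fg q _).
Unshelve. all: by end_near. Qed.

End ComplexCalculus.

(** * Wirtinger derivatives *)

Section FrameCalculus.
Variables (R : realType) (n : nat).
Local Notation C := R[i].
Local Notation V := ('rV[R]_n * 'rV[R]_n)%type.
Implicit Types (z v w : 'rV[C]_n) (f g : 'rV[C]_n -> C) (A B : frame n).

Definition zdiff f z : Prop := cdiff (fun p : V => f (cvec p)) (rvec z).

Lemma rvecK z : cvec (rvec z) = z.
Proof. by apply/rowP => k; rewrite !mxE /=; case: (z 0 k). Qed.

Lemma cvecK (p : V) : rvec (cvec p) = p.
Proof.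
by case: p => x y; congr pair; apply/rowP => k; rewrite !mxE.
Qed.

Lemma rvec0 : rvec (0 : 'rV[C]_n) = 0.
Proof. by congr pair; apply/rowP => k; rewrite !mxE. Qed.

Lemma rvecD v w : rvec (v + w) = rvec v + rvec w.
Proof.
by congr pair; apply/rowP => k; rewrite !mxE; case: (v 0 k) (w 0 k) => [a b] [].
Qed.

Lemma rvecZ (a : R) v : rvec (a%:C *: v) = a *: rvec v.
Proof.
congr pair; apply/rowP => k; rewrite !mxE; case: (v 0 k) => x y /=.
  by rewrite mul0r subr0.
by rewrite mul0r addr0.
Qed.

Lemma fst_differentiable (U W : normedModType R) (p : U * W) :
  differentiable (fst : U * W -> U) p.
Proof. by apply: linear_differentiable => q; exact: cvg_fst. Qed.

Lemma snd_differentiable (U W : normedModType R) (p : U * W) :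
  differentiable (snd : U * W -> W) p.
Proof. by apply: linear_differentiable => q; exact: cvg_snd. Qed.

Lemma fst_coord_differentiable k (p : V) :
  differentiable (fun q : V => q.1 0 k : R^o) p.
Proof.
apply: (@differentiable_comp _ _ _ _ fst (fun x : 'rV[R]_n => x 0 k : R^o)).
  exact: fst_differentiable.
exact: differentiable_coord.
Qed.

Lemma snd_coord_differentiable k (p : V) :
  differentiable (fun q : V => q.2 0 k : R^o) p.
Proof.
apply: (@differentiable_comp _ _ _ _ snd (fun x : 'rV[R]_n => x 0 k : R^o)).
  exact: snd_differentiable.
exact: differentiable_coord.
Qed.

Lemma cderiv_additive (W : normedModType R) (f : W -> C) p (v w : W) : cdiff f p ->
  cderiv (v + w) f p = cderiv v f p + cderiv w f p.
Proof.
move=> [fr fi]; apply: complex_eqP; rewrite ?cReD ?cImD /cderiv /= !deriveE //;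
  exact: linearD.
Qed.

Lemma cderiv_scale (W : normedModType R) (f : W -> C) p (a : R) (v : W) : cdiff f p ->
  cderiv (a *: v) f p = a%:C * cderiv v f p.
Proof.
move=> [fr fi]; rewrite /cderiv.
have E (h : W -> R^o) : differentiable h p -> 'D_(a *: v) h p = a * 'D_v h p.
  by move=> dh; rewrite !deriveE //; exact: linearZZ.
by rewrite !E //; apply: complex_eqP; rewrite ?cReM ?cImM /= mul0r ?subr0 ?addr0.
Qed.

Lemma cderiv0 (W : normedModType R) (f : W -> C) p : cderiv 0 f p = 0.
Proof. by rewrite /cderiv !derive0. Qed.

Lemma real_derivE v f z :
  real_deriv v f z = cderiv (rvec v) (fun p : V => f (cvec p)) (rvec z).
Proof. by []. Qed.

Lemma conj_rect (c : C) : c^* = (complex.Re c)%:C - 'i%C * (complex.Im c)%:C.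
Proof.
case: c => x y; apply: complex_eqP; rewrite ?cReD ?cImD ?Re_conj ?Im_conj /=.
  by rewrite mul0r mulr0 subr0 oppr0 addr0.
by rewrite mul0r mul1r !add0r.
Qed.

Lemma rect_frame (F : fieldType) (i a b x y : F) : i ^+ 2 = -1 ->
  2%:R != 0 :> F ->
  a * x + b * y = (a + i * b) * ((x - i * y) / 2%:R) +
                  (a - i * b) * ((x + i * y) / 2%:R).
Proof. by move=> i2 h2; field : i2. Qed.

(** [v = sum_k (v_k d/dz_k + conj v_k d/d(conj z_k))]; this turns the two
    derivatives hidden in [frame_deriv] into a chain rule for [z |-> z *m A]. *)
Lemma real_deriv_frame v f z : zdiff f z ->
  real_deriv v f z =
  \sum_k (v 0 k * frame_deriv (inl k) f z + (v 0 k)^* * frame_deriv (inr k) f z).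
Proof.
move=> df; rewrite {1}(row_sum_delta v) real_derivE.
have -> : rvec (\sum_(j < n) v 0 j *: delta_mx 0 j) =
  \sum_(j < n) (complex.Re (v 0 j) *: rvec (delta_mx 0 j) +
     complex.Im (v 0 j) *: rvec ('i%C *: delta_mx 0 j)).
  rewrite (big_morph _ rvecD rvec0); apply: eq_bigr => j _.
  rewrite -!rvecZ -rvecD; congr rvec; rewrite scalerA -scalerDl.
  by congr (_ *: _); rewrite {1}(complexE (v 0 j)) [X in _ + X]mulrC.
have := df; rewrite /zdiff; set F := fun p => _; set p := rvec z => dF.
have M u1 u2 : cderiv (u1 + u2) F p = cderiv u1 F p + cderiv u2 F p.
  exact: cderiv_additive.
rewrite (big_morph _ M (cderiv0 _ _)); apply: eq_bigr => j _.
rewrite cderiv_additive // !cderiv_scale // /frame_deriv !real_derivE -/F -/p.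
rewrite conj_rect {3}(complexE (v 0 j)).
by rewrite -rect_frame ?sqr_i // pnatr_eq0.
Qed.

Lemma half_combD (F : fieldType) (s x y x' y' : F) :
  ((x + y) + s * (x' + y')) / 2%:R = (x + s * x') / 2%:R + (y + s * y') / 2%:R.
Proof. by rewrite mulrDr addrACA mulrDl. Qed.

Lemma half_combM (F : fieldType) (s x y x' y' a b : F) :
  ((x * b + a * y) + s * (x' * b + a * y')) / 2%:R =
  (x + s * x') / 2%:R * b + a * ((y + s * y') / 2%:R).
Proof. ring. Qed.

Lemma frame_derivE A f z : frame_deriv A f z =
  (real_deriv (delta_mx 0 (match A with inl k | inr k => k end)) f z +
   (if holo A then - 'i%C else 'i%C) *
   real_deriv ('i%C *: delta_mx 0 (match A with inl k | inr k => k end)) f z) / 2%:R.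
Proof. by case: A => k; rewrite /frame_deriv //= mulNr. Qed.

Lemma frame_derivD A f g z : zdiff f z -> zdiff g z ->
  frame_deriv A (fun x => f x + g x) z = frame_deriv A f z + frame_deriv A g z.
Proof.
by move=> df dg; rewrite !frame_derivE !real_derivE !cderivD // half_combD.
Qed.

Lemma frame_derivM A f g z : zdiff f z -> zdiff g z ->
  frame_deriv A (fun x => f x * g x) z =
  frame_deriv A f z * g z + f z * frame_deriv A g z.
Proof.
move=> df dg; rewrite !frame_derivE !real_derivE !cderivM //.
by rewrite rvecK half_combM.
Qed.

Lemma frame_deriv_cst A (c : C) z : frame_deriv A (fun=> c) z = 0.
Proof.
by rewrite frame_derivE !real_derivE !cderiv_cst mulr0 addr0 mul0r.
Qed.

Lemma frame_derivB A f g z : zdiff f z -> zdiff g z ->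
  frame_deriv A (fun x => f x - g x) z = frame_deriv A f z - frame_deriv A g z.
Proof.
move=> df dg; rewrite !frame_derivE !real_derivE !cderivB //.
by rewrite -mulrBl opprD addrACA -mulrBr.
Qed.

Lemma frame_deriv_sum (I : Type) (r : seq I) (F : I -> 'rV[C]_n -> C) A z :
  (forall i, zdiff (F i) z) ->
  frame_deriv A (fun x => \sum_(i <- r) F i x) z =
  \sum_(i <- r) frame_deriv A (F i) z.
Proof.
move=> dF; case: A => k; rewrite /frame_deriv !real_derivE !cderiv_sum //.
  by rewrite mulr_sumr -sumrB mulr_suml.
by rewrite mulr_sumr -big_split mulr_suml.
Qed.

Lemma conj_iM (x : C) : ('i%C * x)^* = - 'i%C * x^*.
Proof.
case: x => a b; apply: complex_eqP => /=; rewrite ?mul0r ?mul1r /=; ring.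
Qed.

Lemma conj_half_lin (x y : C) :
  ((x - 'i%C * y) / 2%:R)^* = (x^* + 'i%C * y^*) / 2%:R.
Proof.
by rewrite fmorph_div rmorphB /= conj_iM conjC_nat mulNr opprK.
Qed.

Lemma frame_deriv_conj A f z : zdiff f z ->
  frame_deriv A (fun x => (f x)^*) z = (frame_deriv (bar A) f z)^*.
Proof.
move=> df; case: A => k; rewrite /frame_deriv /bar !real_derivE !cderiv_conj //.
  set x := cderiv _ _ _; set y := cderiv _ _ _.
  have := conj_half_lin x (- y).
  by rewrite rmorphN mulrN mulrN opprK => ->.
by rewrite conj_half_lin.
Qed.

Lemma frame_deriv0_near A f g z : (\forall p \near rvec z, f (cvec p) = g (cvec p)) ->
  frame_deriv A f z = frame_deriv A g z.
Proof.
move=> fg; have E v : real_deriv v f z = real_deriv v g z by exact: cderiv_near.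
by case: A => k; rewrite /frame_deriv !E.
Qed.

Lemma open_punctured : open [set p : V | cvec p != 0].
Proof.
have -> : [set p : V | cvec p != 0] = ~` [set 0].
  apply/funext => p; apply/propext; split=> [/eqP np /= p0|/= np].
    by apply: np; rewrite p0 -rvec0 rvecK.
  by apply/eqP => cp; apply: np; rewrite -(cvecK p) cp rvec0.
apply: closed_openC; apply: accessible_closed_set1.
exact: hausdorff_accessible (@norm_hausdorff _ _).
Qed.

Lemma near_punctured (P : 'rV[C]_n -> Prop) z : z != 0 ->
  (forall x, x != 0 -> P x) -> \forall p \near rvec z, P (cvec p).
Proof.
move=> z0 PP; have : nbhs (rvec z) [set p : V | cvec p != 0].
  by apply: open_nbhs_nbhs; split; [exact: open_punctured|rewrite /= rvecK].
by apply: filterS => p; exact: PP.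
Qed.

(** The metrics, and all the identities between them, are only meaningful on the
    open set [z != 0]; this is how such an identity gets differentiated. *)
Lemma frame_deriv_punctured A f g z : z != 0 ->
  (forall x, x != 0 -> f x = g x) -> frame_deriv A f z = frame_deriv A g z.
Proof.
move=> z0 fg; apply: frame_deriv0_near.
exact: (near_punctured (P := fun x => f x = g x)).
Qed.

Lemma zdiff_punctured f g z : z != 0 ->
  (forall x, x != 0 -> f x = g x) -> zdiff f z -> zdiff g z.
Proof.
move=> z0 fg; apply: cdiff_near.
exact: (near_punctured (P := fun x => f x = g x)).
Qed.

Lemma zdiff_coord k z : zdiff (fun x => x 0 k) z.
Proof.
split.
  have -> : (fun p : V => complex.Re (cvec p 0 k) : R^o) = (fun p => p.1 0 k).
    by apply/funext => p; rewrite mxE.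
  exact: fst_coord_differentiable.
have -> : (fun p : V => complex.Im (cvec p 0 k) : R^o) = (fun p => p.2 0 k).
  by apply/funext => p; rewrite mxE.
exact: snd_coord_differentiable.
Qed.

Lemma linear_derive (W : normedModType R) (h : W -> R^o) (p v : W) :
  (forall (a : R) x y, h (a *: x + y) = a * h x + h y) -> 'D_v h p = h v.
Proof.
move=> hl; rewrite /derive.
apply: norm_lim_near_cst; near=> t.
rewrite /= hl addrK /GRing.scale /= mulrA mulVf ?mul1r //.
by near: t; exact: nbhs_dnbhs_neq.
Unshelve. all: by end_near. Qed.

Lemma real_deriv_coord v k z : real_deriv v (fun x => x 0 k) z = v 0 k.
Proof.
rewrite /real_deriv; apply: complex_eqP => /=.
  rewrite linear_derive => [|a [x1 x2] [y1 y2]]; by rewrite !mxE.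
rewrite linear_derive => [|a [x1 x2] [y1 y2]]; by rewrite !mxE.
Qed.

Lemma frame_deriv_coord A k z : frame_deriv A (fun x => x 0 k) z =
  if A is inl j then (j == k)%:R else 0.
Proof.
have i2 : 'i%C * 'i%C = -1 :> C by rewrite -expr2 sqr_i.
case: A => j; rewrite /frame_deriv !real_deriv_coord !mxE eqxx /= eq_sym mulrA i2.
  by rewrite mulN1r opprK mulrDl -splitr.
by rewrite mulN1r subrr mul0r.
Qed.

Lemma frame_deriv_coord_conj A k z : frame_deriv A (fun x => (x 0 k)^*) z =
  if A is inr j then (j == k)%:R else 0.
Proof.
rewrite frame_deriv_conj ?frame_deriv_coord; last exact: zdiff_coord.
by case: A => j /=; rewrite ?conjC_nat ?conjC0.
Qed.

Lemma zdiffV f z : zdiff f z -> f z != 0 -> zdiff (fun x => (f x)^-1) z.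
Proof. by move=> df fz; apply: cdiffV; rewrite // rvecK. Qed.

Lemma zdiff_linear (A : 'M[C]_n) z :
  differentiable (fun p : V => rvec (cvec p *m A)) (rvec z).
Proof.
pose F k : V -> V := fun p =>
  p.1 0 k *: rvec (row k A) + p.2 0 k *: rvec ('i%C *: row k A).
have -> : (fun p : V => rvec (cvec p *m A)) = \sum_(k < n) F k.
  apply/funext => p; rewrite mulmx_sum_row (big_morph _ rvecD rvec0) fct_sumE.
  apply: eq_bigr => k _; rewrite /F -!rvecZ -rvecD scalerA -scalerDl mxE.
  by congr (rvec (_ *: _)); rewrite {1}[LHS]complexE [X in _ + X]mulrC.
apply: differentiable_sum => k; apply: differentiableD; apply: differentiableZl.
  exact: fst_coord_differentiable.
exact: snd_coord_differentiable.
Qed.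

Lemma zdiff_comp f (A : 'M[C]_n) z : zdiff f (z *m A) -> zdiff (fun x => f (x *m A)) z.
Proof.
move=> [fr fi].
have E (h : C -> R) : differentiable (fun p : V => h (f (cvec p)) : R^o) (rvec (z *m A)) ->
    differentiable (fun p : V => h (f (cvec p *m A)) : R^o) (rvec z).
  move=> dh; have -> : (fun p : V => h (f (cvec p *m A)) : R^o) =
    (fun p : V => h (f (cvec p)) : R^o) \o (fun p : V => rvec (cvec p *m A)).
    by apply/funext => p /=; rewrite rvecK.
  apply: differentiable_comp; first exact: zdiff_linear.
  by rewrite rvecK.
by split; exact: E.
Qed.

Lemma real_deriv_comp v f (A : 'M[C]_n) z :
  real_deriv v (fun x => f (x *m A)) z = real_deriv (v *m A) f (z *m A).
Proof.
have E (h : C -> R) : 'D_(rvec v) (fun p : V => h (f (cvec p *m A)) : R^o) (rvec z) =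
   'D_(rvec (v *m A)) (fun p : V => h (f (cvec p)) : R^o) (rvec (z *m A)).
  rewrite /derive; apply: (congr1 (fun k : R -> R^o => lim (k t @[t --> 0^']))).
  apply/funext => t /=.
  by rewrite -!rvecZ -!rvecD !rvecK mulmxDl -scalemxAl.
by rewrite /real_deriv !E.
Qed.

Lemma frame_rect_holo (F : fieldType) (i x y c d : F) : i ^+ 2 = -1 ->
  2%:R != 0 :> F ->
  (c * x + d * y - i * (i * c * x + - i * d * y)) / 2%:R = c * x.
Proof. by move=> i2 h2; field : i2. Qed.

Lemma frame_rect_anti (F : fieldType) (i x y c d : F) : i ^+ 2 = -1 ->
  2%:R != 0 :> F ->
  (c * x + d * y + i * (i * c * x + - i * d * y)) / 2%:R = d * y.
Proof. by move=> i2 h2; field : i2. Qed.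

(** [z |-> z *m A] is holomorphic, so it does not mix the two types of
    derivatives. *)
Lemma frame_deriv_comp_holo k f (A : 'M[C]_n) z : zdiff f (z *m A) ->
  frame_deriv (inl k) (fun x => f (x *m A)) z =
  \sum_r A k r * frame_deriv (inl r) f (z *m A).
Proof.
move=> df; rewrite {1}/frame_deriv !real_deriv_comp !real_deriv_frame //.
rewrite mulr_sumr -sumrB mulr_suml; apply: eq_bigr => r _.
have -> : (delta_mx 0 k *m A : 'rV_n) 0 r = A k r by rewrite -rowE mxE.
have -> : ('i%C *: delta_mx 0 k *m A : 'rV_n) 0 r = 'i%C * A k r.
  by rewrite -scalemxAl -rowE !mxE.
rewrite conj_iM.
by rewrite frame_rect_holo ?sqr_i // pnatr_eq0.
Qed.

Lemma frame_deriv_comp_anti k f (A : 'M[C]_n) z : zdiff f (z *m A) ->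
  frame_deriv (inr k) (fun x => f (x *m A)) z =
  \sum_r (A k r)^* * frame_deriv (inr r) f (z *m A).
Proof.
move=> df; rewrite {1}/frame_deriv !real_deriv_comp !real_deriv_frame //.
rewrite mulr_sumr -big_split mulr_suml; apply: eq_bigr => r _.
have -> : (delta_mx 0 k *m A : 'rV_n) 0 r = A k r by rewrite -rowE mxE.
have -> : ('i%C *: delta_mx 0 k *m A : 'rV_n) 0 r = 'i%C * A k r.
  by rewrite -scalemxAl -rowE !mxE.
rewrite conj_iM.
by rewrite /= frame_rect_anti ?sqr_i // pnatr_eq0.
Qed.

End FrameCalculus.

(** * Smooth functions and smooth families *)

Section Smooth.
Variables (R : realType).

Lemma smooth_differentiable (V : normedModType R) (U : set V) (f : V -> R) p :
  smooth_on U f -> U p -> differentiable (f : V -> R^o) p.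
Proof. by move=> sf Up; exact: (sf [::]). Qed.

Lemma smooth_derive (V : normedModType R) (U : set V) (f : V -> R) v :
  smooth_on U f -> smooth_on U ('D_v (f : V -> R^o)).
Proof. by move=> sf vs p Up; have := sf (rcons vs v) p Up; rewrite foldr_rcons. Qed.

Lemma derive_lin (V : normedModType R) (h k : V -> R^o) (a b : R) p v :
  derivable h p v -> derivable k p v ->
  'D_v (a \*: h + b \*: k) p = a * 'D_v h p + b * 'D_v k p.
Proof.
move=> dh dk.
have dh' := @derivableZ R V R^o h a p v dh.
have dk' := @derivableZ R V R^o k b p v dk.
rewrite (@deriveD R V R^o _ _ p v dh' dk').
by rewrite (@deriveZ R V R^o h a p v dh) (@deriveZ R V R^o k b p v dk).
Qed.

(** Linearity of each iterated derivative holds only where the previous ones are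
    differentiable, that is on [U]; openness of [U] lets the induction go on. *)
Lemma smooth_lin (V : normedModType R) (U : set V) (f g : V -> R) (a b : R) :
  open U -> smooth_on U f -> smooth_on U g ->
  smooth_on U (fun q => a * f q + b * g q).
Proof.
move=> oU sf sg.
pose D (h : V -> R^o) vs := foldr (fun (v : V) (h : V -> R^o) => fun q => 'D_v h q) h vs.
have nU p : U p -> nbhs p U by move=> Up; exact: open_nbhs_nbhs.
have E vs : forall p, U p -> D (fun q => a * f q + b * g q) vs p =
    a * D f vs p + b * D g vs p.
  elim: vs => [|v vs IH] p Up //=.
  have -> : 'D_v (D (fun q => a * f q + b * g q) vs) p =
            'D_v (a \*: D f vs + b \*: D g vs : V -> R^o) p.
    apply: near_eq_derive; apply: filterS (nU _ Up) => q Uq; exact: IH.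
  have df := diff_derivable (v := v) (sf vs p Up).
  have dg := diff_derivable (v := v) (sg vs p Up).
  exact: (derive_lin a b df dg).
move=> vs p Up; rewrite -/(D _ vs).
apply: (@near_differentiable _ _ (a \*: D f vs + b \*: D g vs : V -> R^o)).
  by apply: filterS (nU _ Up) => q Uq; rewrite E.
by apply: differentiableD; apply: differentiableZ; [exact: sf|exact: sg].
Qed.

Lemma smooth_eq (V : normedModType R) (U : set V) (f g : V -> R) :
  open U -> (forall p, U p -> f p = g p) -> smooth_on U f -> smooth_on U g.
Proof.
move=> oU fg sf.
pose D (h : V -> R^o) vs := foldr (fun (v : V) (h : V -> R^o) => fun q => 'D_v h q) h vs.
have nU p : U p -> nbhs p U by move=> Up; exact: open_nbhs_nbhs.
have E vs : forall p, U p -> D f vs p = D g vs p.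
  elim: vs => [|v vs IH] p Up /=; first exact: fg.
  by apply: near_eq_derive; apply: filterS (nU _ Up) => q Uq; exact: IH.
move=> vs p Up; rewrite -/(D _ vs).
apply: (@near_differentiable _ _ (D f vs)); last exact: sf.
by apply: filterS (nU _ Up) => q Uq; rewrite E.
Qed.

Lemma smooth_comp (V W : normedModType R) (U : set V) (U' : set W) (f : V -> R)
    (L : W -> V) :
  (forall (a : R) x y, L (a *: x + y) = a *: L x + L y) ->
  (forall q, differentiable L q) -> (forall q, U' q -> U (L q)) ->
  smooth_on U f -> smooth_on U' (f \o L).
Proof.
move=> linL dL UU sf.
pose D (X : normedModType R) (h : X -> R^o) vs :=
  foldr (fun (v : X) (h : X -> R^o) => fun q => 'D_v h q) h vs.
have E vs : D W (f \o L) vs = D V f (map L vs) \o L.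
  elim: vs => //= v vs ->; apply/funext => q; rewrite /derive.
  apply: (congr1 (fun k : R -> R^o => lim (k t @[t --> 0^']))).
  by apply/funext => t /=; rewrite linL.
move=> vs p U'p; rewrite -/(D W _ vs) E.
by apply: differentiable_comp => //; exact/sf/UU.
Qed.

Lemma csmooth_cdiff (V : normedModType R) (U : set V) (f : V -> R[i]) p :
  csmooth_on U f -> U p -> cdiff f p.
Proof. by move=> [sr si] Up; split; exact: smooth_differentiable Up. Qed.

Lemma csmooth_cderiv (V : normedModType R) (U : set V) (f : V -> R[i]) v :
  csmooth_on U f -> csmooth_on U (cderiv v f).
Proof. by move=> [sr si]; split; exact: smooth_derive. Qed.

Lemma csmooth_eq (V : normedModType R) (U : set V) (f g : V -> R[i]) :
  open U -> (forall p, U p -> f p = g p) -> csmooth_on U f -> csmooth_on U g.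
Proof.
move=> oU fg [sr si]; split.
  by apply: smooth_eq sr => // p Up; rewrite fg.
by apply: smooth_eq si => // p Up; rewrite fg.
Qed.

Lemma csmoothD (V : normedModType R) (U : set V) (f g : V -> R[i]) :
  open U -> csmooth_on U f -> csmooth_on U g -> csmooth_on U (fun q => f q + g q).
Proof.
move=> oU [fr fi] [gr gi]; split.
  apply: smooth_eq (smooth_lin 1 1 oU fr gr) => // p _.
  by rewrite cReD !mul1r.
apply: smooth_eq (smooth_lin 1 1 oU fi gi) => // p _.
by rewrite cImD !mul1r.
Qed.

Lemma csmoothZ (V : normedModType R) (U : set V) (f : V -> R[i]) (c : R[i]) :
  open U -> csmooth_on U f -> csmooth_on U (fun q => c * f q).
Proof.
move=> oU [fr fi]; split.
  apply: smooth_eq (smooth_lin (complex.Re c) (- complex.Im c) oU fr fi) => // p _.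
  by rewrite cReM mulNr.
apply: smooth_eq (smooth_lin (complex.Re c) (complex.Im c) oU fi fr) => // p _.
by rewrite cImM.
Qed.

Lemma csmoothB (V : normedModType R) (U : set V) (f g : V -> R[i]) :
  open U -> csmooth_on U f -> csmooth_on U g -> csmooth_on U (fun q => f q - g q).
Proof.
move=> oU sf sg; under eq_fun do rewrite -mulN1r.
by apply: csmoothD => //; exact: csmoothZ.
Qed.

Lemma csmooth0 (V : normedModType R) (U : set V) :
  csmooth_on U (fun _ : V => 0 : R[i]).
Proof.
have D0 (vs : seq V) :
  foldr (fun (v : V) (h : V -> R^o) => fun q => 'D_v h q) (fun=> 0) vs = cst 0.
  by elim: vs => //= v vs ->; apply/funext => q; rewrite derive_cst.
by split => vs p Up; rewrite D0; exact: differentiable_cst.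
Qed.

Lemma csmooth_sum (V : normedModType R) (U : set V) (I : Type) (r : seq I)
    (F : I -> V -> R[i]) :
  open U -> (forall i, csmooth_on U (F i)) ->
  csmooth_on U (fun q => \sum_(i <- r) F i q).
Proof.
move=> oU sF; elim: r => [|i r IH].
  by apply: csmooth_eq (csmooth0 U) => // p _; rewrite big_nil.
apply: csmooth_eq (csmoothD oU (sF i) IH) => // p _.
by rewrite big_cons.
Qed.

Lemma csmooth_comp (V W : normedModType R) (U : set V) (U' : set W)
    (f : V -> R[i]) (L : W -> V) :
  (forall (a : R) x y, L (a *: x + y) = a *: L x + L y) ->
  (forall q, differentiable L q) -> (forall q, U' q -> U (L q)) ->
  csmooth_on U f -> csmooth_on U' (fun q => f (L q)).
Proof.
by move=> linL dL UU [sr si]; split; [exact: (smooth_comp linL dL UU sr)|exact: (smooth_comp linL dL UU si)].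
Qed.

End Smooth.

Section FrameSmooth.
Variables (R : realType) (n : nat).
Local Notation C := R[i].
Local Notation V := ('rV[R]_n * 'rV[R]_n)%type.
Implicit Types (z v : 'rV[C]_n) (A B : frame n).

Definition zsmooth (f : 'rV[C]_n -> C) :=
  csmooth_on [set p : V | cvec p != 0] (fun p => f (cvec p)).

Lemma zsmooth_zdiff f z : zsmooth f -> z != 0 -> zdiff f z.
Proof. by move=> sf z0; apply: csmooth_cdiff sf _; rewrite /= rvecK. Qed.

Lemma zsmooth_frame_deriv A f : zsmooth f -> zsmooth (frame_deriv A f).
Proof.
move=> sf; have oU := @open_punctured R n.
have E p : frame_deriv A f (cvec p) = 2%:R^-1 *
  (cderiv (rvec (delta_mx 0 (match A with inl k | inr k => k end))) (fun p : V => f (cvec p)) p +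
   (if holo A then - 'i%C else 'i%C) *
   cderiv (rvec ('i%C *: delta_mx 0 (match A with inl k | inr k => k end))) (fun p : V => f (cvec p)) p).
  by rewrite frame_derivE !real_derivE cvecK mulrC.
apply: (csmooth_eq oU); first by move=> p _; rewrite E.
apply: csmoothZ => //; apply: csmoothD => //; first exact: csmooth_cderiv.
by apply: csmoothZ => //; exact: csmooth_cderiv.
Qed.

Local Notation W := (R^o * V)%type.
Implicit Types (U : set W) (F : W -> C).

(** The space derivative [frame_deriv A] of a time-dependent function, seen as
    an operator on functions of [(t, p)], so that smoothness of the family gives
    joint continuity of the derivatives in [t] and [z]. *)
Definition jd A (F : W -> C) : W -> C :=
  fun q => frame_deriv A (fun z => F (q.1, rvec z)) (cvec q.2).

Lemma slice_cderiv F (t : R) (p v : V) :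
  cderiv v (fun x => F (t, x)) p = cderiv ((0, v) : W) F (t, p).
Proof.
have E (h : W -> R^o) : 'D_v (fun x : V => h (t, x)) p = 'D_((0, v) : W) h (t, p).
  rewrite /derive; apply: (congr1 (fun k : R -> R^o => lim (k t @[t --> 0^']))).
  apply/funext => s /=.
  have -> : s *: ((0, v) : W) + (t, p) = (t, s *: v + p).
    by congr pair; rewrite /= scaler0 add0r.
  by [].
rewrite /cderiv (E (fun q => complex.Re (F q))).
by rewrite (E (fun q => complex.Im (F q))).
Qed.

Lemma slice_cdiff F (t : R) (p : V) : cdiff F (t, p) -> cdiff (fun x => F (t, x)) p.
Proof.
have E (h : W -> R^o) : differentiable h (t, p) -> differentiable (fun x : V => h (t, x)) p.
  move=> dh; apply: (@differentiable_comp _ _ _ _ (fun x : V => (t, x) : W) h) => //.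
by move=> [fr fi]; split; [exact: E fr|exact: E fi].
Qed.

Lemma jdE A F q : jd A F q = 2%:R^-1 *
  (cderiv ((0, rvec (delta_mx 0 (match A with inl k | inr k => k end))) : W) F q +
   (if holo A then - 'i%C else 'i%C) *
   cderiv ((0, rvec ('i%C *: delta_mx 0 (match A with inl k | inr k => k end))) : W) F q).
Proof.
rewrite /jd frame_derivE !real_derivE cvecK mulrC.
have -> : (fun p : V => F (q.1, rvec (cvec p))) = (fun p => F (q.1, p)).
  by apply/funext => p; rewrite cvecK.
by rewrite !slice_cderiv; case: q.
Qed.

Lemma csmooth_jd A F U : open U -> csmooth_on U F -> csmooth_on U (jd A F).
Proof.
move=> oU sF; apply: (csmooth_eq oU); first by move=> q _; rewrite jdE.
apply: csmoothZ => //; apply: csmoothD => //; first exact: csmooth_cderiv.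
by apply: csmoothZ => //; exact: csmooth_cderiv.
Qed.

Lemma time_cdiff F (t : R) (p : V) : cdiff F (t, p) -> cdiff (fun s : R^o => F (s, p)) t.
Proof.
have E (h : W -> R^o) : differentiable h (t, p) -> differentiable (fun s : R^o => h (s, p)) t.
  move=> dh; apply: (@differentiable_comp _ _ _ _ (fun s : R^o => (s, p) : W) h) => //.
by move=> [fr fi]; split; [exact: E fr|exact: E fi].
Qed.

End FrameSmooth.

(** * Covariance of the expression of the flow *)

Section Contractions.
Variables (C : numClosedFieldType) (n : nat).
Implicit Types (G A : 'M[C]_n) (u v w : 'rV[C]_n) (D : 'I_n -> 'I_n -> 'I_n -> C).

(** The components of a Hermitian form after the linear change of frame [A]. *)
Definition pull A G : 'M[C]_n := A *m G *m (map_mx Num.conj A)^T.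

Lemma pullE A G i j :
  pull A G i j = \sum_p \sum_q A i p * (A j q)^* * G p q.
Proof.
rewrite mxE exchange_big; apply: eq_bigr => q _ /=.
rewrite mxE mulr_suml; apply: eq_bigr => p _.
by rewrite !mxE mulrAC.
Qed.

Definition contract G (Y : 'I_n -> 'I_n -> C) : C :=
  \sum_k \sum_l invmx G l k * Y k l.

Lemma contract_sum G (F : 'I_n -> 'I_n -> 'I_n -> C) :
  contract G (fun k l => \sum_p F p k l) = \sum_p contract G (F p).
Proof.
rewrite /contract [RHS]exchange_big; apply: eq_bigr => k _ /=.
rewrite [RHS]exchange_big; apply: eq_bigr => l _ /=.
by rewrite mulr_sumr.
Qed.

Lemma contractZ G (c : C) (F : 'I_n -> 'I_n -> C) :
  contract G (fun k l => c * F k l) = c * contract G F.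
Proof.
rewrite /contract mulr_sumr; apply: eq_bigr => k _.
by rewrite mulr_sumr; apply: eq_bigr => l _; rewrite mulrCA.
Qed.

Lemma invmx_pull A G : A \in unitmx -> G \in unitmx ->
  (map_mx Num.conj A)^T *m invmx (pull A G) *m A = invmx G.
Proof.
move=> Au Gu; have Bu : (map_mx Num.conj A)^T \in unitmx.
  by rewrite unitmx_tr map_unitmx.
rewrite /pull; set B := (_)^T in Bu *.
have Pu : A *m G *m B \in unitmx by rewrite !unitmx_mul Au Gu Bu.
have : (B *m invmx (A *m G *m B) *m A) *m G = 1%:M.
  rewrite -[LHS]mulmx1 -(mulmxV Bu) !mulmxA.
  rewrite -(mulmxA _ A G) -(mulmxA _ (A *m G) B) -(mulmxA B).
  by rewrite mulVmx // mulmx1.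
by move/(congr1 (mulmx^~ (invmx G))); rewrite mul1mx mulmxK.
Qed.

(** The two transformation matrices of [Y] cancel against those of the inverse
    of the transformed metric. *)
Lemma contract_pull A G (Y : 'I_n -> 'I_n -> C) : A \in unitmx -> G \in unitmx ->
  contract (pull A G) (fun k l => \sum_a \sum_b A k a * (A l b)^* * Y a b) =
  contract G Y.
Proof.
move=> Au Gu; rewrite /contract -(invmx_pull Au Gu); set H := invmx _.
under eq_bigr => k _ do under eq_bigr => l _ do rewrite mulr_sumr.
under eq_bigr => k _ do rewrite exchange_big /=.
rewrite exchange_big; apply: eq_bigr => a _ /=.
under eq_bigr => k _ do under eq_bigr => l _ do rewrite mulr_sumr.
under eq_bigr => k _ do rewrite exchange_big /=.
rewrite exchange_big; apply: eq_bigr => b _ /=.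
rewrite mxE mulr_suml; apply: eq_bigr => k _.
rewrite mxE !mulr_suml; apply: eq_bigr => l _.
by rewrite !mxE; ring.
Qed.

(** Linearity and antilinearity in each slot, rather than explicit
    transformation rules for six indices, make naturality of the quadratic part
    a formal consequence of [contract_sesq]. *)
Definition lin (F : 'rV[C]_n -> C) :=
  forall (c : C) u v, F (c *: u + v) = c * F u + F v.
Definition anti (F : 'rV[C]_n -> C) :=
  forall (c : C) u v, F (c *: u + v) = c^* * F u + F v.

Lemma lin_expand F u : lin F -> F u = \sum_a u 0 a * F (delta_mx 0 a).
Proof.
move=> lF; have F0 : F 0 = 0.
  by have := lF (-1) 0 0; rewrite scaleN1r addNr mulN1r addNr.
rewrite {1}(row_sum_delta u).
elim: (index_enum _) => [|a r IH]; first by rewrite !big_nil.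
by rewrite !big_cons lF IH.
Qed.

Lemma anti_expand F u : anti F -> F u = \sum_a (u 0 a)^* * F (delta_mx 0 a).
Proof.
move=> lF; have F0 : F 0 = 0.
  by have := lF (-1) 0 0; rewrite scaleN1r addNr rmorphN1 mulN1r addNr.
rewrite {1}(row_sum_delta u).
elim: (index_enum _) => [|a r IH]; first by rewrite !big_nil.
by rewrite !big_cons lF IH.
Qed.

Lemma contract_sesq A G (F : 'rV[C]_n -> 'rV[C]_n -> C) :
  A \in unitmx -> G \in unitmx ->
  (forall w, lin (F^~ w)) -> (forall u, anti (F u)) ->
  contract (pull A G) (fun k l => F (row k A) (row l A)) =
  contract G (fun k l => F (delta_mx 0 k) (delta_mx 0 l)).
Proof.
move=> Au Gu lF aF; rewrite -(contract_pull _ Au Gu).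
apply: eq_bigr => k _; apply: eq_bigr => l _; congr (_ * _).
rewrite (lin_expand _ (lF _)); apply: eq_bigr => a _; rewrite mxE.
rewrite (anti_expand _ (aF _)) mulr_sumr; apply: eq_bigr => b _; rewrite mxE.
by rewrite mulrA.
Qed.

(** In a new frame the components of [D] are the values of this form on the rows
    of [A]. *)
Definition tri D u v w : C := \sum_a \sum_b \sum_c u 0 a * v 0 b * (w 0 c)^* * D a b c.

Lemma tri1 D v w : lin (fun u => tri D u v w).
Proof.
move=> c u u'; rewrite /tri mulr_sumr -big_split; apply: eq_bigr => a _ /=.
rewrite mulr_sumr -big_split; apply: eq_bigr => b _ /=.
rewrite mulr_sumr -big_split; apply: eq_bigr => d _ /=.
by rewrite !mxE; ring.
Qed.

Lemma tri2 D u w : lin (fun v => tri D u v w).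
Proof.
move=> c v v'; rewrite /tri mulr_sumr -big_split; apply: eq_bigr => a _ /=.
rewrite mulr_sumr -big_split; apply: eq_bigr => b _ /=.
rewrite mulr_sumr -big_split; apply: eq_bigr => d _ /=.
by rewrite !mxE; ring.
Qed.

Lemma tri3 D u v : anti (fun w => tri D u v w).
Proof.
move=> c w w'; rewrite /tri mulr_sumr -big_split; apply: eq_bigr => a _ /=.
rewrite mulr_sumr -big_split; apply: eq_bigr => b _ /=.
rewrite mulr_sumr -big_split; apply: eq_bigr => d _ /=.
by rewrite !mxE rmorphD rmorphM /=; ring.
Qed.

Lemma tri_delta D a b c :
  tri D (delta_mx 0 a) (delta_mx 0 b) (delta_mx 0 c) = D a b c.
Proof.
rewrite /tri (bigD1 a) //= [X in _ + X]big1 => [|i ia]; last first.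
  by apply: big1 => j _; apply: big1 => k _; rewrite !mxE (negPf ia) andbF !mul0r.
rewrite addr0 (bigD1 b) //= [X in _ + X]big1 => [|i ia]; last first.
  by apply: big1 => j _; rewrite !mxE (negPf ia) andbF mulr0 !mul0r.
rewrite addr0 (bigD1 c) //= [X in _ + X]big1 => [|i ia]; last first.
  by rewrite !mxE (negPf ia) andbF conjC0 mulr0 !mul0r.
by rewrite !mxE !eqxx conjC1 !mul1r !addr0.
Qed.

Variables (c1 c2 c3 c4 : C).

Definition skew3 (I : Type) (D : I -> I -> I -> C) i k m := D i k m - D k i m.

(** [D k i j] plays the role of the derivatives [d_k g_{i \bar j}], and [skew3 D]
    that of the torsion of the Chern connection. The first term comes from the
    curvature in [S], the others from [Q^1], ..., [Q^4] before contraction. *)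
Definition quad6 (I : Type) (D : I -> I -> I -> C) i k m j l p : C :=
  - (D k i p * (D l j m)^*) +
  (c1 * (skew3 D i k p * (skew3 D j l m)^*) +
   c2 * (skew3 D k m j * (skew3 D l p i)^*) +
   c3 * (skew3 D i k l * (skew3 D j p m)^*) +
   c4 * (2%:R^-1 * (skew3 D m k l * (skew3 D p j i)^* + skew3 D m i j * (skew3 D p l k)^*))).

Definition contract2 G (X : 'I_n -> 'I_n -> 'I_n -> 'I_n -> 'I_n -> 'I_n -> C) i j : C :=
  contract G (fun k l => contract G (fun m p => X i k m j l p)).

(** Each term of [quad6] is linear in [i], [k], [m] and antilinear in [j], [l],
    [p]. *)
Lemma quad6_pull A G D i j : A \in unitmx -> G \in unitmx ->
  contract2 (pull A G) (quad6 (fun k i j => tri D (row k A) (row i A) (row j A))) i j =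
  \sum_a \sum_b A i a * (A j b)^* * contract2 G (quad6 D) a b.
Proof.
move=> Au Gu; pose Q := quad6 (tri D).
have t1 E c u u' v w : tri E (c *: u + u') v w = c * tri E u v w + tri E u' v w.
  exact: (tri1 E v w c u u').
have t2 E c u v v' w : tri E u (c *: v + v') w = c * tri E u v w + tri E u v' w.
  exact: (tri2 E u w c v v').
have t3 E c u v w w' : tri E u v (c *: w + w') = c^* * tri E u v w + tri E u v w'.
  exact: (tri3 E u v c w w').
have s := (t1, t2, t3).
have Q1 k m j' l p : lin (fun i => Q i k m j' l p).
  by move=> c u v; rewrite /Q /quad6 /skew3 !s !(rmorphD, rmorphN, rmorphM) /= ?conjCK; ring.
have Q2 i' m j' l p : lin (fun k => Q i' k m j' l p).
  by move=> c u v; rewrite /Q /quad6 /skew3 !s !(rmorphD, rmorphN, rmorphM) /= ?conjCK; ring.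
have Q3 i' k j' l p : lin (fun m => Q i' k m j' l p).
  by move=> c u v; rewrite /Q /quad6 /skew3 !s !(rmorphD, rmorphN, rmorphM) /= ?conjCK; ring.
have Q4 i' k m l p : anti (fun j => Q i' k m j l p).
  by move=> c u v; rewrite /Q /quad6 /skew3 !s !(rmorphD, rmorphN, rmorphM) /=; ring.
have Q5 i' k m j' p : anti (fun l => Q i' k m j' l p).
  by move=> c u v; rewrite /Q /quad6 /skew3 !s !(rmorphD, rmorphN, rmorphM) /=; ring.
have Q6 i' k m j' l : anti (fun p => Q i' k m j' l p).
  by move=> c u v; rewrite /Q /quad6 /skew3 !s !(rmorphD, rmorphN, rmorphM) /=; ring.
pose e a : 'rV[C]_n := delta_mx 0 a.
have cl (H : 'I_n -> 'I_n -> 'rV[C]_n -> C) : (forall k l, lin (H k l)) ->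
   lin (fun u => contract G (fun k l => H k l u)).
  move=> lH c u v; rewrite /contract mulr_sumr -big_split; apply: eq_bigr => k _ /=.
  rewrite mulr_sumr -big_split; apply: eq_bigr => l _ /=.
  by rewrite lH; ring.
have ca (H : 'I_n -> 'I_n -> 'rV[C]_n -> C) : (forall k l, anti (H k l)) ->
   anti (fun u => contract G (fun k l => H k l u)).
  move=> lH c u v; rewrite /contract mulr_sumr -big_split; apply: eq_bigr => k _ /=.
  rewrite mulr_sumr -big_split; apply: eq_bigr => l _ /=.
  by rewrite lH; ring.
transitivity (contract (pull A G) (fun k l => contract G (fun m p =>
    Q (row i A) (row k A) (e m) (row j A) (row l A) (e p)))).
  apply: eq_bigr => k _; apply: eq_bigr => l _; congr (_ * _).
  by rewrite -(contract_sesq (F := fun m p => Q (row i A) (row k A) m (row j A) (row l A) p) Au Gu).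
rewrite (contract_sesq (F := fun k l => contract G (fun m p =>
    Q (row i A) k (e m) (row j A) l (e p))) Au Gu); last 2 first.
- by move=> w; apply: cl => *; exact: Q2.
- by move=> w; apply: ca => *; exact: Q5.
pose Z u v := contract G (fun k l => contract G (fun m p =>
    Q u (e k) (e m) v (e l) (e p))).
rewrite -[LHS]/(Z (row i A) (row j A)).
have Z1 v : lin (Z^~ v) by apply: (cl) => k l; apply: cl => m p; exact: Q1.
have Z2 u : anti (Z u) by apply: (ca) => k l; apply: ca => m p; exact: Q4.
rewrite (lin_expand _ (Z1 _)); apply: eq_bigr => a _; rewrite mxE.
rewrite (anti_expand _ (Z2 _)) mulr_sumr; apply: eq_bigr => b _; rewrite mxE mulrA.
congr (_ * _); apply: eq_bigr => k _; apply: eq_bigr => l _; congr (_ * _).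
apply: eq_bigr => m _; apply: eq_bigr => p _; congr (_ * _).
by rewrite /Q /quad6 /skew3 !tri_delta.
Qed.

(** The right-hand side [- S + Q] of the flow, as a function of the metric [G]
    and of the arrays [D] of its first derivatives and [Y] of its second
    derivatives at a point: the principal part is the Laplacian of [G]. *)
Definition hcf_expr G D (Y : 'I_n -> 'I_n -> 'I_n -> 'I_n -> C) i j : C :=
  contract G (fun k l => Y k l i j) + contract2 G (quad6 D) i j.

(** Covariance of the flow equation under holomorphic linear maps. *)
Lemma hcf_expr_pull A G D (Y : 'I_n -> 'I_n -> 'I_n -> 'I_n -> C) i j :
  A \in unitmx -> G \in unitmx ->
  hcf_expr (pull A G) (fun k i j => tri D (row k A) (row i A) (row j A))
    (fun k l i j => \sum_a \sum_b A k a * (A l b)^* *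
        \sum_p \sum_q A i p * (A j q)^* * Y a b p q) i j =
  \sum_p \sum_q A i p * (A j q)^* * hcf_expr G D Y p q.
Proof.
move=> Au Gu; rewrite /hcf_expr quad6_pull // contract_pull //.
under [RHS]eq_bigr => p _ do under eq_bigr => q _ do rewrite mulrDr.
under [RHS]eq_bigr => p _ do rewrite big_split /=.
rewrite big_split contract_sum; congr (_ + _); apply: eq_bigr => p _.
by rewrite contract_sum; apply: eq_bigr => q _; rewrite contractZ.
Qed.

End Contractions.

(** * The flow equation in coordinates *)

Section PositiveMatrices.
Variables (C : numClosedFieldType) (n : nat).
Implicit Types (G : 'M[C]_n) (v : 'rV[C]_n).

Definition herm_form G v : C := \sum_i \sum_j G i j * v 0 i * (v 0 j)^*.
Definition posdef G := forall v, v != 0 -> 0 < herm_form G v.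

Lemma herm_formE G v : herm_form G v = (v *m G *m (map_mx Num.conj v)^T) 0 0.
Proof.
rewrite mxE /herm_form exchange_big; apply: eq_bigr => j _ /=.
rewrite !mxE mulr_suml; apply: eq_bigr => i _; congr (_ * _); exact: mulrC.
Qed.

Lemma posdef_unitmx G : posdef G -> G \in unitmx.
Proof.
move=> pG; rewrite -row_free_unit -kermx_eq0; apply/negPn/negP => k0.
have v0 : nz_row (kermx G) != 0 by rewrite nz_row_eq0.
have := pG _ v0; rewrite herm_formE.
have /sub_kermxP -> := nz_row_sub (kermx G).
by rewrite mul0mx mxE ltxx.
Qed.

Lemma pull_comp (A B G : 'M[C]_n) : pull A (pull B G) = pull (A *m B) G.
Proof. by rewrite /pull map_mxM trmx_mul !mulmxA. Qed.

Lemma herm_form_pull (A G : 'M[C]_n) v : herm_form (pull A G) v = herm_form G (v *m A).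
Proof. by rewrite !herm_formE /pull map_mxM trmx_mul !mulmxA. Qed.

Lemma pull_posdef (A G : 'M[C]_n) : A \in unitmx -> posdef G -> posdef (pull A G).
Proof.
move=> Au pG v v0; rewrite herm_form_pull; apply: pG.
by apply: contra v0 => /eqP vA; rewrite -(mulmxK Au v) vA mul0mx.
Qed.
End PositiveMatrices.

Section FunctionAlgebra.
Variables (C : fieldType) (X : Type) (P : (X -> C) -> Prop) (x0 : X).
Hypothesis Pcst : forall c, P (fun=> c).
Hypothesis PD : forall f g, P f -> P g -> P (fun x => f x + g x).
Hypothesis PM : forall f g, P f -> P g -> P (fun x => f x * g x).
Hypothesis PV : forall f, P f -> f x0 != 0 -> P (fun x => (f x)^-1).

Lemma closed_sum (I : Type) (r : seq I) (F : I -> X -> C) :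
  (forall i, P (F i)) -> P (fun x => \sum_(i <- r) F i x).
Proof.
move=> PF; elim: r => [|i r IH]; first by under eq_fun do rewrite big_nil.
by under eq_fun do rewrite big_cons; apply: PD.
Qed.

Lemma closed_prod (I : Type) (r : seq I) (F : I -> X -> C) :
  (forall i, P (F i)) -> P (fun x => \prod_(i <- r) F i x).
Proof.
move=> PF; elim: r => [|i r IH]; first by under eq_fun do rewrite big_nil.
by under eq_fun do rewrite big_cons; apply: PM.
Qed.

(** Abstract in the class [P], so that one argument through Cramer's rule serves
    both the pointwise and the space-time differentiability of the inverse. *)
Lemma closed_det m (M : X -> 'M[C]_m) :
  (forall i j, P (fun x => M x i j)) -> P (fun x => \det (M x)).
Proof.
move=> PE; apply: closed_sum => s; apply: PM; first exact: Pcst.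
exact: closed_prod.
Qed.

Lemma closed_cramer m (M : X -> 'M[C]_m) i j :
  (forall i j, P (fun x => M x i j)) -> M x0 \in unitmx ->
  P (fun x => (\det (M x))^-1 * \adj (M x) i j).
Proof.
move=> PE u0; apply: PM.
  by apply: PV; [exact: closed_det|rewrite -unitfE -unitmxE].
under eq_fun do rewrite mxE; apply: PM; first exact: Pcst.
apply: closed_det => k l; under eq_fun do rewrite !mxE; exact: PE.
Qed.

End FunctionAlgebra.

Lemma invmxE (C : fieldType) m (M : 'M[C]_m) i j : M \in unitmx ->
  invmx M i j = (\det M)^-1 * \adj M i j.
Proof. by move=> Mu; rewrite /invmx Mu mxE. Qed.

Section ChernConnection.
Variables (R : realType) (n : nat).
Local Notation C := R[i].
Implicit Types (g : metric R n) (z : 'rV[C]_n) (Gam : connection R n).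

Definition d1 g z (k i j : 'I_n) : C := frame_deriv (inl k) (fun x => g x i j) z.
Definition d2 g z (k l i j : 'I_n) : C :=
  frame_deriv (inr l) (frame_deriv (inl k) (fun x => g x i j)) z.

Lemma hermitian_unitmx g z : hermitian_metric g -> z != 0 -> g z \in unitmx.
Proof. by move=> [_ _ pg] z0; apply: posdef_unitmx => v; exact: pg. Qed.

Lemma hermitian_zsmooth g i j : hermitian_metric g -> zsmooth (fun x => g x i j).
Proof. by case=> sg _ _; exact: sg. Qed.

Lemma big_frame (F : frame n -> C) :
  \sum_E F E = \sum_k F (inl k) + \sum_k F (inr k).
Proof. by rewrite big_sumType. Qed.

(** [nabla J = 0] makes the connection preserve the eigenspaces of [J]. *)
Lemma connection_type g Gam A B D z : hermitian_connection g Gam -> z != 0 ->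
  holo B != holo D -> Gam A B D z = 0.
Proof.
move=> hG z0 BD; have [_ _ /(_ A B D)] := hG z z0.
have i0 : 'i%C + 'i%C != 0 :> C.
  by rewrite -mulr2n mulrn_eq0 /= eq_complex /= negb_and oner_eq0 orbT.
have E (x y c : C) : x + x != 0 -> y = - x -> x * c = c * y -> c = 0.
  move=> xx -> /eqP; rewrite mulrN mulrC -addr_eq0 -mulrDr mulf_eq0 (negPf xx).
  by rewrite orbF => /eqP.
rewrite /Jval; case: B D BD => [b|b] [d|d] //= _.
  exact: (E 'i%C (- 'i%C) _ i0 erefl).
by apply: (E (- 'i%C) 'i%C); rewrite ?opprK // -opprD oppr_eq0.
Qed.

Lemma d1_conj g z l p j : hermitian_metric g -> z != 0 ->
  frame_deriv (inr l) (fun x => g x p j) z = (d1 g z l j p)^*.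
Proof.
move=> hg z0; have [_ hs _] := hg.
rewrite /d1 -(frame_deriv_conj (inr l)); last first.
  exact: zsmooth_zdiff (hermitian_zsmooth _ _ hg) z0.
by apply: frame_deriv_punctured => // x x0; exact: hs.
Qed.

Lemma zdiff_invmx g z q p : hermitian_metric g -> z != 0 ->
  zdiff (fun x => invmx (g x) q p) z.
Proof.
move=> hg z0.
apply: (zdiff_punctured (f := fun x => (\det (g x))^-1 * \adj (g x) q p) z0).
  by move=> x x0; rewrite invmxE //; exact: hermitian_unitmx.
apply: (closed_cramer (P := fun f => zdiff f z) (x0 := z)).
- by move=> c; exact: cdiff_cst.
- by move=> f h; exact: cdiffD.
- by move=> f h; exact: cdiffM.
- by move=> f; exact: zdiffV.
- by move=> i j; exact: zsmooth_zdiff (hermitian_zsmooth _ _ hg) z0.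
- exact: hermitian_unitmx.
Qed.

Section Chern.
Variables (g : metric R n) (Gam : connection R n).
Hypotheses (hg : hermitian_metric g) (hG : chern_connection g Gam).

Lemma chern_d1 z k i j : z != 0 ->
  d1 g z k i j = \sum_p Gam (inl k) (inl i) (inl p) z * g z p j.
Proof.
move=> z0; have [hc h01] := hG; have [hreal hcpt _] := hc z z0.
apply: etrans (hcpt (inl k) (inl i) (inr j)) _.
rewrite !big_frame /= [X in _ + X + _]big1 ?addr0; last by move=> p _; rewrite mulr0.
rewrite [X in _ + (X + _)]big1 ?add0r; last by move=> p _; rewrite mulr0.
rewrite [X in _ + X]big1 ?addr0 // => p _.
have := hreal (inr k) (inl j) (inl p) => /= ->.
by rewrite h01 // conjC0 mul0r.
Qed.

(** In the holomorphic frame [d/dz_j] the Chern connection matrix is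
    [(dg) g^-1]; the remaining mixed components vanish by definition. *)
Lemma chern_christoffel z k i p : z != 0 ->
  Gam (inl k) (inl i) (inl p) z = \sum_q d1 g z k i q * invmx (g z) q p.
Proof.
move=> z0; have gu := hermitian_unitmx hg z0.
pose N := \matrix_(i, p) Gam (inl k) (inl i) (inl p) z.
have -> : Gam (inl k) (inl i) (inl p) z = (N *m g z *m invmx (g z)) i p.
  by rewrite mulmxK // mxE.
rewrite mxE; apply: eq_bigr => q _; congr (_ * _).
by rewrite chern_d1 // mxE; apply: eq_bigr => r _; rewrite mxE.
Qed.

Lemma chern_torsion z i k m : z != 0 -> Tlow g Gam z i k m = skew3 (d1 g z) i k m.
Proof.
move=> z0; rewrite /Tlow /torsion_low /torsion /skew3 !chern_d1 // big_frame /=.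
rewrite [X in _ + X]big1 ?addr0; last by move=> p _; rewrite mulr0.
by rewrite -sumrB; apply: eq_bigr => p _; rewrite mulrBl.
Qed.

Lemma chern_zdiff z k i p : z != 0 -> zdiff (Gam (inl k) (inl i) (inl p)) z.
Proof.
move=> z0; apply: (zdiff_punctured
   (f := fun x => \sum_q d1 g x k i q * invmx (g x) q p) z0).
  by move=> x x0; rewrite chern_christoffel.
apply: cdiff_sum => q; apply: cdiffM; last exact: zdiff_invmx.
exact: zsmooth_zdiff (zsmooth_frame_deriv _ (hermitian_zsmooth _ _ hg)) z0.
Qed.

(** Differentiate [d_k g = Gamma g] along [d/d(conj z_l)]: the derivative of
    [Gamma] is the only surviving term of the curvature. *)
Lemma chern_curvature z k l i j : z != 0 ->
  curvature_low g Gam (inl k) (inr l) (inl i) (inr j) z =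
  - d2 g z k l i j +
  \sum_p \sum_q d1 g z k i q * invmx (g z) q p * (d1 g z l j p)^*.
Proof.
move=> z0; have [hc h01] := hG.
have dg a b : zdiff (fun x => g x a b) z.
  exact: zsmooth_zdiff (hermitian_zsmooth _ _ hg) z0.
have E : d2 g z k l i j = \sum_p (frame_deriv (inr l) (Gam (inl k) (inl i) (inl p)) z * g z p j
    + Gam (inl k) (inl i) (inl p) z * (d1 g z l j p)^*).
  rewrite /d2 (frame_deriv_punctured (g := fun x =>
     \sum_p Gam (inl k) (inl i) (inl p) x * g x p j) _ z0); last first.
    by move=> x x0; rewrite -chern_d1.
  rewrite frame_deriv_sum; last first.
    by move=> p; exact: cdiffM (chern_zdiff k i p z0) (dg p j).
  apply: eq_bigr => p _; rewrite frame_derivM //; last exact: chern_zdiff.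
  by rewrite d1_conj.
rewrite {}E big_split opprD -addrA /curvature_low big_frame /=.
rewrite [X in _ + X = _]big1 ?addr0; last by move=> p _; rewrite mulr0.
rewrite [X in _ = _ + X](_ : _ = 0) ?addr0; last first.
  apply/eqP; rewrite addrC subr_eq0; apply/eqP; apply: eq_bigr => p _.
  by rewrite chern_christoffel // mulr_suml.
rewrite -sumrN; apply: eq_bigr => p _; rewrite -mulNr; congr (_ * _).
rewrite /curvature (frame_deriv_punctured (g := fun=> 0) _ z0); last first.
  by move=> x x0; rewrite h01.
rewrite frame_deriv_cst sub0r big_frame.
rewrite !big1 ?addr0 // => q _; rewrite ?h01 // ?mulr0 ?mul0r ?subrr //.
by rewrite (connection_type _ hc) // mul0r subrr.
Qed.

(** The flow becomes an explicit second-order system on [C^n] minus the origin,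
    from which the connection has disappeared. *)
Lemma chern_hcf (c1 c2 c3 c4 : R) z i j : z != 0 ->
  - hcf_S g Gam z i j +
    (c1%:C * hcf_Q1 g Gam z i j + c2%:C * hcf_Q2 g Gam z i j
     + c3%:C * hcf_Q3 g Gam z i j + c4%:C * hcf_Q4 g Gam z i j) =
  hcf_expr c1%:C c2%:C c3%:C c4%:C (g z) (d1 g z) (d2 g z) i j.
Proof.
move=> z0; pose T := skew3 (d1 g z).
pose K X := contract2 (g z) X i j.
have KE (X : 'I_n -> 'I_n -> 'I_n -> 'I_n -> 'I_n -> 'I_n -> C) :
   \sum_k \sum_l \sum_m \sum_p ginv g z k l * ginv g z m p * X i k m j l p = K X.
  apply: eq_bigr => k _; apply: eq_bigr => l _; rewrite mulr_sumr.
  apply: eq_bigr => m _; rewrite mulr_sumr; apply: eq_bigr => p _.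
  by rewrite mulrA.
have KD X Y : K (fun i k m j l p => X i k m j l p + Y i k m j l p) = K X + K Y.
  rewrite -!KE -big_split; apply: eq_bigr => k _ /=.
  rewrite -big_split; apply: eq_bigr => l _ /=.
  rewrite -big_split; apply: eq_bigr => m _ /=.
  rewrite -big_split; apply: eq_bigr => p _ /=.
  by rewrite mulrDr.
have KZ c X : K (fun i k m j l p => c * X i k m j l p) = c * K X.
  rewrite -!KE mulr_sumr; apply: eq_bigr => k _.
  rewrite mulr_sumr; apply: eq_bigr => l _.
  rewrite mulr_sumr; apply: eq_bigr => m _.
  rewrite mulr_sumr; apply: eq_bigr => p _.
  by rewrite mulrCA.
have E1 : hcf_Q1 g Gam z i j = K (fun i k m j l p => T i k p * (T j l m)^*).
  rewrite -KE; do 4 (apply: eq_bigr => ? _).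
  by rewrite /Tlow_bar !chern_torsion.
have E2 : hcf_Q2 g Gam z i j = K (fun i k m j l p => T k m j * (T l p i)^*).
  rewrite -KE; do 4 (apply: eq_bigr => ? _).
  by rewrite /Tlow_bar !chern_torsion.
have E3 : hcf_Q3 g Gam z i j = K (fun i k m j l p => T i k l * (T j p m)^*).
  rewrite -KE; do 4 (apply: eq_bigr => ? _).
  by rewrite /Tlow_bar !chern_torsion.
have E4 : hcf_Q4 g Gam z i j = K (fun i k m j l p => 2%:R^-1 *
    (T m k l * (T p j i)^* + T m i j * (T p l k)^*)).
  rewrite KZ -KE /hcf_Q4; congr (_ * _); do 4 (apply: eq_bigr => ? _).
  by rewrite /Tlow_bar !chern_torsion.
have ES : - hcf_S g Gam z i j = contract (g z) (fun k l => d2 g z k l i j) +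
    K (fun i k m j l p => - (d1 g z k i p * (d1 g z l j m)^*)).
  have -> : (fun i k m j l p => - (d1 g z k i p * (d1 g z l j m)^*)) =
     (fun i k m j l p => -1 * (d1 g z k i p * (d1 g z l j m)^*)).
    by do 6 (apply/funext => ?); rewrite mulN1r.
  rewrite KZ -KE mulN1r /hcf_S -sumrN -sumrB; apply: eq_bigr => k _ /=.
  rewrite -sumrN -sumrB; apply: eq_bigr => l _ /=.
  rewrite chern_curvature // mulrDr mulrN opprD opprK; congr (_ - _).
  rewrite mulr_sumr; apply: eq_bigr => p _; rewrite mulr_sumr; apply: eq_bigr => q _.
  by rewrite -[RHS]mulrA; congr (_ * _); rewrite [RHS]mulrCA mulrA.
rewrite ES E1 E2 E3 E4 -!KZ -!KD -addrA; congr (_ + _).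
by rewrite -KD.
Qed.

End Chern.
End ChernConnection.

(** * Pulling back solutions *)

Section Solutions.
Variables (R : realType) (n : nat).
Local Notation C := R[i].
Local Notation V := ('rV[R]_n * 'rV[R]_n)%type.
Local Notation W := (R^o * V)%type.
Implicit Types (z : 'rV[C]_n) (A : 'M[C]_n).

(** [hcf_on_hopf] with the Chern connection eliminated. *)
Definition hcf_solution (b : 'rV[C]_n) (c1 c2 c3 c4 : R) (T : \bar R)
    (g : R -> metric R n) : Prop :=
  smooth_family T g /\
  forall t : R, 0 <= t -> (t%:E < T)%E -> hopf_hermitian_metric b (g t) /\
    forall z, z != 0 -> forall i j, time_deriv (fun s => g s z i j) t =
      hcf_expr c1%:C c2%:C c3%:C c4%:C (g t z) (d1 (g t) z) (d2 (g t) z) i j.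

Lemma hcf_on_hopf_solution b c1 c2 c3 c4 T g :
  hcf_on_hopf b c1 c2 c3 c4 T g -> hcf_solution b c1 c2 c3 c4 T g.
Proof.
move=> [sg eg]; split=> // t t0 tT; have [hg [Gam [hG E]]] := eg t t0 tT.
split=> // z z0 i j; rewrite E //; case: hg => hg _.
exact: chern_hcf.
Qed.

Definition pullm A (g : metric R n) : metric R n := fun z => pull A (g (z *m A)).

Lemma mulmx_neq0 A z : A \in unitmx -> z != 0 -> z *m A != 0.
Proof.
by move=> Au; apply: contra => /eqP zA; rewrite -(mulmxK Au z) zA mul0mx.
Qed.

Lemma hopf_mapE (b : 'rV[C]_n) z : hopf_map b z = z *m diag_mx b.
Proof.
by apply/rowP => i; rewrite mul_mx_diag !mxE mulrC.
Qed.

Lemma hopf_pull (b : 'rV[C]_n) (g : metric R n) z :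
  g z = pull (diag_mx b) (g (hopf_map b z)) <->
  forall i j, g z i j = g (hopf_map b z) i j * b 0 i * (b 0 j)^*.
Proof.
have E i j : pull (diag_mx b) (g (hopf_map b z)) i j =
    g (hopf_map b z) i j * b 0 i * (b 0 j)^*.
  rewrite /pull mul_diag_mx mxE (bigD1 j) //= big1 ?addr0 => [|q qj]; last first.
    by rewrite !mxE eq_sym (negPf qj) conjC0 mulr0.
  by rewrite !mxE eqxx mulr1n; congr (_ * _); exact: mulrC.
split=> [-> i j|H]; last by apply/matrixP => i j; rewrite E.
by rewrite E.
Qed.

Section Pull.
Variables (A : 'M[C]_n).
Hypothesis Au : A \in unitmx.

Lemma pullm_d1 (g : metric R n) z : hermitian_metric g -> z != 0 ->
  d1 (pullm A g) z =
  (fun k i j => tri (d1 g (z *m A)) (row k A) (row i A) (row j A)).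
Proof.
move=> hg z0; have zA0 := mulmx_neq0 Au z0.
apply/funext => k; apply/funext => i; apply/funext => j.
have dg p q : zdiff (fun x => g x p q) (z *m A).
  exact: zsmooth_zdiff (hermitian_zsmooth _ _ hg) zA0.
rewrite /d1 (_ : (fun x => pullm A g x i j) = (fun x =>
   \sum_p \sum_q A i p * (A j q)^* * g (x *m A) p q)); last first.
  by apply/funext => x; rewrite /pullm pullE.
have dgA p q : zdiff (fun x => A i p * (A j q)^* * g (x *m A) p q) z.
  by apply: cdiffM; [exact: cdiff_cst|exact: (zdiff_comp (f := fun x => g x p q))].
rewrite frame_deriv_sum; last by move=> p; apply: cdiff_sum => q; exact: dgA.
rewrite /tri [RHS]exchange_big; apply: eq_bigr => p _ /=.
rewrite frame_deriv_sum; last by move=> q; exact: dgA.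
rewrite [RHS]exchange_big; apply: eq_bigr => q _ /=.
rewrite (@frame_derivM R n _ (fun=> A i p * (A j q)^*) (fun x => g (x *m A) p q)); last 2 first.
- exact: cdiff_cst.
- exact: (zdiff_comp (f := fun x => g x p q)).
rewrite frame_deriv_cst mul0r add0r (frame_deriv_comp_holo _ (dg p q)) mulr_sumr.
by apply: eq_bigr => r _; rewrite !mxE; rewrite !mulrA [_ * A k r]mulrC !mulrA.
Qed.

Lemma pullm_d2 (g : metric R n) z : hermitian_metric g -> z != 0 ->
  d2 (pullm A g) z = (fun k l i j => \sum_a \sum_b A k a * (A l b)^* *
    \sum_p \sum_q A i p * (A j q)^* * d2 g (z *m A) a b p q).
Proof.
move=> hg z0; have zA0 := mulmx_neq0 Au z0.
apply/funext => k; apply/funext => l; apply/funext => i; apply/funext => j.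
have d1g a p q : zdiff (fun x => d1 g x a p q) (z *m A).
  exact: zsmooth_zdiff (zsmooth_frame_deriv _ (hermitian_zsmooth _ _ hg)) zA0.
rewrite /d2 (frame_deriv_punctured (g := fun x =>
   \sum_a \sum_p \sum_q (A k a * A i p * (A j q)^*) * d1 g (x *m A) a p q) _ z0);
  last first.
  move=> y y0; have := congr1 (fun F => F k i j) (pullm_d1 hg y0).
  rewrite /d1 /tri => ->; apply: eq_bigr => a _; apply: eq_bigr => p _.
  by apply: eq_bigr => q _; rewrite !mxE.
have dgA a p q : zdiff (fun x => (A k a * A i p * (A j q)^*) * d1 g (x *m A) a p q) z.
  by apply: cdiffM; [exact: cdiff_cst|exact: (zdiff_comp (f := fun x => d1 g x a p q))].
rewrite frame_deriv_sum; last first.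
  by move=> a; apply: cdiff_sum => p; apply: cdiff_sum => q; exact: dgA.
apply: eq_bigr => a _; rewrite frame_deriv_sum; last first.
  by move=> p; apply: cdiff_sum => q; exact: dgA.
rewrite (eq_bigr (fun p => \sum_q \sum_b A k a * A i p * (A j q)^* *
   ((A l b)^* * d2 g (z *m A) a b p q))) => [|p _]; last first.
  rewrite frame_deriv_sum; last by move=> q; exact: dgA.
  apply: eq_bigr => q _.
  rewrite (@frame_derivM R n _ (fun=> A k a * A i p * (A j q)^*) (fun x => d1 g (x *m A) a p q)); last 2 first.
  - exact: cdiff_cst.
  - exact: (zdiff_comp (f := fun x => d1 g x a p q)).
  rewrite frame_deriv_cst mul0r add0r (frame_deriv_comp_anti _ (d1g a p q)) mulr_sumr.
  by [].
under eq_bigr => p _ do rewrite exchange_big /=.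
rewrite exchange_big; apply: eq_bigr => b _ /=; rewrite mulr_sumr.
apply: eq_bigr => p _; rewrite mulr_sumr; apply: eq_bigr => q _.
have alg (F : comNzRingType) (x y u v w : F) : x * y * u * (v * w) = x * v * (y * u * w).
  by ring.
exact: alg.
Qed.

Lemma pullm_hermitian (g : metric R n) :
  hermitian_metric g -> hermitian_metric (pullm A g).
Proof.
move=> hg; have [sg cg pg] := hg; split.
- move=> i j; have oU := @open_punctured R n.
  apply: (csmooth_eq (f := fun p : V =>
     \sum_p0 \sum_q A i p0 * (A j q)^* * g (cvec p *m A) p0 q) oU).
    by move=> p _; rewrite /pullm pullE.
  apply: csmooth_sum => // a; apply: csmooth_sum => // b; apply: csmoothZ => //.
  have := csmooth_comp (U' := [set p : V | cvec p != 0])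
     (L := fun p : V => rvec (cvec p *m A)) _ _ _ (sg a b).
  have -> : (fun p : V => g (cvec p *m A) a b) =
     (fun p : V => g (cvec (rvec (cvec p *m A))) a b).
    by apply/funext => p; rewrite rvecK.
  apply.
  + move=> s x y; rewrite -{1}(cvecK x) -{1}(cvecK y) -rvecZ -rvecD rvecK mulmxDl.
    by rewrite -scalemxAl rvecD rvecZ.
  + by move=> p; have := zdiff_linear A (cvec p); rewrite cvecK.
  + by move=> p /= p0; rewrite rvecK mulmx_neq0.
- move=> z z0 i j; rewrite /pullm !pullE exchange_big rmorph_sum /=.
  apply: eq_bigr => p _; rewrite rmorph_sum; apply: eq_bigr => q _ /=.
  rewrite !rmorphM /= conjCK -(cg _ (mulmx_neq0 Au z0)) mulrC [RHS]mulrC; congr (_ * _).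
  exact: mulrC.
- move=> z z0 v v0; have := pull_posdef Au (pg _ (mulmx_neq0 Au z0)); apply => //.
Qed.

(** Commutation with [diag_mx b] is what makes the pulled back metric descend to
    the same Hopf manifold; the equation itself is covariant under every
    invertible [A]. *)
Lemma pullm_solution b c1 c2 c3 c4 T g :
  A *m diag_mx b = diag_mx b *m A ->
  hcf_solution b c1 c2 c3 c4 T g -> hcf_solution b c1 c2 c3 c4 T (fun t => pullm A (g t)).
Proof.
move=> Ab [[U [oU UT sU]] eg].
have comm (t : R) : 0 <= t -> (t%:E < T)%E ->
    hopf_hermitian_metric b (pullm A (g t)).
  move=> t0 tT; have [[hg ig] _] := eg t t0 tT.
  split=> [|z z0]; first exact: pullm_hermitian.
  apply/hopf_pull; rewrite /pullm pull_comp.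
  have zA0 := mulmx_neq0 Au z0.
  have /hopf_pull -> := ig _ zA0; rewrite pull_comp Ab; congr (pull _ (g t _)).
  by rewrite !hopf_mapE -!mulmxA Ab.
pose L (q : W) : W := (q.1, rvec (cvec q.2 *m A)).
have linL (a : R) x y : L (a *: x + y) = a *: L x + L y.
  case: x y => [x1 x2] [y1 y2]; congr pair => /=.
  rewrite -{1}(cvecK x2) -{1}(cvecK y2) -rvecZ -rvecD rvecK mulmxDl.
  by rewrite -scalemxAl rvecD rvecZ.
have dL q : differentiable L q.
  apply: (@differentiable_pair _ _ _ _ (fun q : W => q.1)
    (fun q : W => rvec (cvec q.2 *m A))); first exact: fst_differentiable.
  apply: (@differentiable_comp _ _ _ _ (fun q : W => q.2)
    (fun p : V => rvec (cvec p *m A))); first exact: snd_differentiable.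
  by have := zdiff_linear A (cvec q.2); rewrite cvecK.
have EL t z i j : pullm A (g t) z i j =
   \sum_p \sum_q A i p * (A j q)^* * g t (z *m A) p q by rewrite /pullm pullE.
split.
  exists (L @^-1` U); split.
  - apply: open_comp => // q _; exact: differentiable_continuous.
  - by move=> t z t0 tT z0; rewrite /= /L /= rvecK; apply: UT => //; exact: mulmx_neq0.
  - have oU' : open (L @^-1` U) by apply: open_comp => // q _; exact: differentiable_continuous.
    move=> i j; apply: (csmooth_eq (f := fun p : W =>
     \sum_p0 \sum_q A i p0 * (A j q)^* * g p.1 (cvec p.2 *m A) p0 q) oU').
      by move=> p _; rewrite /= EL.
    apply: csmooth_sum => // a; apply: csmooth_sum => // e; apply: csmoothZ => //.
    have := csmooth_comp (U' := L @^-1` U) linL dL _ (sU a e).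
    have -> : (fun p : W => g p.1 (cvec p.2 *m A) a e) =
      (fun q : W => g (L q).1 (cvec (L q).2) a e).
      by apply/funext => p; rewrite /L /= rvecK.
    by apply.
move=> t t0 tT; split; first exact: comm.
move=> z z0 i j; have [[hg ig] E] := eg t t0 tT.
have zA0 := mulmx_neq0 Au z0.
rewrite (pullm_d1 hg z0) (pullm_d2 hg z0) /pullm hcf_expr_pull //; last first.
  exact: hermitian_unitmx.
have dg p q : cdiff (fun s : R^o => g s (z *m A) p q) t.
  have := time_cdiff (F := fun r : W => g r.1 (cvec r.2) p q) (t := t) (p := rvec (z *m A)).
  rewrite /= rvecK; apply; exact: csmooth_cdiff (sU p q) (UT t _ t0 tT zA0).
have TE (f : R -> C) : time_deriv f t = cderiv (1 : R^o) (f : R^o -> C) t.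
  by rewrite /time_deriv !derive1E.
rewrite TE; under eq_fun do rewrite pullE.
have dd p q : cdiff (fun s : R^o => A i p * (A j q)^* * g s (z *m A) p q) t.
  by apply: cdiffM; [exact: cdiff_cst|exact: dg].
rewrite cderiv_sum; last by move=> p; apply: cdiff_sum => q.
apply: eq_bigr => p _; rewrite cderiv_sum //; apply: eq_bigr => q _.
rewrite (@cderivM R R^o (fun=> A i p * (A j q)^*) (fun s => g s (z *m A) p q)); [|exact: cdiff_cst|exact: dg].
by rewrite cderiv_cst mul0r add0r -TE E.
Qed.

End Pull.
End Solutions.

(** * Derivative tests at a maximum *)

Section DerivativeTests.
Variable R : realType.

Lemma left_deriv_max (f : R -> R^o) (a t : R) : a < t -> derivable f t 1 ->
  (forall x, a <= x <= t -> f x <= f t) -> 0 <= 'D_1 f t.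
Proof.
move=> lat df fmax; rewrite ['D_1 f t]cvg_at_leftE; last exact: df.
apply: limr_ge.
  rewrite -(cvg_at_leftE (fun h => h^-1 *: ((f \o shift t) _ - f t))) //.
  apply: cvg_trans df; apply: cvg_app.
  move=> A [e egt0 Ae]; exists e => // x xe xgt0; apply: Ae => //.
  exact/ltr0_neq0.
near=> h; have h0 : h < 0 by near: h; exists 1 => /=.
apply: mulr_le0; first by rewrite invr_le0 ltW.
rewrite subr_le0 [_%:A]mulr1; apply: fmax; rewrite gerDr (ltW h0) andbT.
near: h; exists (t - a); first by rewrite /= subr_gt0.
move=> h; rewrite /= distrC subr0 => /ltr_normlP[+ _] _.
by rewrite ltrBrDl ltrBlDl => /ltW; rewrite addrC.
Unshelve. all: by end_near. Qed.

(** If the second derivative were positive, the first derivative, which vanishes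
    at the maximum, would be positive just after it, and the mean value theorem
    would contradict maximality. *)
Lemma deriv2_max (phi : R -> R) :
  (\forall s \near (0 : R), derivable phi s 1) ->
  (\forall s \near (0 : R), phi s <= phi 0) ->
  derivable (derive1 phi) 0 1 -> derive1 (derive1 phi) 0 <= 0.
Proof.
move=> /nbhs_norm0P[e1 /= e1_gt0 dphi] /nbhs_norm0P[e2 /= e2_gt0 phimax] dpsi.
rewrite leNgt; apply/negP; set psi := derive1 phi in dpsi *; rewrite derive1E => d0.
have lim_psi : (h^-1 *: ((psi \o shift 0) (h *: 1) - psi 0) @[h --> 0^'] -->
   ('D_1 psi 0 : R^o)) by [].
have : \forall h \near (0 : R), h != 0 ->
    0 < h^-1 *: ((psi \o shift 0) (h *: 1) - psi 0).
  exact: (cvgr_gt _ lim_psi _ d0).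
move=> /nbhs_norm0P[e3 /= e3_gt0 psi_gt].
pose e := Num.min e1 (Num.min e2 e3).
have e_gt0 : 0 < e by rewrite !lt_min e1_gt0 e2_gt0.
have inb (s x : R) : e <= x -> `|s| < e -> `|s| < x.
  by move=> ex se; exact: lt_le_trans ex.
have ele1 : e <= e1 by rewrite ge_min lexx.
have ele2 : e <= e2 by rewrite !ge_min lexx orbT.
have ele3 : e <= e3 by rewrite !ge_min lexx !orbT.
have inI (s : R) : s \in `]- e, e[ -> `|s| < e by rewrite in_itv /= ltr_norml.
have psi0 : psi 0 = 0.
  have [] := @derive1_at_max R phi (- e) e 0.
  - by rewrite ge0_cp ?ltW.
  - by move=> s /inI se; apply: dphi; exact: inb.
  - by rewrite in_itv /= oppr_lt0 e_gt0.
  - by move=> s /inI se; apply: phimax; exact: inb.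
  - by move=> _; rewrite /psi derive1E.
pose s := e / 2.
have s_gt0 : 0 < s by rewrite divr_gt0.
have s_lt : s < e by rewrite ltr_pdivrMr // ltr_pMr // ltr1n.
have in0s x : 0 <= x <= s -> `|x| < e.
  by move=> /andP[x0 xs]; rewrite ger0_norm //; exact: le_lt_trans xs s_lt.
have [||c c0s Hc] := @MVT R phi psi 0 s s_gt0.
- move=> x /[!in_itv]/= /andP[x0 xs].
  rewrite /psi derive1E; apply: derivableP; apply: dphi; apply: inb ele1 _.
  by apply: in0s; rewrite !ltW.
- apply: derivable_within_continuous => x /[!in_itv]/= xs; apply: dphi.
  by apply: inb ele1 _; exact: in0s.
have : phi s <= phi 0 by apply: phimax; apply: inb ele2 _; apply: in0s; rewrite ltW /=.
rewrite -subr_le0 Hc subr0 leNgt => /negP; apply; apply: mulr_gt0 => //.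
move: c0s; rewrite in_itv /= => /andP[c0 cs].
have := psi_gt c; rewrite /= psi0 subr0 addr0 [_%:A]mulr1 => H.
have : 0 < c^-1 *: psi c.
  by apply: H; [apply: inb ele3 _; apply: in0s; rewrite !ltW|rewrite gt_eqF].
by rewrite /GRing.scale /= pmulr_rgt0 ?invr_gt0.
Qed.

Lemma deriv_line (V : normedModType R) (F : V -> R^o) (p v : V) :
  derive1 (fun s : R => F (s *: v + p)) = (fun s => 'D_v F (s *: v + p)).
Proof.
apply/funext => s; rewrite derive1E /derive.
apply: (congr1 (fun k : R -> R^o => lim (k t @[t --> 0^']))).
by apply/funext => t /=; rewrite scalerDl -addrA [_%:A]mulr1.
Qed.

Lemma deriv2_dir_max (V : normedModType R) (F : V -> R^o) (p v : V) :
  (\forall q \near p, differentiable F q) ->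
  (\forall q \near p, F q <= F p) ->
  differentiable ('D_v F : V -> R^o) p -> 'D_v ('D_v F : V -> R^o) p <= 0.
Proof.
move=> dF Fmax dDF.
have line_cont : (fun s : R => s *: v + p) @ (0 : R) --> p.
  rewrite -[X in _ --> X]add0r -(scale0r v).
  by apply: cvgD; [apply: cvgZr_tmp; exact: cvg_id|exact: cvg_cst].
have line_diff s : differentiable (fun s : R^o => s *: v + p) s.
  apply: differentiableD; last exact: differentiable_cst.
  by apply: differentiableZl; exact: ex_diff.
have dline (H : V -> R^o) s : differentiable H (s *: v + p) ->
    derivable (fun s : R => H (s *: v + p)) s 1.
  move=> dH; apply: diff_derivable.
  exact: (@differentiable_comp _ _ _ _ (fun s : R^o => s *: v + p) H).
have := @deriv2_max (fun s => F (s *: v + p)).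
rewrite (deriv_line F p v) (deriv_line ('D_v F : V -> R^o) p v).
rewrite scale0r add0r; apply.
- have : \forall s \near (0 : R), differentiable F (s *: v + p) := line_cont _ dF.
  by apply: filterS => s; exact: dline.
- by have := line_cont _ Fmax.
- by apply: (dline ('D_v F : V -> R^o)); rewrite scale0r add0r.
Qed.

End DerivativeTests.

Section HermitianMatrices.
Variables (C : numClosedFieldType) (n : nat).
Implicit Types (G : 'M[C]_n) (v : 'rV[C]_n).

Definition herm G := forall i j, G j i = (G i j)^*.

Lemma hermE G : herm G <-> (map_mx Num.conj G)^T = G.
Proof.
split=> [hG|hG i j]; first by apply/matrixP => i j; rewrite !mxE -hG.
by rewrite -{1}hG !mxE.
Qed.

Lemma herm_inv G : G \in unitmx -> herm G -> herm (invmx G).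
Proof. by move=> Gu /hermE hG; apply/hermE; rewrite map_invmx trmx_inv hG. Qed.

Lemma posdef_inv G : herm G -> posdef G -> posdef (invmx G).
Proof.
move=> hG pG v v0; have Gu := posdef_unitmx pG.
have /hermE hI := herm_inv Gu hG.
have -> : herm_form (invmx G) v = herm_form G (v *m invmx G).
  rewrite !herm_formE map_mxM trmx_mul hI -!mulmxA mulKmx //.
apply: pG; apply: contra v0 => /eqP vG.
by rewrite -(mulmxKV Gu v) vG mul0mx.
Qed.

(** Diagonalizing reduces a trace against [G] to a sum of positive multiples of
    second derivatives along lines. *)
Lemma posdef_spectral G : herm G -> posdef G ->
  exists (d : 'I_n -> C) (P : 'M[C]_n), (forall m, 0 < d m) /\
    forall l k, G l k = \sum_m d m * (P m k * (P m l)^*).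
Proof.
move=> hG pG; have /orthomx_spectralP Gs : G \is normalmx.
  apply: hermitian_normalmx; rewrite is_hermitianmxE expr0 scale1r.
  by have /hermE := hG; rewrite map_trmx => {1}<-.
set P := spectralmx G in Gs; set d := spectral_diag G in Gs.
have Pu : P \is unitarymx := spectral_unitarymx G.
have PV : invmx P = (map_mx Num.conj P)^T by rewrite invmx_unitary // map_trmx.
have Punit := unitarymx_unit Pu.
have diagE : P *m G *m (map_mx Num.conj P)^T = diag_mx d.
  by rewrite -PV Gs !mulmxA mulmxV // mul1mx mulmxK.
exists (fun m => d 0 m), P; split=> [m|l k].
  have <- : herm_form G (row m P) = d 0 m.
    have := congr1 (fun M : 'M[C]_n => M m m) diagE.
    rewrite [in X in _ = X]mxE eqxx mulr1n => <-.
    rewrite herm_formE map_row -!row_mul !mxE.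
    by apply: eq_bigr => j _; rewrite !mxE.
  apply: pG; apply: contraTneq Punit => P0.
  rewrite -row_free_unit; apply/negP => /row_freeP[Q PQ].
  have PQm : (row m P *m Q) 0 m = 1.
    by rewrite -row_mul PQ row1 mxE !eqxx.
  by move: PQm; rewrite P0 mul0mx mxE => /esym/eqP; rewrite oner_eq0.
rewrite {1}Gs PV mxE; apply: eq_bigr => m _.
by rewrite mul_mx_diag !mxE [_ * d 0 m]mulrC -mulrA [P m k * _]mulrC.
Qed.

(** Expand the square of [v - M^-1 (v G)] for the positive form of [invmx G]. *)
Lemma posdef_inv_coercive G (M : C) v : herm G -> posdef G -> 0 < M ->
  herm_form G v <= M * \sum_k `|v 0 k| ^+ 2 ->
  M^-1 * \sum_k `|v 0 k| ^+ 2 <= herm_form (invmx G) v.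
Proof.
move=> hG pG M0 bG; have Gu := posdef_unitmx pG.
have pI := posdef_inv hG pG; have /hermE hGs := hG.
have nE : (v *m (map_mx Num.conj v)^T) 0 0 = \sum_k `|v 0 k| ^+ 2.
  by rewrite mxE; apply: eq_bigr => k _; rewrite !mxE normCK.
set N := \sum_k _ in bG nE *.
have Mc : M^-1^* = M^-1 by rewrite conj_Creal // realE invr_ge0 ltW.
have E : herm_form (invmx G) (v - M^-1 *: (v *m G)) =
    herm_form (invmx G) v - M^-1 * (2%:R * N) + M^-1 ^+ 2 * herm_form G v.
  pose w := (map_mx Num.conj v)^T.
  have wE : (map_mx Num.conj (v - M^-1 *: (v *m G)))^T = w - M^-1 *: (G *m w).
    by rewrite map_mxB map_mxZ map_mxM raddfB /= linearZ /= trmx_mul hGs Mc.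
  rewrite !herm_formE wE -/w -[in 2%:R * N]nE -/w.
  rewrite !mulmxBl !mulmxBr -!scalemxAl -!scalemxAr !mulmxA.
  rewrite (mulmxK Gu) !(mulmxKV Gu).
  by rewrite !(mxE, mulmxA); ring.
have : 0 <= herm_form (invmx G) (v - M^-1 *: (v *m G)).
  have [->|w0] := eqVneq (v - M^-1 *: (v *m G)) 0.
    by rewrite herm_formE mul0mx mul0mx mxE.
  exact/ltW/pI.
rewrite E => H; rewrite -subr_ge0; apply: le_trans H _.
have -> : herm_form (invmx G) v - M^-1 * N =
    herm_form (invmx G) v - M^-1 * (2%:R * N) + M^-1 ^+ 2 * (M * N).
  have MM : M != 0 by rewrite gt_eqF.
  by field.
by rewrite lerD2l ler_wpM2l // exprn_ge0 // invr_ge0 ltW.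
Qed.

End HermitianMatrices.

Section FrameMaximum.
Variables (R : realType) (n : nat).
Local Notation C := R[i].
Local Notation V := ('rV[R]_n * 'rV[R]_n)%type.
Implicit Types (z v w c : 'rV[C]_n) (f : 'rV[C]_n -> C).

Lemma cRe_sum (I : Type) (r : seq I) (F : I -> C) :
  complex.Re (\sum_(m <- r) F m) = \sum_(m <- r) complex.Re (F m).
Proof.
by elim: r => [|i r IH]; rewrite ?big_nil // !big_cons cReD IH.
Qed.

Lemma real_deriv_near_real f v z : (\forall p \near rvec z, complex.Im (f (cvec p)) = 0) ->
  complex.Im (real_deriv v f z) = 0.
Proof.
move=> f0; rewrite /real_deriv /=.
rewrite (near_eq_derive (g := cst 0)) ?derive_cst //.
Qed.

Lemma real_deriv_lin2 f h (a b : C) w z : zdiff f z -> zdiff h z ->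
  real_deriv w (fun x => a * f x + b * h x) z =
  a * real_deriv w f z + b * real_deriv w h z.
Proof.
move=> df dh.
have Z e (k : 'rV[C]_n -> C) : zdiff k z -> zdiff (fun x => e * k x) z.
  by move=> dk; apply: cdiffM => //; exact: cdiff_cst.
have E e (k : 'rV[C]_n -> C) : zdiff k z ->
    real_deriv w (fun x => e * k x) z = e * real_deriv w k z.
  move=> dk; apply: etrans (cderivM (rvec w) (cdiff_cst e (rvec z)) dk) _.
  by rewrite cderiv_cst mul0r add0r.
apply: etrans (cderivD (rvec w) (Z a f df) (Z b h dh)) _.
by congr (_ + _); exact: E.
Qed.

Lemma holo_direction f c z : zdiff f z ->
  \sum_k c 0 k * frame_deriv (inl k) f z =
  (real_deriv c f z - 'i%C * real_deriv ('i%C *: c) f z) / 2%:R.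
Proof.
move=> df; rewrite !real_deriv_frame // mulr_sumr -sumrB mulr_suml.
by apply: eq_bigr => k _; rewrite mxE conj_iM frame_rect_holo ?sqr_i // pnatr_eq0.
Qed.

Lemma anti_direction f c z : zdiff f z ->
  \sum_k (c 0 k)^* * frame_deriv (inr k) f z =
  (real_deriv c f z + 'i%C * real_deriv ('i%C *: c) f z) / 2%:R.
Proof.
move=> df; rewrite !real_deriv_frame // mulr_sumr -big_split mulr_suml.
by apply: eq_bigr => k _; rewrite mxE conj_iM /= frame_rect_anti ?sqr_i // pnatr_eq0.
Qed.

Lemma zdiff_real_deriv f v z : z != 0 -> (forall x, x != 0 -> zdiff f x) ->
  (forall A, zdiff (frame_deriv A f) z) -> zdiff (real_deriv v f) z.
Proof.
move=> z0 df ddf; apply: (zdiff_punctured (f := fun x =>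
  \sum_k (v 0 k * frame_deriv (inl k) f x + (v 0 k)^* * frame_deriv (inr k) f x)) z0).
  by move=> x x0; rewrite real_deriv_frame //; exact: df.
apply: cdiff_sum => k; apply: cdiffD; apply: cdiffM;
  by [exact: cdiff_cst|exact: ddf].
Qed.

Lemma real_deriv2_max f v z : z != 0 -> (forall x, x != 0 -> zdiff f x) ->
  (forall A, zdiff (frame_deriv A f) z) ->
  (forall x, x != 0 -> complex.Re (f x) <= complex.Re (f z)) ->
  complex.Re (real_deriv v (real_deriv v f) z) <= 0.
Proof.
move=> z0 df ddf fmax.
pose F (p : V) : R^o := complex.Re (f (cvec p)).
have E : (fun p : V => complex.Re (real_deriv v f (cvec p)) : R^o) = 'D_(rvec v) F.
  by apply/funext => p; rewrite /real_deriv /= cvecK.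
rewrite {1}/real_deriv /= E; apply: deriv2_dir_max.
- have := near_punctured (P := fun x => zdiff f x) z0 df.
  by apply: filterS => p [+ _]; rewrite cvecK.
- have := near_punctured z0 fmax.
  by apply: filterS => p; rewrite /F rvecK.
- by rewrite -E; have [] := zdiff_real_deriv v z0 df ddf.
Qed.

Lemma quarter_Re_le0 (x y u w : C) :
  complex.Im x = 0 -> complex.Im y = 0 -> complex.Im u = 0 -> complex.Im w = 0 ->
  complex.Re x <= 0 -> complex.Re w <= 0 ->
  complex.Re (((x - 'i%C * y) / 2%:R + 'i%C * ((u - 'i%C * w) / 2%:R)) / 2%:R) <= 0.
Proof.
move=> x0 y0 u0 w0 xle wle.
have h2 : (2%:R : C)^-1 = (2%:R^-1)%:C by rewrite fmorphV rmorph_nat.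
have -> : ((x - 'i%C * y) / 2%:R + 'i%C * ((u - 'i%C * w) / 2%:R)) / 2%:R =
   (x - 'i%C * y) * (2%:R^-1 * 2%:R^-1)%:C +
   'i%C * (u - 'i%C * w) * (2%:R^-1 * 2%:R^-1)%:C :> C.
  by rewrite rmorphM /= -h2 mulrDl !mulrA.
rewrite !(cReM, cImM, cReD, cImD, raddfN, rmorphN) /=.
rewrite !(cReM, cImM) /= y0 x0 u0 w0.
have h0 : 0 <= 2%:R^-1 / 2%:R :> R by rewrite mulr_ge0 // invr_ge0.
move: (2^-1 / 2) h0 xle wle => h.
move: (complex.Re x) (complex.Re y) (complex.Re u) (complex.Re w) => a b c d.
move=> h0 a0 d0; have := mulr_ge0_le0 h0 a0; have := mulr_ge0_le0 h0 d0; lra.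
Qed.

(** For a direction [c], [d_c d_{conj c} f] is a quarter of the sum of the second
    derivatives of [f] along the real directions [c] and [i c]; a positive
    Hermitian trace is a combination of such operators. *)
Lemma contract_max f (G : 'M[C]_n) z : z != 0 -> herm G -> posdef G ->
  (forall x, x != 0 -> zdiff f x) -> (forall A, zdiff (frame_deriv A f) z) ->
  (forall x, x != 0 -> complex.Im (f x) = 0) ->
  (forall x, x != 0 -> complex.Re (f x) <= complex.Re (f z)) ->
  complex.Re (contract G (fun k l =>
    frame_deriv (inr l) (frame_deriv (inl k) f) z)) <= 0.
Proof.
move=> z0 hG pG df ddf fr fmax.
have [d [P [d0 HE]]] := posdef_spectral (herm_inv (posdef_unitmx pG) hG) (posdef_inv hG pG).
have -> : contract G (fun k l => frame_deriv (inr l) (frame_deriv (inl k) f) z) =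
   \sum_m d m * \sum_l (row m P 0 l)^* *
       frame_deriv (inr l) (fun x => \sum_k row m P 0 k * frame_deriv (inl k) f x) z.
  rewrite /contract.
  under eq_bigr => k _ do under eq_bigr => l _ do rewrite HE mulr_suml.
  under eq_bigr => k _ do rewrite exchange_big /=.
  rewrite exchange_big; apply: eq_bigr => m _ /=.
  rewrite exchange_big mulr_sumr; apply: eq_bigr => l _ /=.
  rewrite frame_deriv_sum; last first.
    by move=> k; apply: cdiffM; [exact: cdiff_cst|exact: ddf].
  rewrite !mulr_sumr; apply: eq_bigr => k _.
  rewrite (@frame_derivM R n _ (fun=> row m P 0 k) (frame_deriv (inl k) f)); last 2 first.
  - exact: cdiff_cst.
  - exact: ddf.
  by rewrite frame_deriv_cst mul0r add0r !mxE -!mulrA; congr (_ * _); rewrite mulrCA.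
rewrite cRe_sum; apply: sumr_le0 => m _; set c := row m P.
have dm : d m = (complex.Re (d m))%:C.
  by have := d0 m; case: (d m) => x y; rewrite ltcE /= => /andP[/eqP -> _].
rewrite dm cReM /= mul0r subr0; apply: mulr_ge0_le0.
  by rewrite -lecR -dm ltW.
have drd v : zdiff (real_deriv v f) z by exact: zdiff_real_deriv.
rewrite anti_direction; last first.
  by apply: cdiff_sum => k; apply: cdiffM; [exact: cdiff_cst|exact: ddf].
have E w : real_deriv w (fun x => \sum_k c 0 k * frame_deriv (inl k) f x) z =
  (real_deriv w (real_deriv c f) z - 'i%C * real_deriv w (real_deriv ('i%C *: c) f) z) / 2%:R.
  have -> : real_deriv w (fun x => \sum_k c 0 k * frame_deriv (inl k) f x) z =
     real_deriv w (fun x => 2%:R^-1 * real_deriv c f x +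
         (- 'i%C / 2%:R) * real_deriv ('i%C *: c) f x) z.
    apply: cderiv_near.
    apply: (near_punctured (P := fun x => \sum_k c 0 k * frame_deriv (inl k) f x =
       2%:R^-1 * real_deriv c f x + (- 'i%C / 2%:R) * real_deriv ('i%C *: c) f x) z0).
    move=> x x0; rewrite holo_direction; last exact: df.
    by rewrite mulrBl mulrC mulNr mulNr mulrAC.
  rewrite real_deriv_lin2 // mulrBl mulrC; congr (_ + _).
  by rewrite mulNr mulNr mulrAC.
have rr v w : complex.Im (real_deriv w (real_deriv v f) z) = 0.
  apply: real_deriv_near_real.
  apply: (near_punctured (P := fun x => complex.Im (real_deriv v f x) = 0) z0) => x x0.
  apply: real_deriv_near_real.
  exact: (near_punctured (P := fun x => complex.Im (f x) = 0) x0).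
by rewrite !E; apply: quarter_Re_le0 => //; exact: real_deriv2_max.
Qed.

End FrameMaximum.

(** * Estimates of differences *)

Section Modulus.
Variable R : realType.
Local Notation C := R[i].
Implicit Types x y : C.

(** The norm of [R[i]] takes its values in [R[i]]; estimates need it in [R]. *)
Definition cabs x : R := complex.Re `|x|.

Lemma cabsE x : `|x| = (cabs x)%:C.
Proof. by rewrite /cabs normc_def. Qed.

Lemma cabs_ge0 x : 0 <= cabs x.
Proof. by rewrite -lecR -cabsE normr_ge0. Qed.

Lemma cabs0 : cabs 0 = 0.
Proof. by rewrite /cabs normr0. Qed.

Lemma cabsN x : cabs (- x) = cabs x.
Proof. by rewrite /cabs normrN. Qed.

Lemma cabsM x y : cabs (x * y) = cabs x * cabs y.
Proof. by apply: complexI; rewrite rmorphM /= -!cabsE normrM. Qed.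

Lemma cabsD x y : cabs (x + y) <= cabs x + cabs y.
Proof. by rewrite -lecR rmorphD /= -!cabsE ler_normD. Qed.

Lemma cabs_conj x : cabs x^* = cabs x.
Proof. by rewrite /cabs norm_conjC. Qed.

Lemma cabs_sum (I : Type) (r : seq I) (F : I -> C) :
  cabs (\sum_(i <- r) F i) <= \sum_(i <- r) cabs (F i).
Proof.
elim: r => [|i r IH]; rewrite ?big_nil ?cabs0 // !big_cons.
by apply: le_trans (cabsD _ _) _; rewrite lerD2l.
Qed.

Lemma cabs_eq0 x : (cabs x == 0) = (x == 0).
Proof. by rewrite -(inj_eq (@complexI R)) -cabsE normr_eq0. Qed.

Lemma cabs_sqr x : x * x^* = (cabs x ^+ 2)%:C.
Proof. by rewrite -normCK cabsE rmorphXn. Qed.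

Lemma Re_le_cabs x : complex.Re x <= cabs x.
Proof.
apply: le_trans (ler_norm _) _; rewrite -lecR -cabsE.
exact: normc_ge_Re.
Qed.

Lemma cabs_real (a : R) : 0 <= a -> cabs a%:C = a.
Proof. by move=> a0; rewrite /cabs ger0_norm // lecR. Qed.

End Modulus.

Section Domination.
Variables (R : realType) (X : Type) (S : X -> Prop).
Local Notation C := R[i].
Implicit Types (F G : X -> C) (w : X -> R).

(** [F = O(w)] on [S]. With [w = 1] this is boundedness. *)
Definition dom w F := exists M : R, forall x, S x -> cabs (F x) <= M * w x.

Lemma domD w F G : dom w F -> dom w G -> dom w (fun x => F x + G x).
Proof.
move=> [M HM] [N HN]; exists (M + N) => x Sx; rewrite mulrDl.
by apply: le_trans (cabsD _ _) _; apply: lerD; [exact: HM|exact: HN].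
Qed.

Lemma domN w F : dom w F -> dom w (fun x => - F x).
Proof. by move=> [M HM]; exists M => x Sx; rewrite cabsN; exact: HM. Qed.

Lemma dom_conj w F : dom w F -> dom w (fun x => (F x)^*).
Proof. by move=> [M HM]; exists M => x Sx; rewrite cabs_conj; exact: HM. Qed.

Lemma domM w F G : dom (fun=> 1) F -> dom w G -> dom w (fun x => F x * G x).
Proof.
move=> [M HM] [N HN]; exists (M * N) => x Sx; rewrite cabsM -mulrA.
apply: ler_pM; rewrite ?cabs_ge0 ?HN //.
by have := HM x Sx; rewrite mulr1.
Qed.

Lemma dom0 w : dom w (fun=> 0).
Proof. by exists 0 => x _; rewrite cabs0 mul0r. Qed.

Lemma dom_sum (I : Type) (r : seq I) w (F : I -> X -> C) :
  (forall i, dom w (F i)) -> dom w (fun x => \sum_(i <- r) F i x).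
Proof.
move=> dF; elim: r => [|i r IH].
  by under eq_fun do rewrite big_nil; exact: dom0.
by under eq_fun do rewrite big_cons; exact: domD.
Qed.

Lemma dom_eq w F G : (forall x, S x -> F x = G x) -> dom w F -> dom w G.
Proof. by move=> FG [M HM]; exists M => x Sx; rewrite -FG //; exact: HM. Qed.

Lemma bdd_cst (c : C) : dom (fun=> 1) (fun=> c).
Proof. by exists (cabs c) => x _; rewrite mulr1. Qed.

Variable e : X -> R.

(** The flow equation is polynomial in the metric, its inverse and its
    derivatives, and this relation is stable under the ring operations: it
    carries the estimate of [g1 - g2] to their right-hand sides. *)
Definition lipd F G :=
  [/\ dom (fun=> 1) F, dom (fun=> 1) G & dom e (fun x => F x - G x)].

Lemma lipd_cst (c : C) : lipd (fun=> c) (fun=> c).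
Proof.
split; try exact: bdd_cst.
by apply: dom_eq (dom0 e) => x _; rewrite subrr.
Qed.

Lemma lipd_refl F : dom (fun=> 1) F -> lipd F F.
Proof.
move=> bF; split=> //.
by apply: dom_eq (dom0 e) => x _; rewrite subrr.
Qed.

Lemma lipdD F G F' G' : lipd F G -> lipd F' G' ->
  lipd (fun x => F x + F' x) (fun x => G x + G' x).
Proof.
move=> [a b c] [a' b' c']; split; try exact: domD.
by apply: dom_eq (domD c c') => x _; ring.
Qed.

Lemma lipdN F G : lipd F G -> lipd (fun x => - F x) (fun x => - G x).
Proof.
move=> [a b c]; split; try exact: domN.
by apply: dom_eq (domN c) => x _; rewrite opprD.
Qed.

Lemma lipd_conj F G : lipd F G -> lipd (fun x => (F x)^*) (fun x => (G x)^*).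
Proof.
move=> [a b c]; split; try exact: dom_conj.
by apply: dom_eq (dom_conj c) => x _; rewrite rmorphB.
Qed.

Lemma mulr_diff_split (K : comNzRingType) (a b a' b' : K) :
  a * (a' - b') + b' * (a - b) = a * a' - b * b'.
Proof. ring. Qed.

Lemma lipdM F G F' G' : lipd F G -> lipd F' G' ->
  lipd (fun x => F x * F' x) (fun x => G x * G' x).
Proof.
move=> [a b c] [a' b' c']; split; try exact: domM.
by apply: dom_eq (domD (domM a c') (domM b' c)) => x _; exact: mulr_diff_split.
Qed.

Lemma lipd_sum (I : Type) (r : seq I) (F G : I -> X -> C) :
  (forall i, lipd (F i) (G i)) ->
  lipd (fun x => \sum_(i <- r) F i x) (fun x => \sum_(i <- r) G i x).
Proof.
move=> FG; split; try by apply: dom_sum => i; have [] := FG i.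
apply: (dom_eq (F := fun x => \sum_(i <- r) (F i x - G i x))).
  by move=> x _; rewrite sumrB.
by apply: dom_sum => i; have [] := FG i.
Qed.

Variable n : nat.

Lemma lipd_contract (G1 G2 : X -> 'M[C]_n) (Y1 Y2 : X -> 'I_n -> 'I_n -> C) :
  (forall i j, lipd (fun x => invmx (G1 x) i j) (fun x => invmx (G2 x) i j)) ->
  (forall k l, lipd (fun x => Y1 x k l) (fun x => Y2 x k l)) ->
  lipd (fun x => contract (G1 x) (Y1 x)) (fun x => contract (G2 x) (Y2 x)).
Proof.
move=> LG LY; apply: lipd_sum => k; apply: lipd_sum => l.
by apply: lipdM; [exact: LG|exact: LY].
Qed.

Lemma lipd_skew3 (D1 D2 : X -> 'I_n -> 'I_n -> 'I_n -> C) i j k :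
  (forall i j k, lipd (fun x => D1 x i j k) (fun x => D2 x i j k)) ->
  lipd (fun x => skew3 (D1 x) i j k) (fun x => skew3 (D2 x) i j k).
Proof. by move=> LD; apply: lipdD; [exact: LD|apply: lipdN; exact: LD]. Qed.

Lemma lipd_quad6 c1 c2 c3 c4 (D1 D2 : X -> 'I_n -> 'I_n -> 'I_n -> C) i k m j l p :
  (forall i j k, lipd (fun x => D1 x i j k) (fun x => D2 x i j k)) ->
  lipd (fun x => quad6 c1 c2 c3 c4 (D1 x) i k m j l p)
       (fun x => quad6 c1 c2 c3 c4 (D2 x) i k m j l p).
Proof.
move=> LD.
have T a b c a' b' c' : lipd (fun x => skew3 (D1 x) a b c * (skew3 (D1 x) a' b' c')^*)
    (fun x => skew3 (D2 x) a b c * (skew3 (D2 x) a' b' c')^*).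
  by apply: lipdM; [exact: lipd_skew3|apply: lipd_conj; exact: lipd_skew3].
apply: lipdD; first by apply/lipdN/lipdM => //; exact: lipd_conj.
apply: lipdD; last first.
  apply: lipdM; first exact: lipd_cst.
  by apply: lipdM; [exact: lipd_cst|exact: lipdD].
by apply: lipdD; [apply: lipdD|]; apply: lipdM => //; exact: lipd_cst.
Qed.

Lemma lipd_hcf_expr c1 c2 c3 c4 (G1 G2 : X -> 'M[C]_n)
    (D1 D2 : X -> 'I_n -> 'I_n -> 'I_n -> C)
    (Y1 Y2 : X -> 'I_n -> 'I_n -> 'I_n -> 'I_n -> C) i j :
  (forall i j, lipd (fun x => invmx (G1 x) i j) (fun x => invmx (G2 x) i j)) ->
  (forall i j k, lipd (fun x => D1 x i j k) (fun x => D2 x i j k)) ->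
  (forall k l, lipd (fun x => Y1 x k l i j) (fun x => Y2 x k l i j)) ->
  lipd (fun x => hcf_expr c1 c2 c3 c4 (G1 x) (D1 x) (Y1 x) i j)
       (fun x => hcf_expr c1 c2 c3 c4 (G2 x) (D2 x) (Y2 x) i j).
Proof.
move=> LG LD LY; apply: lipdD; first exact: lipd_contract.
by apply: lipd_contract => // k l; apply: lipd_contract => // m p; exact: lipd_quad6.
Qed.

(** [G1^-1 - G2^-1 = - G1^-1 (G1 - G2) G2^-1]. *)
Lemma lipd_invmx (G1 G2 : X -> 'M[C]_n) :
  (forall x, S x -> G1 x \in unitmx /\ G2 x \in unitmx) ->
  (forall i j, dom (fun=> 1) (fun x => invmx (G1 x) i j)) ->
  (forall i j, dom (fun=> 1) (fun x => invmx (G2 x) i j)) ->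
  (forall i j, dom e (fun x => G1 x i j - G2 x i j)) ->
  forall i j, lipd (fun x => invmx (G1 x) i j) (fun x => invmx (G2 x) i j).
Proof.
move=> Gu b1 b2 dG i j; split=> //.
apply: (dom_eq (F := fun x => - \sum_q \sum_p
   invmx (G2 x) q j * (invmx (G1 x) i p * (G1 x p q - G2 x p q)))).
  move=> x Sx; have [u1 u2] := Gu x Sx.
  have -> : invmx (G1 x) i j - invmx (G2 x) i j =
     - (invmx (G1 x) *m (G1 x - G2 x) *m invmx (G2 x)) i j.
    rewrite mulmxBr mulVmx // mulmxBl mul1mx -mulmxA mulmxV // mulmx1.
    by rewrite !mxE opprB.
  congr (- _); rewrite mxE; apply: eq_bigr => q _.
  rewrite mxE mulr_suml; apply: eq_bigr => p _.
  by rewrite mulrC !mxE.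
apply: domN; apply: dom_sum => q; apply: dom_sum => p.
by apply: domM => //; apply: domM.
Qed.

End Domination.

(** * The parabolic inequality *)

Section ParabolicInequality.
Variables (R : realType) (n : nat).
Local Notation C := R[i].
Implicit Types (z v : 'rV[C]_n).

Lemma sqr_sum_le (I : finType) (x : I -> R) :
  (\sum_i x i) ^+ 2 <= #|I|%:R * \sum_i x i ^+ 2.
Proof.
have -> : (\sum_i x i) ^+ 2 = \sum_i \sum_j x i * x j.
  by rewrite expr2 mulr_suml; apply: eq_bigr => i _; rewrite mulr_sumr.
have -> : #|I|%:R * \sum_i x i ^+ 2 = \sum_i \sum_j (x i ^+ 2 + x j ^+ 2) / 2%:R.
  under [RHS]eq_bigr => i _ do rewrite -mulr_suml big_split /= sumr_const.
  rewrite -mulr_suml big_split /= sumr_const sumrMnl.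
  by rewrite mulr_natl mulrDl -splitr.
apply: ler_sum => i _; apply: ler_sum => j _.
have := sqr_ge0 (x i - x j); rewrite !expr2; lra.
Qed.

Lemma swap_products (K : comNzRingType) (x h d c c' d' h' x' : K) :
  x * h + d * c + (c' * d' + h' * x') = h * x + d * c + (h' * x' + d' * c').
Proof. ring. Qed.

(** Bochner-type identity for [|h|^2]: the gradient term on the right has a sign
    and will absorb the first-order terms of the equation. *)
Lemma laplace_square (h : 'I_n -> 'I_n -> 'rV[C]_n -> C) (G : 'M[C]_n) z :
  (forall i j, zsmooth (h i j)) -> z != 0 ->
  (forall x, x != 0 -> forall i j, h j i x = (h i j x)^*) ->
  contract G (fun k l => frame_deriv (inr l)
     (frame_deriv (inl k) (fun x => \sum_i \sum_j h i j x * h j i x)) z) =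
  2%:R * \sum_i \sum_j h j i z *
     contract G (fun k l => frame_deriv (inr l) (frame_deriv (inl k) (h i j)) z) +
  2%:R * \sum_i \sum_j contract G (fun k l =>
     frame_deriv (inl k) (h i j) z * (frame_deriv (inl l) (h i j) z)^*).
Proof.
move=> sh z0 hh.
have dh i j x : x != 0 -> zdiff (h i j) x by exact: zsmooth_zdiff.
have ddh i j A x : x != 0 -> zdiff (frame_deriv A (h i j)) x.
  by move=> x0; exact: zsmooth_zdiff (zsmooth_frame_deriv _ (sh i j)) x0.
have conj_h i j l : frame_deriv (inr l) (h j i) z = (frame_deriv (inl l) (h i j) z)^*.
  rewrite -(frame_deriv_conj (inr l)); last exact: dh.
  by apply: frame_deriv_punctured => // x x0; exact: hh.
pose A k l i j := h j i z * frame_deriv (inr l) (frame_deriv (inl k) (h i j)) z +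
   frame_deriv (inl k) (h i j) z * (frame_deriv (inl l) (h i j) z)^*.
have E k l : frame_deriv (inr l) (frame_deriv (inl k)
    (fun x => \sum_i \sum_j h i j x * h j i x)) z = 2%:R * \sum_i \sum_j A k l i j.
  rewrite (frame_deriv_punctured (g := fun x => \sum_i \sum_j
      (frame_deriv (inl k) (h i j) x * h j i x + h i j x * frame_deriv (inl k) (h j i) x)) _ z0);
    last first.
    move=> x x0; rewrite frame_deriv_sum; last first.
      by move=> i; apply: cdiff_sum => j; apply: cdiffM; exact: dh.
    apply: eq_bigr => i _; rewrite frame_deriv_sum; last first.
      by move=> j; apply: cdiffM; exact: dh.
    by apply: eq_bigr => j _; rewrite frame_derivM //; exact: dh.
  have dM i j : zdiff (fun x => frame_deriv (inl k) (h i j) x * h j i x) z.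
    by apply: cdiffM; [exact: ddh|exact: dh].
  have dM' i j : zdiff (fun x => h i j x * frame_deriv (inl k) (h j i) x) z.
    by apply: cdiffM; [exact: dh|exact: ddh].
  rewrite frame_deriv_sum; last first.
    by move=> i; apply: cdiff_sum => j; apply: cdiffD; [exact: dM|exact: dM'].
  rewrite mulr_natl mulr2n [X in _ = _ + X]exchange_big -big_split; apply: eq_bigr => i _ /=.
  rewrite frame_deriv_sum; last by move=> j; apply: cdiffD; [exact: dM|exact: dM'].
  rewrite -big_split; apply: eq_bigr => j _ /=.
  rewrite frame_derivD; [|exact: dM|exact: dM'].
  rewrite (@frame_derivM _ _ _ (frame_deriv (inl k) (h i j)) (h j i)); [|exact: ddh|exact: dh].
  rewrite (@frame_derivM _ _ _ (h i j) (frame_deriv (inl k) (h j i))); [|exact: dh|exact: ddh].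
  by rewrite !conj_h /A swap_products.
transitivity (contract G (fun k l => 2%:R * \sum_i \sum_j A k l i j)).
  by apply: eq_bigr => k _; apply: eq_bigr => l _; rewrite E.
rewrite contractZ -mulrDr; congr (_ * _); rewrite contract_sum -big_split; apply: eq_bigr => i _ /=.
rewrite contract_sum -big_split; apply: eq_bigr => j _ /=.
rewrite -contractZ /contract -big_split; apply: eq_bigr => k _ /=.
by rewrite -big_split; apply: eq_bigr => l _ /=; rewrite -mulrDr.
Qed.

Lemma herm_form_bound (G : 'M[C]_n) (M : R) v : posdef G -> 0 <= M ->
  (forall i j, cabs (G i j) <= M) ->
  herm_form G v <= (M * n%:R)%:C * \sum_k `|v 0 k| ^+ 2.
Proof.
move=> pG M0 bM.
have h0 : 0 <= herm_form G v.
  have [->|v0] := eqVneq v 0; last exact/ltW/pG.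
  by rewrite herm_formE mul0mx mul0mx mxE.
have -> : (M * n%:R)%:C * \sum_k `|v 0 k| ^+ 2 =
    (M * (n%:R * \sum_k cabs (v 0 k) ^+ 2))%:C.
  rewrite mulrA [RHS]rmorphM /=; congr (_ * _); rewrite rmorph_sum.
  by apply: eq_bigr => k _; rewrite rmorphXn /= cabsE.
have -> : herm_form G v = (complex.Re (herm_form G v))%:C.
  by move: h0; case: (herm_form G v) => x y; rewrite lecE /= => /andP[/eqP -> _].
rewrite lecR; apply: le_trans (Re_le_cabs _) _.
apply: (le_trans (y := \sum_i \sum_j M * (cabs (v 0 i) * cabs (v 0 j)))).
  apply: le_trans (cabs_sum _ _) _; apply: ler_sum => i _.
  apply: le_trans (cabs_sum _ _) _; apply: ler_sum => j _.
  rewrite !cabsM cabs_conj -mulrA ler_wpM2r // mulr_ge0 ?cabs_ge0 //.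
have := sqr_sum_le (fun i => cabs (v 0 i)); rewrite card_ord => /(ler_wpM2l M0).
apply: le_trans; rewrite expr2 mulr_suml mulr_sumr; apply: ler_sum => i _.
by rewrite mulr_sumr mulr_sumr.
Qed.

(** Uniform ellipticity: an upper bound of the metric is a lower bound of its
    inverse, which is the symbol of the Laplacian. *)
Lemma contract_coercive (G : 'M[C]_n) (M : R) (xi : 'I_n -> C) :
  herm G -> posdef G -> 0 < M -> (forall i j, cabs (G i j) <= M) ->
  (M * n.+1%:R)^-1 * \sum_k cabs (xi k) ^+ 2 <=
  complex.Re (contract G (fun k l => xi k * (xi l)^*)).
Proof.
move=> hG pG M0 bM.
pose v : 'rV[C]_n := \row_k (xi k)^*.
have nE : \sum_k `|v 0 k| ^+ 2 = (\sum_k cabs (xi k) ^+ 2)%:C.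
  rewrite rmorph_sum; apply: eq_bigr => k _.
  by rewrite mxE norm_conjC cabsE rmorphXn.
have K0 : 0 < (M * n.+1%:R)%:C by rewrite ltcR mulr_gt0.
have := posdef_inv_coercive hG pG K0 (v := v).
have -> : herm_form (invmx G) v = contract G (fun k l => xi k * (xi l)^*).
  rewrite /herm_form exchange_big; apply: eq_bigr => k _; apply: eq_bigr => l _ /=.
  by rewrite !mxE conjCK -mulrA; congr (_ * _); exact: mulrC.
rewrite nE -fmorphV => H.
have : herm_form G v <= (M * n.+1%:R)%:C * (\sum_k cabs (xi k) ^+ 2)%:C.
  rewrite -nE; apply: le_trans (herm_form_bound v pG (ltW M0) bM) _.
  apply: ler_wpM2r; first by apply: sumr_ge0 => k _; rewrite exprn_ge0.
  by rewrite lecR ler_wpM2l ?(ltW M0) // ler_nat.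
by move=> Hb; have := H Hb; rewrite -rmorphM lecE /= => /andP[].
Qed.

Lemma bdd_family (X : Type) (S : X -> Prop) (I : finType) (F : I -> X -> C) :
  (forall i, dom S (fun=> 1) (F i)) ->
  exists2 M : R, 0 < M & forall x i, S x -> cabs (F i x) <= M.
Proof.
move=> bF; have [M HM] := choice bF.
exists (1 + \sum_i `|M i|).
  by rewrite ltr_wpDr // sumr_ge0.
move=> x i Sx; have := HM i x Sx; rewrite mulr1 => /le_trans; apply.
apply: le_trans (ler_norm _) _; rewrite (bigD1 i) //= addrCA lerDl.
by rewrite addr_ge0 // sumr_ge0.
Qed.

Lemma domMM (X : Type) (S : X -> Prop) (w w' : X -> R) (F G : X -> C) :
  dom S w F -> dom S w' G -> dom S (fun x => w x * w' x) (fun x => F x * G x).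
Proof.
move=> [M HM] [N HN]; exists (M * N) => x Sx; rewrite cabsM mulrACA.
by apply: ler_pM; rewrite ?cabs_ge0 ?HM ?HN.
Qed.

(** Here [a] bounds [|h|] and [b] bounds [|dh|]: the cross term [a b] is split by
    the inequality of arithmetic and geometric means, the part in [b ^+ 2] being
    absorbed by the gradient term [B]. *)
Lemma absorb (L D u a b B C1 s N1 : R) : 0 < s -> 0 <= C1 ->
  a ^+ 2 <= N1 * u -> s * b ^+ 2 <= B -> 
  D <= L - B + 2%:R * (C1 * (a * (a + b))) ->
  D <= L + (2%:R * C1 + C1 ^+ 2 / s) * N1 * u.
Proof.
move=> s0 C0 au bB DL.
have sq : 2%:R * C1 * (a * b) <= s * b ^+ 2 + C1 ^+ 2 / s * a ^+ 2.
  have : 0 <= (s * b - C1 * a) ^+ 2 / s by rewrite divr_ge0 ?sqr_ge0 ?ltW.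
  have -> : (s * b - C1 * a) ^+ 2 / s = s * b ^+ 2 + C1 ^+ 2 / s * a ^+ 2 - 2%:R * C1 * (a * b).
    by field; rewrite gt_eqF.
  by rewrite subr_ge0.
have K0 : 0 <= 2%:R * C1 + C1 ^+ 2 / s.
  by apply: addr_ge0; [exact: mulr_ge0|rewrite divr_ge0 ?sqr_ge0 // ltW].
have := ler_wpM2l K0 au; rewrite [X in _ <= X]mulrA => au'.
have E : (2%:R * C1 + C1 ^+ 2 / s) * a ^+ 2 = 2%:R * (C1 * (a * a)) + C1 ^+ 2 / s * a ^+ 2.
  by rewrite mulrDl !expr2 !mulrA.
rewrite E in au'; move: DL sq; rewrite !mulrDr; lra.
Qed.

End ParabolicInequality.

Section ReactionDiffusion.
Variables (R : realType) (n : nat).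
Local Notation C := R[i].
Local Notation W := (R^o * ('rV[R]_n * 'rV[R]_n))%type.
Local Notation X := (R * 'rV[C]_n)%type.
Implicit Types (z v : 'rV[C]_n) (g : R -> metric R n).

(** Coefficient bounds for the linearized equation. Two derivatives of [g2] are
    needed because [L_1 h = L_1 g1 - L_2 g2 + (L_2 - L_1) g2], where [L_1] and
    [L_2] are the Laplacians of the two metrics. *)
Definition bounded_geometry (S : X -> Prop) g : Prop :=
  [/\ forall i j, dom S (fun=> 1) (fun x => g x.1 x.2 i j),
      forall i j, dom S (fun=> 1) (fun x => invmx (g x.1 x.2) i j),
      forall k i j, dom S (fun=> 1) (fun x => d1 (g x.1) x.2 k i j) &
      forall k l i j, dom S (fun=> 1) (fun x => d2 (g x.1) x.2 k l i j)].

(** [h j i] instead of the conjugate of [h i j]: the two agree for Hermitian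
    matrices, and this form can be differentiated by the product rule alone. *)
Definition sqdiff (g1 g2 : R -> metric R n) (t : R) z : C :=
  \sum_i \sum_j (g1 t z i j - g2 t z i j) * (g1 t z j i - g2 t z j i).

Lemma time_derivE1 (f : R -> C) t : time_deriv f t = cderiv (1 : R^o) (f : R^o -> C) t.
Proof. by rewrite /time_deriv !derive1E. Qed.

Lemma solution_time_cdiff b c1 c2 c3 c4 T g t z i j :
  hcf_solution b c1 c2 c3 c4 T g -> 0 <= t -> (t%:E < T)%E -> z != 0 ->
  cdiff (fun s : R^o => g s z i j) t.
Proof.
move=> [[U [oU UT sU]] _] t0 tT z0.
have := time_cdiff (F := fun r : W => g r.1 (cvec r.2) i j) (t := t) (p := rvec z).
by rewrite /= rvecK; apply; exact: csmooth_cdiff (sU i j) (UT t _ t0 tT z0).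
Qed.

Lemma hcf_expr_shift (K : numClosedFieldType) (e1 e2 e3 e4 : K) (G : 'M[K]_n) D Y Y' i j r :
  hcf_expr e1 e2 e3 e4 G D Y i j - r =
  contract G (fun k l => Y k l i j - Y' k l i j) + (hcf_expr e1 e2 e3 e4 G D Y' i j - r).
Proof.
rewrite /hcf_expr !addrA; congr (_ + _ - _); rewrite -big_split.
apply: eq_bigr => k _; rewrite -big_split; apply: eq_bigr => l _ /=.
by rewrite -mulrDr subrK.
Qed.

Lemma cRe_double (x : C) : complex.Re (2%:R * x) = 2%:R * complex.Re x.
Proof. by rewrite !mulr_natl !mulr2n cReD. Qed.

Variables (b : 'rV[C]_n) (c1 c2 c3 c4 : R) (T : \bar R) (g1 g2 : R -> metric R n).
Hypothesis sol1 : hcf_solution b c1 c2 c3 c4 T g1.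
Hypothesis sol2 : hcf_solution b c1 c2 c3 c4 T g2.

Local Notation E G D Y := (hcf_expr c1%:C c2%:C c3%:C c4%:C G D Y).

Lemma sqdiff_time_deriv t z : 0 <= t -> (t%:E < T)%E -> z != 0 ->
  time_deriv (fun s => sqdiff g1 g2 s z) t =
  2%:R * \sum_i \sum_j (g1 t z j i - g2 t z j i) *
    (E (g1 t z) (d1 (g1 t) z) (d2 (g1 t) z) i j -
     E (g2 t z) (d1 (g2 t) z) (d2 (g2 t) z) i j).
Proof.
move=> t0 tT z0.
have dh i j : cdiff (fun s : R^o => g1 s z i j - g2 s z i j) t.
  exact: cdiffB (solution_time_cdiff i j sol1 t0 tT z0) (solution_time_cdiff i j sol2 t0 tT z0).
pose F i j := E (g1 t z) (d1 (g1 t) z) (d2 (g1 t) z) i j -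
     E (g2 t z) (d1 (g2 t) z) (d2 (g2 t) z) i j.
have hE i j : cderiv (1 : R^o) (fun s : R^o => g1 s z i j - g2 s z i j) t = F i j.
  rewrite (cderivB _ (solution_time_cdiff i j sol1 t0 tT z0)
    (solution_time_cdiff i j sol2 t0 tT z0)).
  rewrite -(time_derivE1 (fun s => g1 s z i j)) -(time_derivE1 (fun s => g2 s z i j)).
  have [_ e1] := sol1; have [_ e2] := sol2.
  have [_ E1] := e1 t t0 tT; have [_ E2] := e2 t t0 tT.
  by rewrite E1 // E2.
rewrite time_derivE1 cderiv_sum; last first.
  by move=> i; apply: cdiff_sum => j; exact: cdiffM.
rewrite mulr_natl mulr2n [X in _ = _ + X]exchange_big -big_split; apply: eq_bigr => i _ /=.
rewrite cderiv_sum; last by move=> j; exact: cdiffM.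
rewrite -big_split; apply: eq_bigr => j _ /=.
rewrite cderivM // !hE /F; congr (_ + _); exact: mulrC.
Qed.

Variable S : X -> Prop.
Hypothesis S_dom : forall x, S x -> [/\ 0 <= x.1, (x.1%:E < T)%E & x.2 != 0].
Hypothesis bdd1 : bounded_geometry S g1.
Hypothesis bdd2 : bounded_geometry S g2.

(** With [h = g1 - g2], the equation for [h] is [d_t h = L_1 h + Rem], where
    [L_1] is the Laplacian of [g1] and [Rem] is bounded by [|h| + |dh|], because
    [hcf_expr] is locally Lipschitz in the metric and its first derivatives.
    [laplace_square] then gives
    [d_t |h|^2 <= L_1 |h|^2 - lam |dh|^2 + C |h| (|h| + |dh|)], and the bad
    term [|h| |dh|] is absorbed. *)
Lemma parabolic_inequality : exists K : R, forall x, S x ->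
  complex.Re (time_deriv (fun s => sqdiff g1 g2 s x.2) x.1) <=
  complex.Re (contract (g1 x.1 x.2) (fun k l =>
     frame_deriv (inr l) (frame_deriv (inl k) (sqdiff g1 g2 x.1)) x.2)) +
  K * complex.Re (sqdiff g1 g2 x.1 x.2).
Proof.
have [bg1 bi1 bd1 bdd1'] := bdd1; have [bg2 bi2 bd2 bdd2'] := bdd2.
pose h (x : X) i j : C := g1 x.1 x.2 i j - g2 x.1 x.2 i j.
pose dh (x : X) k i j : C := frame_deriv (inl k) (fun z => g1 x.1 z i j - g2 x.1 z i j) x.2.
pose a x := \sum_(p : 'I_n * 'I_n) cabs (h x p.1 p.2).
pose be x := \sum_(q : 'I_n * 'I_n * 'I_n) cabs (dh x q.1.1 q.1.2 q.2).
pose e x := a x + be x.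
have a0 x : 0 <= a x by apply: sumr_ge0 => p _; exact: cabs_ge0.
have be0 x : 0 <= be x by apply: sumr_ge0 => p _; exact: cabs_ge0.
have herm12 x : S x -> hermitian_metric (g1 x.1) /\ hermitian_metric (g2 x.1).
  move=> Sx; have [t0 tT _] := S_dom Sx.
  have [_ s1] := sol1; have [_ s2] := sol2.
  by have [[H1 _] _] := s1 _ t0 tT; have [[H2 _] _] := s2 _ t0 tT.
have sub_zsmooth x i j : S x -> zsmooth (fun z => g1 x.1 z i j - g2 x.1 z i j).
  move=> Sx; have [H1 H2] := herm12 x Sx.
  exact: csmoothB (@open_punctured R n) (hermitian_zsmooth i j H1) (hermitian_zsmooth i j H2).
have dhE x k i j : S x -> dh x k i j = d1 (g1 x.1) x.2 k i j - d1 (g2 x.1) x.2 k i j.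
  move=> Sx; have [H1 H2] := herm12 x Sx; have [_ _ z0] := S_dom Sx.
  by rewrite /dh frame_derivB //; exact: zsmooth_zdiff (hermitian_zsmooth _ _ _) z0.
have ddhE x k l i j : S x -> frame_deriv (inr l) (frame_deriv (inl k)
    (fun z => g1 x.1 z i j - g2 x.1 z i j)) x.2 =
    d2 (g1 x.1) x.2 k l i j - d2 (g2 x.1) x.2 k l i j.
  move=> Sx; have [H1 H2] := herm12 x Sx; have [t0 tT z0] := S_dom Sx.
  have dd f : zsmooth f -> zdiff (frame_deriv (inl k) f) x.2.
    by move=> sf; exact: zsmooth_zdiff (zsmooth_frame_deriv _ sf) z0.
  have D1 := dd _ (hermitian_zsmooth i j H1).
  have D2 := dd _ (hermitian_zsmooth i j H2).
  rewrite /d2 -(frame_derivB (inr l) D1 D2).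
  apply: frame_deriv_punctured => // z z0'; apply: frame_derivB.
    exact: zsmooth_zdiff (hermitian_zsmooth i j H1) z0'.
  exact: zsmooth_zdiff (hermitian_zsmooth i j H2) z0'.
have dom_h i j : dom S e (fun x => h x i j).
  exists 1 => x _; rewrite mul1r /e; apply: le_trans (_ : a x <= _); last by rewrite lerDl.
  by rewrite /a (bigD1 (i, j)) //= lerDl; apply: sumr_ge0 => p _; exact: cabs_ge0.
have dom_dh k i j : dom S e (fun x => dh x k i j).
  exists 1 => x _; rewrite mul1r /e; apply: le_trans (_ : be x <= _); last by rewrite lerDr.
  by rewrite /be (bigD1 (k, i, j)) //= lerDl; apply: sumr_ge0 => p _; exact: cabs_ge0.
have dom_ha i j : dom S a (fun x => h x i j).
  exists 1 => x _; rewrite mul1r.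
  by rewrite /a (bigD1 (i, j)) //= lerDl; apply: sumr_ge0 => p _; exact: cabs_ge0.
have Linv i j : lipd S e (fun x => invmx (g1 x.1 x.2) i j) (fun x => invmx (g2 x.1 x.2) i j).
  apply: lipd_invmx => //.
  move=> x Sx; have [H1 H2] := herm12 x Sx; have [_ _ z0] := S_dom Sx.
  by split; exact: hermitian_unitmx.
have Ld1 i j k : lipd S e (fun x => d1 (g1 x.1) x.2 i j k) (fun x => d1 (g2 x.1) x.2 i j k).
  split=> //; apply: dom_eq (dom_dh i j k) => x Sx; exact: dhE.
pose E1' x i j := E (g1 x.1 x.2) (d1 (g1 x.1) x.2) (d2 (g2 x.1) x.2) i j.
pose E2 x i j := E (g2 x.1 x.2) (d1 (g2 x.1) x.2) (d2 (g2 x.1) x.2) i j.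
pose Rem x i j := E1' x i j - E2 x i j.
have domRem i j : dom S e (fun x => Rem x i j).
  have [] // : lipd S e (fun x => E1' x i j) (fun x => E2 x i j).
  by apply: lipd_hcf_expr => // k l; apply: lipd_refl.
have [C1 HC1] : dom S (fun x => a x * e x)
    (fun x => \sum_i \sum_j h x j i * Rem x i j).
  by apply: dom_sum => i; apply: dom_sum => j; exact: domMM.
have [M M0 HM] := bdd_family (F := fun (p : 'I_n * 'I_n) (x : X) => g1 x.1 x.2 p.1 p.2)
  (fun p => bg1 p.1 p.2).
pose lam := (M * n.+1%:R)^-1.
have lam0 : 0 < lam by rewrite invr_gt0 mulr_gt0.
pose N2 : R := (#|{: 'I_n * 'I_n * 'I_n}|).+1%:R.
pose s := 2%:R * lam / N2.
have s0 : 0 < s by rewrite divr_gt0 // mulr_gt0.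
pose N1 : R := #|{: 'I_n * 'I_n}|%:R.
exists ((2%:R * `|C1| + `|C1| ^+ 2 / s) * N1) => x Sx.
have [t0 tT z0] := S_dom Sx; have [H1 H2] := herm12 x Sx.
have [_ hh1 pp1] := H1; have [_ hh2 pp2] := H2.
have hherm z : z != 0 -> forall i j, g1 x.1 z j i - g2 x.1 z j i = (g1 x.1 z i j - g2 x.1 z i j)^*.
  by move=> z0' i j; rewrite rmorphB /= -hh1 // -hh2.
pose B := \sum_(q : 'I_n * 'I_n * 'I_n) cabs (dh x q.1.1 q.1.2 q.2) ^+ 2.
apply: (@absorb R _ _ _ (a x) (be x) (2%:R * lam * B)) => //.
- have -> : complex.Re (sqdiff g1 g2 x.1 x.2) = \sum_(p : 'I_n * 'I_n) cabs (h x p.1 p.2) ^+ 2.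
    rewrite -(pair_bigA _ (fun i j => cabs (h x i j) ^+ 2)) /= /sqdiff cRe_sum.
    apply: eq_bigr => i _; rewrite cRe_sum; apply: eq_bigr => j _.
    by rewrite (hherm _ z0 i j) cabs_sqr.
  exact: sqr_sum_le.
- have bB : be x ^+ 2 <= N2 * B.
    apply: le_trans (sqr_sum_le _) _; apply: ler_wpM2r; last by rewrite ler_nat.
    by apply: sumr_ge0 => q _; exact: sqr_ge0.
  rewrite /s mulrAC ler_pdivrMr // -[X in _ <= X]mulrA [B * N2]mulrC.
  by rewrite ler_wpM2l // mulr_ge0 // ltW.
rewrite sqdiff_time_deriv //.
rewrite (laplace_square (h := fun i j z => g1 x.1 z i j - g2 x.1 z i j)) //; last first.
  by move=> i j; exact: sub_zsmooth.
pose L2 := \sum_i \sum_j h x j i * contract (g1 x.1 x.2) (fun k l =>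
  frame_deriv (inr l) (frame_deriv (inl k) (fun z => g1 x.1 z i j - g2 x.1 z i j)) x.2).
pose NN := \sum_i \sum_j contract (g1 x.1 x.2) (fun k l => dh x k i j * (dh x l i j)^*).
pose HR := \sum_i \sum_j h x j i * Rem x i j.
rewrite (_ : \sum_i \sum_j _ = L2 + HR); last first.
  rewrite -big_split; apply: eq_bigr => i _; rewrite -big_split; apply: eq_bigr => j _ /=.
  rewrite -mulrDr; congr (_ * _).
  rewrite (hcf_expr_shift _ _ _ _ _ _ _ (d2 (g2 x.1) x.2)); congr (_ + _).
  by apply: eq_bigr => k _; apply: eq_bigr => l _; rewrite ddhE.
suff: complex.Re (2%:R * (L2 + HR)) <= complex.Re (2%:R * L2 + 2%:R * NN)
    - 2%:R * lam * B + 2%:R * (`|C1| * (a x * (a x + be x))) by [].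
rewrite cReD !cRe_double cReD.
have leHR : complex.Re HR <= `|C1| * (a x * (a x + be x)).
  apply: le_trans (Re_le_cabs _) _; apply: le_trans (HC1 x Sx) _.
  by apply: ler_wpM2r; [rewrite mulr_ge0 // addr_ge0|exact: ler_norm].
have leNN : lam * B <= complex.Re NN.
  have -> : B = \sum_i \sum_j \sum_k cabs (dh x k i j) ^+ 2.
    rewrite /B -(pair_bigA _ (fun p j => cabs (dh x p.1 p.2 j) ^+ 2)) /=.
    rewrite -(pair_bigA _ (fun k i => \sum_j cabs (dh x k i j) ^+ 2)) /=.
    by rewrite [LHS]exchange_big; apply: eq_bigr => i _; exact: exchange_big.
  rewrite mulr_sumr cRe_sum; apply: ler_sum => i _.
  rewrite mulr_sumr cRe_sum; apply: ler_sum => j _.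
  apply: contract_coercive => //; last by move=> p q; exact: (HM x (p, q)).
  - by move=> p q; exact: hh1.
  - by move=> v v0; exact: pp1.
move: leHR leNN; lra.
Qed.

End ReactionDiffusion.

(** * The squared norm and the orbits of the deck group *)

Section SquaredNorm.
Variables (R : realType) (n : nat).
Local Notation C := R[i].
Implicit Types (z v : 'rV[C]_n) (A : frame n).

Definition normsq z : R := \sum_k cabs (z 0 k) ^+ 2.

Lemma sqnormE z : sqnorm z = (normsq z)%:C.
Proof.
rewrite /sqnorm /normsq rmorph_sum; apply: eq_bigr => k _ /=.
by rewrite cabsE rmorphXn.
Qed.

Lemma sqnorm_conj z : sqnorm z = \sum_k z 0 k * (z 0 k)^*.
Proof. by apply: eq_bigr => k _; rewrite normCK. Qed.

Lemma normsq_ge0 z : 0 <= normsq z.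
Proof. by apply: sumr_ge0 => k _; exact: sqr_ge0. Qed.

Lemma normsq_eq0 z : (normsq z == 0) = (z == 0).
Proof.
apply/idP/eqP => [|->]; last first.
  by rewrite /normsq big1 // => k _; rewrite mxE cabs0 expr0n.
rewrite psumr_eq0 => [/allP H|k _]; last exact: sqr_ge0.
apply/rowP => k; rewrite mxE; apply/eqP; rewrite -cabs_eq0 -sqrf_eq0.
by apply: H; rewrite mem_index_enum.
Qed.

Lemma normsq_gt0 z : (0 < normsq z) = (z != 0).
Proof. by rewrite lt_def normsq_eq0 normsq_ge0 andbT. Qed.

Lemma sqnorm_neq0 z : z != 0 -> sqnorm z != 0.
Proof. by rewrite -normsq_gt0 sqnormE => /gt_eqF s0; rewrite fmorph_eq0 s0. Qed.

Lemma zdiff_sqnorm z : zdiff (@sqnorm R n) z.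
Proof.
have -> : @sqnorm R n = (fun x => \sum_k x 0 k * (x 0 k)^*).
  by apply/funext => x; exact: sqnorm_conj.
apply: cdiff_sum => k; apply: cdiffM; first exact: zdiff_coord.
by apply: cdiff_conj; exact: zdiff_coord.
Qed.

Lemma frame_deriv_sqnorm A z : frame_deriv A (@sqnorm R n) z =
  match A with inl k => (z 0 k)^* | inr k => z 0 k end.
Proof.
have -> : @sqnorm R n = (fun x => \sum_k x 0 k * (x 0 k)^*).
  by apply/funext => x; exact: sqnorm_conj.
have dz k : zdiff (fun x => x 0 k) z := zdiff_coord k z.
have dc k : zdiff (fun x => (x 0 k)^*) z := cdiff_conj (zdiff_coord k z).
rewrite frame_deriv_sum; last by move=> k; apply: cdiffM; [exact: dz|exact: dc].
have E k : frame_deriv A (fun x : 'rV[C]_n => x 0 k * (x 0 k)^*) z =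
    (if A is inl j then (j == k)%:R else 0) * (z 0 k)^* +
    z 0 k * (if A is inr j then (j == k)%:R else 0).
  by rewrite (frame_derivM A (dz k) (dc k)) frame_deriv_coord frame_deriv_coord_conj.
rewrite (eq_bigr _ (fun k _ => E k)).
case: A {E} => k; rewrite (bigD1 k) //= big1 => [|j /negPf jk]; rewrite ?eqxx.
- by rewrite mul1r mulr0 !addr0.
- by rewrite eq_sym jk mul0r mulr0 addr0.
- by rewrite mulr1 mul0r add0r addr0.
- by rewrite eq_sym jk mul0r mulr0 addr0.
Qed.

Lemma frame_deriv_inv A f z : z != 0 -> (forall x, x != 0 -> f x != 0) ->
  zdiff f z -> frame_deriv A (fun x => (f x)^-1) z = - frame_deriv A f z / f z ^+ 2.
Proof.
move=> z0 f0 df; have dV := zdiffV df (f0 z z0).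
have : frame_deriv A (fun x => f x * (f x)^-1) z = 0.
  rewrite (frame_deriv_punctured (g := fun=> 1) _ z0) ?frame_deriv_cst //.
  by move=> x x0; rewrite divff // f0.
rewrite (@frame_derivM R n A f (fun x => (f x)^-1)) //.
have alg (K : fieldType) (a b c : K) : b != 0 -> a * b^-1 + b * c = 0 -> c = - a / b ^+ 2.
  move=> b0 /eqP; rewrite addrC addr_eq0 => /eqP H; apply: (mulfI b0); rewrite H; field.
  exact: b0.
by apply: alg; exact: f0.
Qed.

Lemma zdiff_inv_sqnorm z : z != 0 -> zdiff (fun x => (sqnorm x)^-1) z.
Proof. by move=> z0; apply: zdiffV; [exact: zdiff_sqnorm|exact: sqnorm_neq0]. Qed.

Lemma frame_deriv_inv_sqnorm A z : z != 0 ->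
  frame_deriv A (fun x => (sqnorm x)^-1) z =
  - (match A with inl k => (z 0 k)^* | inr k => z 0 k end) / sqnorm z ^+ 2.
Proof.
move=> z0; rewrite (frame_deriv_inv A z0 (@sqnorm_neq0)) ?frame_deriv_sqnorm //.
exact: zdiff_sqnorm.
Qed.

Lemma normsq_hopf (b z : 'rV[C]_n) r : (forall i, cabs (b 0 i) = r) ->
  normsq (hopf_map b z) = r ^+ 2 * normsq z.
Proof.
move=> br; rewrite /normsq mulr_sumr; apply: eq_bigr => k _.
by rewrite mxE cabsM br exprMn.
Qed.

Lemma expr_unbounded (q x : R) : 1 < q -> exists k, x <= q ^+ k.
Proof.
move=> q1; have bern k : 1 + k%:R * (q - 1) <= q ^+ k.
  elim: k => [|k IH]; first by rewrite mul0r addr0 expr0.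
  rewrite exprS; apply: le_trans (_ : q * (1 + k%:R * (q - 1)) <= _); last first.
    by rewrite ler_wpM2l // ltW // (lt_trans ltr01).
  have kq : 0 <= k%:R * (q - 1) * (q - 1) by rewrite !mulr_ge0 // subr_ge0 ltW.
  rewrite -natr1; lra.
have q10 : 0 < q - 1 by rewrite subr_gt0.
have [k Hk] : exists k : nat, x / (q - 1) <= k%:R.
  exists (Num.bound `|x / (q - 1)|); apply: le_trans (ler_norm _) _.
  by apply/ltW/archi_boundP; exact: normr_ge0.
exists k; apply: le_trans (bern k); rewrite ler_pdivrMr // in Hk.
by apply: le_trans Hk _; rewrite lerDr.
Qed.

Lemma orbit_annulus_step (P : 'rV[C]_n -> Prop) (up down : 'rV[C]_n -> 'rV[C]_n) (q : R) :
  1 < q ->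
  (forall z, normsq (up z) = q * normsq z) ->
  (forall z, normsq (down z) = q^-1 * normsq z) ->
  (forall z, z != 0 -> P (up z) -> P z) -> (forall z, z != 0 -> P (down z) -> P z) ->
  (forall z, 1 <= normsq z <= q -> P z) -> forall z, z != 0 -> P z.
Proof.
move=> q1 Nup Ndown Pup Pdown Pbase.
have q0 : 0 < q := lt_trans ltr01 q1.
have main k : forall z, z != 0 -> q ^- k <= normsq z <= q ^+ k.+1 -> P z.
  elim: k => [|k IH] z z0 /andP[lo hi].
    by apply: Pbase; rewrite expr0 invr1 in lo; rewrite lo hi.
  have nz x : normsq x > 0 -> x != 0 by rewrite normsq_gt0.
  have s0 : 0 < normsq z by rewrite normsq_gt0.
  have [s1|s1] := ltP (normsq z) 1.
    apply: (Pup _ z0); apply: IH; first by rewrite -normsq_gt0 Nup mulr_gt0.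
    rewrite Nup; apply/andP; split.
      have := ler_wpM2l (ltW q0) lo; rewrite exprS invfM mulrA mulfV ?gt_eqF // mul1r.
      exact.
    apply: le_trans (_ : q <= _); first by rewrite ger_pMr // ltW.
    by rewrite exprS ler_peMr ?(ltW q0) // exprn_ege1 // ltW.
  have [sq|sq] := leP (normsq z) q; first by apply: Pbase; rewrite s1 sq.
  apply: (Pdown _ z0); apply: IH.
    by rewrite -normsq_gt0 Ndown mulr_gt0 // invr_gt0.
  rewrite Ndown; apply/andP; split.
    apply: le_trans (_ : 1 <= _); first by rewrite invf_le1 ?exprn_gt0 // exprn_ege1 // ltW.
    by rewrite mulrC ler_pdivlMr // mul1r ltW.
  by rewrite mulrC ler_pdivrMr // -exprSr.
move=> z z0; have s0 : 0 < normsq z by rewrite normsq_gt0.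
have [k1 H1] := expr_unbounded (normsq z) q1.
have [k2 H2] := expr_unbounded (normsq z)^-1 q1.
apply: (main (maxn k1 k2)) => //; apply/andP; split.
  rewrite -[X in _ <= X]invrK lef_pV2 ?posrE ?exprn_gt0 ?invr_gt0 //.
  apply: le_trans H2 _; apply: ler_weXn2l; [exact: ltW|exact: leq_maxr].
apply: le_trans H1 _; apply: ler_weXn2l; first exact: ltW.
exact: leqW (leq_maxl _ _).
Qed.

(** The deck transformation multiplies [|z|] by a constant different from 1, so
    some power of it brings any point into a fixed closed annulus. Stated as an
    induction principle: an invariant property holds everywhere as soon as it
    holds on the annulus. *)
Lemma orbit_annulus (b : 'rV[C]_n) : hopf_multiplier b ->
  exists rho : R, forall P : 'rV[C]_n -> Prop,
    (forall z, z != 0 -> P (hopf_map b z) <-> P z) ->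
    (forall z, 1 <= normsq z <= rho -> P z) -> forall z, z != 0 -> P z.
Proof.
move=> [b0 beq b1].
have [i0 bi0] : exists i, b 0 i != 0.
  apply/existsP; apply: contraNT b0 => /existsPn H; apply/eqP/rowP => i.
  by rewrite mxE; apply/eqP; have := H i; rewrite negbK.
pose r := cabs (b 0 i0).
have br i : cabs (b 0 i) = r by apply: complexI; rewrite -!cabsE.
have r0 : 0 < r by rewrite lt_def cabs_eq0 bi0 cabs_ge0.
have r1 : r != 1 by have := b1 i0; rewrite cabsE -/r fmorph_eq1.
have bn i : b 0 i != 0 by rewrite -cabs_eq0 br gt_eqF.
pose b' : 'rV[C]_n := \row_i (b 0 i)^-1.
have br' i : cabs (b' 0 i) = r^-1.
  have rne : r != 0 by rewrite gt_eqF.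
  by apply: (mulIf rne); rewrite mxE -{1}(br i) -cabsM !mulVf // /cabs normr1.
have bK z : hopf_map b (hopf_map b' z) = z.
  by apply/rowP => i; rewrite !mxE mulrA mulfV // mul1r.
have bz z : z != 0 -> hopf_map b' z != 0.
  rewrite -!normsq_gt0 (normsq_hopf _ br') => s0.
  by rewrite mulr_gt0 // exprn_gt0 // invr_gt0.
have N z := normsq_hopf z br; have N' z := normsq_hopf z br'.
have inv2 : r^-1 ^+ 2 = (r ^+ 2)^-1 by rewrite exprVn.
have [lt1|gt1] : r < 1 \/ 1 < r by apply/orP; rewrite -neq_lt.
  exists (r^-1 ^+ 2) => P Pinv Pbase.
  apply: (orbit_annulus_step (up := hopf_map b') (down := hopf_map b) _ N' _ _ _ Pbase).
  - by rewrite exprn_egt1 // invf_gt1.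
  - by move=> z; rewrite N inv2 invrK.
  - by move=> z z0 /(Pinv _ (bz _ z0)); rewrite bK.
  - by move=> z z0 /(Pinv _ z0).
exists (r ^+ 2) => P Pinv Pbase.
apply: (orbit_annulus_step (up := hopf_map b) (down := hopf_map b') _ N _ _ _ Pbase).
- by rewrite exprn_egt1.
- by move=> z; rewrite N' inv2.
- by move=> z z0 /(Pinv _ z0).
- by move=> z z0 /(Pinv _ (bz _ z0)); rewrite bK.
Qed.

End SquaredNorm.

(** * Bounds on a compact fundamental region *)

Section Compactness.
Variables (R : realType) (n : nat).
Local Notation C := R[i].
Local Notation V := ('rV[R]_n * 'rV[R]_n)%type.
Local Notation W := (R^o * V)%type.
Local Notation X := (R * 'rV[C]_n)%type.
Implicit Types (z v : 'rV[C]_n).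

Lemma normsq_cvec (p : V) : normsq (cvec p) = \sum_k (p.1 0 k ^+ 2 + p.2 0 k ^+ 2).
Proof.
apply: eq_bigr => k _; apply: complexI.
by rewrite -cabs_sqr mxE /=; apply: complex_eqP => /=; ring.
Qed.

Lemma normsq_differentiable (p : V) : differentiable (fun q : V => normsq (cvec q) : R^o) p.
Proof.
have [+ _] := zdiff_sqnorm (cvec p); rewrite cvecK.
have -> // : (fun q : V => complex.Re (sqnorm (cvec q)) : R^o) = (fun q => normsq (cvec q)).
by apply/funext => q; rewrite sqnormE.
Qed.

(** Compact and, for a suitable [rho], meeting every orbit of the deck group at
    all times up to [t1]: it replaces the compact manifold [[0, t1] x M]. *)
Definition slab (t1 rho : R) : set W :=
  [set q | 0 <= q.1 <= t1 /\ 1 <= normsq (cvec q.2) <= rho].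

Lemma slab_compact (t1 rho : R) : compact (slab t1 rho).
Proof.
pose A : set V := [set p | 1 <= normsq (cvec p) <= rho].
have -> : slab t1 rho = (`[0, t1]%classic : set R^o) `*` A.
  by apply/seteqP; split => q /=; rewrite in_itv.
apply: compact_setX; first exact: segment_compact.
have sq_le (x : R) : x ^+ 2 <= rho -> - (1 + rho) <= x <= 1 + rho.
  move=> xr; rewrite -ler_norml; have := sqr_ge0 (`|x| - 1).
  by have := normr_ge0 x; rewrite -real_normK ?num_real // in xr; rewrite expr2 in xr *; nra.
pose B : set V := [set x : 'rV[R]_n | forall i, (`[- (1 + rho), 1 + rho]%classic : set R) (x ord0 i)] `*`
  [set x : 'rV[R]_n | forall i, (`[- (1 + rho), 1 + rho]%classic : set R) (x ord0 i)].
apply: (@subclosed_compact _ A B).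
- have -> : A = (fun q : V => normsq (cvec q)) @^-1` `[1, rho]%classic.
    by apply/seteqP; split => q /=; rewrite in_itv.
  apply: closed_comp; last exact: interval_closed.
  by move=> p _; apply: differentiable_continuous; exact: normsq_differentiable.
- have cB : compact [set x : 'rV[R]_n | forall i, (`[- (1 + rho), 1 + rho]%classic : set R) (x ord0 i)].
    apply: (@rV_compact R n (fun=> `[- (1 + rho), 1 + rho]%classic)) => i.
    exact: segment_compact.
  exact: compact_setX.
move=> p /= /andP[_]; rewrite normsq_cvec => hi.
have le k : p.1 0 k ^+ 2 + p.2 0 k ^+ 2 <= rho.
  apply: le_trans hi; rewrite (bigD1 k) //= lerDl; apply: sumr_ge0 => j _.
  by rewrite addr_ge0 ?sqr_ge0.
split=> i; rewrite /= in_itv /=; apply: sq_le; apply: le_trans (le i).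
  by rewrite lerDl sqr_ge0.
by rewrite lerDr sqr_ge0.
Qed.

Lemma compact_bdd (K : set W) (F : W -> R^o) : compact K ->
  (forall q, K q -> {for q, continuous F}) -> exists M : R, forall q, K q -> `|F q| <= M.
Proof.
move=> cK cF; have [[q0 Kq0]|K0] := pselect (exists q, K q); last first.
  by exists 0 => q Kq; case: K0; exists q.
have [||c Kc Hc] := @compact_EVT_max W R (fun q => `|F q|) K _ cK.
- by exists q0.
- apply: continuous_in_subspaceT => q /set_mem Kq.
  by apply: continuous_comp; [exact: cF|exact: norm_continuous].
by exists `|F c| => q Kq; apply: Hc; rewrite inE.
Qed.

Definition slab_pts (t1 rho : R) (x : X) : Prop := slab t1 rho (x.1, rvec x.2).

Lemma slab_ptsE t1 rho x : slab_pts t1 rho x <->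
  0 <= x.1 <= t1 /\ 1 <= normsq x.2 <= rho.
Proof. by rewrite /slab_pts /slab /= rvecK. Qed.

Lemma slab_neq0 t1 rho x : slab_pts t1 rho x -> x.2 != 0.
Proof.
move=> /slab_ptsE[_ /andP[lo _]]; rewrite -normsq_gt0.
exact: lt_le_trans ltr01 lo.
Qed.

Lemma dom_slab t1 rho (F : W -> C) :
  (forall q, slab t1 rho q -> cdiff F q) ->
  dom (slab_pts t1 rho) (fun=> 1) (fun x => F (x.1, rvec x.2)).
Proof.
move=> dF.
have [M1 HM1] := compact_bdd (F := fun q => complex.Re (F q)) (@slab_compact t1 rho)
  (fun q Kq => differentiable_continuous (dF q Kq).1).
have [M2 HM2] := compact_bdd (F := fun q => complex.Im (F q)) (@slab_compact t1 rho)
  (fun q Kq => differentiable_continuous (dF q Kq).2).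
exists (M1 + M2) => x Sx; rewrite mulr1 (complexE (F _)).
apply: le_trans (cabsD _ _) _; apply: lerD.
  apply: le_trans (HM1 _ Sx); rewrite /cabs normc_def /=.
  by rewrite expr0n addr0 sqrtr_sqr.
apply: le_trans (HM2 _ Sx); rewrite cabsM /cabs !normc_def /=.
by rewrite expr0n add0r expr1n addr0 sqrtr1 mul1r sqrtr_sqr.
Qed.

(** All these functions are continuous on the compact slab, because the solution
    is smooth on a neighbourhood of it. *)
Lemma solution_bounded b c1 c2 c3 c4 (T : \bar R) (g : R -> metric R n) (t1 rho : R) :
  hcf_solution b c1 c2 c3 c4 T g -> (t1%:E < T)%E ->
  bounded_geometry (slab_pts t1 rho) g.
Proof.
move=> [[U [oU UT sU]] eg] t1T.
pose G i j : W -> C := fun p => g p.1 (cvec p.2) i j.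
have slabU q : slab t1 rho q -> U q.
  case: q => t p [/andP[t0 tt1] /andP[lo _]].
  have := UT t (cvec p) t0; rewrite cvecK; apply.
    exact: le_lt_trans t1T.
  by rewrite -normsq_gt0; exact: lt_le_trans ltr01 lo.
have herm12 x : slab_pts t1 rho x -> hermitian_metric (g x.1).
  move=> Sx; have /slab_ptsE[/andP[t0 tt1] _] := Sx.
  have tT : (x.1%:E < T)%E by exact: le_lt_trans t1T.
  by have [[]] := eg _ t0 tT.
have bF (F : W -> C) (H : X -> C) : csmooth_on U F ->
  (forall x, F (x.1, rvec x.2) = H x) -> dom (slab_pts t1 rho) (fun=> 1) H.
  move=> sF FH; apply: (dom_eq (F := fun x => F (x.1, rvec x.2))) => //.
  by apply: dom_slab => q Kq; exact: csmooth_cdiff sF (slabU _ Kq).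
have Gt t i j : (fun z' => G i j (t, rvec z')) = (fun z' => g t z' i j).
  by apply/funext => z'; rewrite /G /= rvecK.
split.
- by move=> i j; apply: bF (sU i j) _ => x; rewrite /= rvecK.
- move=> i j.
  apply: (dom_eq (F := fun x => (fun q : W => (\det (g q.1 (cvec q.2)))^-1 *
      \adj (g q.1 (cvec q.2)) i j) (x.1, rvec x.2))).
    move=> x Sx /=; rewrite rvecK invmxE //.
    by apply: hermitian_unitmx; [exact: herm12|exact: slab_neq0 Sx].
  apply: (dom_slab (F := fun q : W => (\det (g q.1 (cvec q.2)))^-1 *
      \adj (g q.1 (cvec q.2)) i j)) => q Kq.
  apply: (closed_cramer (P := fun f => cdiff f q) (x0 := q)).
  + by move=> c; exact: cdiff_cst.
  + by move=> f h; exact: cdiffD.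
  + by move=> f h; exact: cdiffM.
  + by move=> f; exact: cdiffV.
  + by move=> k l; exact: csmooth_cdiff (sU k l) (slabU _ Kq).
  + have Sq : slab_pts t1 rho (q.1, cvec q.2) by rewrite /slab_pts /= cvecK; case: q Kq.
    by apply: hermitian_unitmx; [exact: (herm12 (q.1, cvec q.2))|exact: slab_neq0 Sq].
- move=> k i j; apply: bF (csmooth_jd (inl k) oU (sU i j)) _ => x.
  by rewrite /jd /= Gt rvecK.
move=> k l i j; apply: bF (csmooth_jd (inr l) oU (csmooth_jd (inl k) oU (sU i j))) _ => x.
have E : (fun z => jd (inl k) (G i j) (x.1, rvec z)) =
    frame_deriv (inl k) (fun y => g x.1 y i j).
  by apply/funext => z; rewrite /jd /= Gt rvecK.
by rewrite [LHS]/jd E rvecK.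
Qed.

(** The barrier [|z|^-4] of the comparison argument is explicit, and its second
    derivatives are polynomials in the coordinates and [|z|^-2]. *)
Lemma barrier_bounded t1 rho k l : dom (slab_pts t1 rho) (fun=> 1)
  (fun x => frame_deriv (inr l) (frame_deriv (inl k)
     (fun z => (sqnorm z)^-1 * (sqnorm z)^-1)) x.2).
Proof.
have dz q f : zdiff f (cvec q.2) -> cdiff (fun q : W => f (cvec q.2)) q.
  rewrite /zdiff cvecK => -[fr fi]; split.
    apply: (@differentiable_comp _ _ _ _ (fun q : W => q.2)
      (fun p : V => complex.Re (f (cvec p)) : R^o)) => //; exact: snd_differentiable.
  apply: (@differentiable_comp _ _ _ _ (fun q : W => q.2)
      (fun p : V => complex.Im (f (cvec p)) : R^o)) => //; exact: snd_differentiable.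
pose H z : C := - (2%:R * (k == l)%:R) * ((sqnorm z)^-1 * (sqnorm z)^-1 * (sqnorm z)^-1)
  + 6%:R * ((z 0 k)^* * z 0 l) * ((sqnorm z)^-1 * (sqnorm z)^-1 * ((sqnorm z)^-1 * (sqnorm z)^-1)).
have HE z : z != 0 -> frame_deriv (inr l) (frame_deriv (inl k)
     (fun z => (sqnorm z)^-1 * (sqnorm z)^-1)) z = H z.
  move=> z0.
  have di (x : 'rV[C]_n) : x != 0 -> zdiff (fun x => (sqnorm x)^-1) x by exact: zdiff_inv_sqnorm.
  rewrite (frame_deriv_punctured (g := fun x => (- 2%:R * (x 0 k)^*) *
     ((sqnorm x)^-1 * (sqnorm x)^-1 * (sqnorm x)^-1)) _ z0); last first.
    move=> x x0; rewrite (frame_derivM _ (di x x0) (di x x0)).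
    rewrite frame_deriv_inv_sqnorm //=.
    have alg (K : fieldType) (s zc : K) : s != 0 -> - zc / s ^+ 2 * s^-1 + s^-1 * (- zc / s ^+ 2) =
       - 2%:R * zc * (s^-1 * s^-1 * s^-1) by move=> s0; field.
    by apply: alg; exact: sqnorm_neq0.
  have dzk : zdiff (fun x => - 2%:R * (x 0 k)^*) z.
    by apply: cdiffM; [exact: cdiff_cst|apply: cdiff_conj; exact: zdiff_coord].
  have d2i : zdiff (fun x => (sqnorm x)^-1 * (sqnorm x)^-1) z by exact: cdiffM (di z z0) (di z z0).
  have d3i : zdiff (fun x => (sqnorm x)^-1 * (sqnorm x)^-1 * (sqnorm x)^-1) z.
    exact: cdiffM d2i (di z z0).
  rewrite (frame_derivM _ dzk d3i) (frame_derivM _ d2i (di z z0)).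
  rewrite (frame_derivM _ (di z z0) (di z z0)) frame_deriv_inv_sqnorm //=.
  have dc : zdiff (fun x => (x 0 k)^*) z by apply: cdiff_conj; exact: zdiff_coord.
  rewrite (@frame_derivM R n _ (fun=> - 2%:R) _ z (cdiff_cst _ _) dc).
  rewrite frame_deriv_cst frame_deriv_coord_conj eq_sym /H.
  have alg (K : fieldType) (s zc w d : K) : s != 0 ->
    (0 * zc + - 2%:R * d) * (s^-1 * s^-1 * s^-1) + - 2%:R * zc *
    ((- w / s ^+ 2 * s^-1 + s^-1 * (- w / s ^+ 2)) * s^-1 + s^-1 * s^-1 * (- w / s ^+ 2)) =
    - (2%:R * d) * (s^-1 * s^-1 * s^-1) + 6%:R * (zc * w) * (s^-1 * s^-1 * (s^-1 * s^-1)).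
    by move=> s0; field.
  by apply: alg; exact: sqnorm_neq0.
apply: (dom_eq (F := fun x => H (cvec (rvec x.2)))).
  by move=> x Sx; rewrite rvecK HE //; exact: slab_neq0 Sx.
apply: (dom_slab (F := fun q : W => H (cvec q.2))) => q Kq; apply: dz.
have z0 : cvec q.2 != 0.
  case: Kq => _ /andP[lo _]; rewrite -normsq_gt0; exact: lt_le_trans ltr01 lo.
have di := zdiff_inv_sqnorm z0.
apply: cdiffD; apply: cdiffM; try exact: cdiff_cst.
- by do 2 (apply: cdiffM => //).
- apply: cdiffM; first exact: cdiff_cst.
  by apply: cdiffM; [apply: cdiff_conj|]; exact: zdiff_coord.
- by do 2 (apply: cdiffM => //).
Qed.

End Compactness.

(** * Uniqueness of the flow *)

Lemma hopf_map_neq0 (R : realType) (n : nat) (b z : 'rV[R[i]]_n) :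
  hopf_multiplier b -> z != 0 -> hopf_map b z != 0.
Proof.
move=> [b0 beq _] z0; rewrite hopf_mapE mulmx_neq0 // unitmxE det_diag unitfE.
apply/prodf_neq0 => i _; apply: contraNneq b0 => bi0.
apply/eqP/rowP => j; rewrite mxE; apply/eqP.
by rewrite -normr_eq0 (beq j i) bi0 normr0.
Qed.

Lemma no_growth (F : realFieldType) (p q y : F) :
  0 < y -> (p + q + 1) * y <= q * y + p * y -> False.
Proof. by move=> y0; rewrite !mulrDl mul1r; lra. Qed.

Section Uniqueness.
Variables (R : realType) (n : nat).
Local Notation C := R[i].
Local Notation V := ('rV[R]_n * 'rV[R]_n)%type.
Local Notation W := (R^o * V)%type.
Local Notation X := (R * 'rV[C]_n)%type.
Implicit Types (z v : 'rV[C]_n).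

Variables (b : 'rV[C]_n) (c1 c2 c3 c4 : R) (T : \bar R) (g1 g2 : R -> metric R n).
Hypothesis hb : hopf_multiplier b.
Hypothesis sol1 : hcf_solution b c1 c2 c3 c4 T g1.
Hypothesis sol2 : hcf_solution b c1 c2 c3 c4 T g2.

Let u (t : R) z : R := complex.Re (sqdiff g1 g2 t z).

Let live (t : R) := 0 <= t /\ (t%:E < T)%E.

Let metric1 t : live t -> hermitian_metric (g1 t).
Proof. by move=> [t0 tT]; have [_ s] := sol1; have [[]] := s t t0 tT. Qed.

Let metric2 t : live t -> hermitian_metric (g2 t).
Proof. by move=> [t0 tT]; have [_ s] := sol2; have [[]] := s t t0 tT. Qed.

Let sqdiffE t z : live t -> z != 0 ->
  sqdiff g1 g2 t z = (\sum_i \sum_j cabs (g1 t z i j - g2 t z i j) ^+ 2)%:C.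
Proof.
move=> lt z0; have [_ h1 _] := metric1 lt; have [_ h2 _] := metric2 lt.
rewrite /sqdiff rmorph_sum; apply: eq_bigr => i _ /=.
rewrite rmorph_sum; apply: eq_bigr => j _ /=.
by rewrite (h1 z z0 i j) (h2 z z0 i j) -rmorphB /= cabs_sqr.
Qed.

Let sqdiff_u t z : live t -> z != 0 -> sqdiff g1 g2 t z = (u t z)%:C.
Proof. by move=> lt z0; rewrite /u sqdiffE. Qed.

Let u_eq0 t z : live t -> z != 0 -> u t z <= 0 -> g1 t z = g2 t z.
Proof.
move=> lt z0; rewrite /u sqdiffE //= => u0.
have s0 i : 0 <= \sum_j cabs (g1 t z i j - g2 t z i j) ^+ 2.
  by apply: sumr_ge0 => j _; exact: sqr_ge0.
have : \sum_i \sum_j cabs (g1 t z i j - g2 t z i j) ^+ 2 == 0.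
  by rewrite eq_le u0 sumr_ge0.
rewrite psumr_eq0 // => /allP H1; apply/matrixP => i j.
have := H1 i (mem_index_enum i); rewrite /= psumr_eq0 => [/allP H2|k _]; last exact: sqr_ge0.
have := H2 j (mem_index_enum j); rewrite /= sqrf_eq0 cabs_eq0 subr_eq0.
by move/eqP.
Qed.

(* The components of a metric on the quotient scale like [|z|^-2], hence [u],
   which is computed in coordinates, like [|z|^-4]. *)
Let weight_inv t z : live t -> z != 0 ->
  normsq (hopf_map b z) ^+ 2 * u t (hopf_map b z) = normsq z ^+ 2 * u t z.
Proof.
move=> lt z0; have [t0 tT] := lt; have [b0 beq _] := hb.
have [_ s1] := sol1; have [_ s2] := sol2.
have [[_ i1] _] := s1 t t0 tT; have [[_ i2] _] := s2 t t0 tT.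
have [k zk] : exists k, z 0 k != 0.
  apply/existsP; apply: contraNT z0 => /existsPn H; apply/eqP/rowP => i.
  by rewrite mxE; apply/eqP; have := H i; rewrite negbK.
pose r := cabs (b 0 k).
have br i : cabs (b 0 i) = r by apply: complexI; rewrite -!cabsE.
have bz0 : hopf_map b z != 0 by exact: hopf_map_neq0.
rewrite (normsq_hopf _ br) /u !sqdiffE //= exprMn -mulrA mulrCA; congr (_ * _).
rewrite mulr_sumr; apply: eq_bigr => i _; rewrite mulr_sumr; apply: eq_bigr => j _.
rewrite (i1 z z0) (i2 z z0) -!mulrBl !cabsM cabs_conj !br.
by ring.
Qed.

Let jF (q : W) : C := sqdiff g1 g2 q.1 (cvec q.2).

Let jF_diff (q : W) : live q.1 -> cvec q.2 != 0 -> cdiff jF q.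
Proof.
move=> [t0 tT] z0; have [[U1 [oU1 UT1 s1]] _] := sol1; have [[U2 [oU2 UT2 s2]] _] := sol2.
have d1g i j : cdiff (fun q : W => g1 q.1 (cvec q.2) i j) q.
  apply: csmooth_cdiff (s1 i j) _; have := UT1 _ _ t0 tT z0.
  by rewrite cvecK; case: q {t0 tT z0}.
have d2g i j : cdiff (fun q : W => g2 q.1 (cvec q.2) i j) q.
  apply: csmooth_cdiff (s2 i j) _; have := UT2 _ _ t0 tT z0.
  by rewrite cvecK; case: q {t0 tT z0 d1g}.
have dh i j : cdiff (fun q : W => g1 q.1 (cvec q.2) i j - g2 q.1 (cvec q.2) i j) q.
  exact: cdiffB (d1g i j) (d2g i j).
by apply: cdiff_sum => i; apply: cdiff_sum => j; exact: cdiffM.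
Qed.

Let barrier z : C := (sqnorm z)^-1 * (sqnorm z)^-1.

Let barrierE z : barrier z = ((normsq z)^-1 ^+ 2)%:C.
Proof. by rewrite /barrier sqnormE -fmorphV -rmorphM expr2. Qed.

Let zdiff_u t : live t -> forall z, z != 0 -> zdiff (sqdiff g1 g2 t) z.
Proof.
move=> lt z z0; have := @jF_diff (t, rvec z); rewrite /= rvecK => /(_ lt z0).
exact: (@slice_cdiff R n jF).
Qed.

Let zdiff_barrier z : z != 0 -> zdiff barrier z.
Proof. by move=> z0; apply: cdiffM; exact: zdiff_inv_sqnorm. Qed.

Let zdiff_dbarrier A z : z != 0 -> zdiff (frame_deriv A barrier) z.
Proof.
move=> z0; have di (x : 'rV[C]_n) : x != 0 -> zdiff (fun x => (sqnorm x)^-1) x by exact: zdiff_inv_sqnorm.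
pose w (x : 'rV[C]_n) : C := match A with inl k => (x 0 k)^* | inr k => x 0 k end.
have dw : zdiff w z.
  by rewrite /w; case: (A) => k; [apply: cdiff_conj|]; exact: zdiff_coord.
apply: (zdiff_punctured (f := fun x => -1 * w x * ((sqnorm x)^-1 * (sqnorm x)^-1) * (sqnorm x)^-1 +
   (sqnorm x)^-1 * (-1 * w x * ((sqnorm x)^-1 * (sqnorm x)^-1))) z0).
  move=> x x0; rewrite /barrier (frame_derivM A (di x x0) (di x x0)).
  by rewrite frame_deriv_inv_sqnorm // -/(w x) expr2 invfM !mulN1r.
have d1' : zdiff (fun x => -1 * w x * ((sqnorm x)^-1 * (sqnorm x)^-1)) z.
  apply: cdiffM; first by apply: cdiffM => //; exact: cdiff_cst.
  by apply: cdiffM; exact: di.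
by apply: cdiffD; apply: cdiffM => //; exact: di.
Qed.

Let zdiff_du t A z : live t -> z != 0 -> zdiff (frame_deriv A (sqdiff g1 g2 t)) z.
Proof.
move=> lt z0; have H1 := metric1 lt; have H2 := metric2 lt.
pose h i j x := g1 t x i j - g2 t x i j.
have sh i j : zsmooth (h i j).
  exact: csmoothB (@open_punctured R n) (hermitian_zsmooth i j H1) (hermitian_zsmooth i j H2).
have dh i j x : x != 0 -> zdiff (h i j) x by exact: zsmooth_zdiff.
have ddh i j : zdiff (frame_deriv A (h i j)) z.
  exact: zsmooth_zdiff (zsmooth_frame_deriv _ (sh i j)) z0.
apply: (zdiff_punctured (f := fun x => \sum_i \sum_j
   (frame_deriv A (h i j) x * h j i x + h i j x * frame_deriv A (h j i) x)) z0).
  move=> x x0; rewrite [RHS](@frame_deriv_sum R n _ _ (fun i x => \sum_j h i j x * h j i x)).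
    apply: eq_bigr => i _; rewrite (@frame_deriv_sum R n _ _ (fun j x => h i j x * h j i x)).
      by apply: eq_bigr => j _; rewrite (frame_derivM A (dh i j x x0) (dh j i x x0)).
    by move=> j; apply: cdiffM; exact: dh.
  by move=> i; apply: cdiff_sum => j; apply: cdiffM; exact: dh.
apply: cdiff_sum => i; apply: cdiff_sum => j.
by apply: cdiffD; apply: cdiffM; try exact: ddh; exact: dh.
Qed.

(** [u - c |z|^-4] has a maximum at the touching point, so its Laplacian is
    nonpositive there. *)
Let touching_laplacian t z (c : R) : live t -> z != 0 ->
  (forall x, x != 0 -> u t x <= c * (normsq x)^-1 ^+ 2) ->
  u t z = c * (normsq z)^-1 ^+ 2 ->
  complex.Re (contract (g1 t z) (fun k l =>
     frame_deriv (inr l) (frame_deriv (inl k) (sqdiff g1 g2 t)) z)) <=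
  c * complex.Re (contract (g1 t z) (fun k l =>
     frame_deriv (inr l) (frame_deriv (inl k) barrier) z)).
Proof.
move=> lt z0 uc uz; have [_ h1 p1] := metric1 lt.
pose f x := sqdiff g1 g2 t x - c%:C * barrier x.
have dcb x : x != 0 -> zdiff (fun x => c%:C * barrier x) x.
  by move=> x0; apply: cdiffM; [exact: cdiff_cst|exact: zdiff_barrier].
have fA A x : x != 0 -> frame_deriv A f x =
    frame_deriv A (sqdiff g1 g2 t) x - c%:C * frame_deriv A barrier x.
  move=> x0; rewrite (frame_derivB A (zdiff_u lt x0) (dcb x x0)).
  rewrite (@frame_derivM R n A (fun=> c%:C) barrier x (cdiff_cst _ _) (zdiff_barrier x0)).
  by rewrite frame_deriv_cst mul0r add0r.
have dB A x : x != 0 -> zdiff (fun x => c%:C * frame_deriv A barrier x) x.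
  by move=> x0; apply: cdiffM; [exact: cdiff_cst|exact: zdiff_dbarrier].
have subzd f1 f2 x : zdiff f1 x -> zdiff f2 x -> zdiff (fun y => f1 y - f2 y) x.
  exact: cdiffB.
have fre x : x != 0 -> f x = (u t x - c * (normsq x)^-1 ^+ 2)%:C.
  by move=> x0; rewrite /f sqdiff_u // barrierE -rmorphM -rmorphB.
pose A := contract (g1 t z) (fun k l =>
  frame_deriv (inr l) (frame_deriv (inl k) (sqdiff g1 g2 t)) z).
pose B := contract (g1 t z) (fun k l =>
  frame_deriv (inr l) (frame_deriv (inl k) barrier) z).
have E : contract (g1 t z) (fun k l => frame_deriv (inr l) (frame_deriv (inl k) f) z) =
   A + (- c%:C) * B.
  rewrite -contractZ -big_split; apply: eq_bigr => k _; rewrite -big_split.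
  apply: eq_bigr => l _ /=; rewrite -mulrDr; congr (_ * _).
  rewrite (frame_deriv_punctured (g := fun x => frame_deriv (inl k) (sqdiff g1 g2 t) x -
     c%:C * frame_deriv (inl k) barrier x) _ z0); last by move=> x; exact: fA.
  rewrite (frame_derivB _ (zdiff_du _ lt z0) (dB (inl k) z z0)) mulNr; congr (_ - _).
  rewrite (@frame_derivM R n _ (fun=> c%:C) (frame_deriv (inl k) barrier) z (cdiff_cst _ _) (zdiff_dbarrier _ z0)).
  by rewrite frame_deriv_cst mul0r add0r.
suff : complex.Re (A + (- c%:C) * B) <= 0.
  by rewrite cReD mulNr raddfN /= cReM /= mul0r subr0 subr_le0.
rewrite -E; apply: contract_max => //; [exact: h1|exact: p1| | | |].
- by move=> x x0; apply: subzd; [exact: zdiff_u|exact: dcb].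
- move=> F; apply: (zdiff_punctured (f := fun x => frame_deriv F (sqdiff g1 g2 t) x -
     c%:C * frame_deriv F barrier x) z0); first by move=> x x0; rewrite fA.
  by apply: subzd; [exact: zdiff_du|exact: dB].
- by move=> x x0; rewrite fre.
- by move=> x x0; rewrite !fre //= uz subrr subr_le0; exact: uc.
Qed.

(** Only times before [t] are available, so the derivative test is the one-sided
    [left_deriv_max]. *)
Let time_touching t z (c K : R) : live t -> 0 < t -> z != 0 ->
  (forall s, 0 <= s <= t -> u s z <= c * expR (K * s)) -> u t z = c * expR (K * t) ->
  K * u t z <= complex.Re (time_deriv (fun s => sqdiff g1 g2 s z) t).
Proof.
move=> lt t0 z0 uc ut.
have [dF _] : cdiff (fun s : R^o => sqdiff g1 g2 s z) t.
  have := @jF_diff (t, rvec z); rewrite /= rvecK => /(_ lt z0) /(@time_cdiff R n jF).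
  by rewrite /jF /= rvecK.
have dFt : derivable (fun s : R => u s z : R^o) t 1 by exact: diff_derivable.
have dK : is_derive t 1 (fun s : R => K * s) K.
  have := @is_deriveZ R R^o R^o id K t 1 1 (is_derive_id _ _).
  by rewrite -[K *: 1]/(K * 1) mulr1.
have [dE dEE] := is_derive1_comp (is_derive_expR (K * t)) dK.
have dcE : derivable (fun s : R => c * expR (K * s) : R^o) t 1.
  exact: (@derivableZ R R^o R^o _ c t 1 dE).
have vcE : 'D_1 (fun s : R => c * expR (K * s) : R^o) t = c * (expR (K * t) * K).
  rewrite -dEE; exact: (@deriveZ R R^o R^o _ c t 1 dE).
have := @left_deriv_max R (fun s => u s z - c * expR (K * s)) 0 t t0.
rewrite (_ : 'D_1 _ t = 'D_1 (fun s : R => u s z : R^o) t - c * (expR (K * t) * K)); last first.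
  by apply: etrans (@deriveB R R^o R^o _ _ t 1 dFt dcE) _; rewrite vcE.
have -> : complex.Re (time_deriv (fun s => sqdiff g1 g2 s z) t) =
    'D_1 (fun s : R => u s z : R^o) t.
  by rewrite /time_deriv /= derive1E.
move=> H; rewrite -subr_ge0 ut.
have -> : K * (c * expR (K * t)) = c * (expR (K * t) * K) by ring.
apply: H; first exact: (@derivableB R R^o R^o _ _ t 1 dFt dcE).
by move=> s /andP[s0 st]; rewrite ut subrr subr_le0 uc // s0.
Qed.

(** Maximum principle. The invariant function [e^{-Kt} |z|^4 u] attains its
    maximum [m] over times [0 <= t <= t1] at a point of the slab. If [m > 0],
    then [t > 0] there, and the barrier [m e^{Kt} |z|^-4] touches [u] from above,
    which bounds [d_t u] below by [K u] and the Laplacian of [u] above by a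
    multiple of [u]. For [K] large this contradicts [parabolic_inequality]. *)
Theorem hcf_unique : (forall z, z != 0 -> g1 0 z = g2 0 z) ->
  forall t z, 0 <= t -> (t%:E < T)%E -> z != 0 -> g1 t z = g2 t z.
Proof.
move=> init t1 z1 t10 t1T z10; have [rho orbP] := orbit_annulus hb.
have live1 s : 0 <= s <= t1 -> live s.
  by move=> /andP[s0 st]; split=> //; exact: le_lt_trans t1T.
pose S := slab_pts (n := n) t1 rho.
have S_dom x : S x -> [/\ 0 <= x.1, (x.1%:E < T)%E & x.2 != 0].
  move=> Sx; have /slab_ptsE[t01 _] := Sx; have [? ?] := live1 _ t01.
  by split=> //; exact: slab_neq0 Sx.
have B1 := solution_bounded rho sol1 t1T.
have B2 := solution_bounded rho sol2 t1T.
have [Kp HKp] := parabolic_inequality sol1 sol2 S_dom B1 B2.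
have [M HM] : dom S (fun=> 1) (fun x => contract (g1 x.1 x.2) (fun k l =>
     frame_deriv (inr l) (frame_deriv (inl k) barrier) x.2)).
  have [_ bi _ _] := B1.
  apply: dom_sum => k; apply: dom_sum => l; apply: domM; first exact: bi.
  exact: barrier_bounded.
pose K2 := `|M| * rho ^+ 2; pose K := Kp + K2 + 1.
have barrier_le x : S x -> complex.Re (contract (g1 x.1 x.2) (fun k l =>
     frame_deriv (inr l) (frame_deriv (inl k) barrier) x.2)) <= K2 * (normsq x.2)^-1 ^+ 2.
  move=> Sx; apply: le_trans (Re_le_cabs _) _; apply: le_trans (HM x Sx) _.
  rewrite mulr1; apply: le_trans (ler_norm _) _; rewrite /K2 -mulrA ler_peMr //.
  have /slab_ptsE[_ /andP[lo hi]] := Sx.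
  have N0 : 0 < normsq x.2 by exact: lt_le_trans ltr01 lo.
  by rewrite -exprMn exprn_ege1 // ler_pdivlMr // mul1r.
apply: u_eq0 => //; move: z1 z10; apply: (orbP (fun z => u t1 z <= 0)).
  move=> z z0; have := weight_inv (conj t10 t1T) z0.
  have bz0 : hopf_map b z != 0.
    exact: hopf_map_neq0.
  move=> E; have := pmulr_rle0 (u t1 (hopf_map b z)) (exprn_gt0 2 (etrans (normsq_gt0 _) bz0)).
  have := pmulr_rle0 (u t1 z) (exprn_gt0 2 (etrans (normsq_gt0 _) z0)).
  by rewrite E => -> ->.
move=> z1 z1_rho; rewrite leNgt; apply/negP => u1.
pose phi (q : W) : R := expR (- K * q.1) * (normsq (cvec q.2) ^+ 2 * u q.1 (cvec q.2)).
have q1S : slab t1 rho ((t1, rvec z1) : W).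
  by split => /=; rewrite ?rvecK // t10 lexx.
have slab_facts (q : W) : slab t1 rho q -> live q.1 /\ cvec q.2 != 0.
  move=> [qt /andP[lo _]]; split; first exact: live1.
  by rewrite -normsq_gt0; exact: lt_le_trans ltr01 lo.
have [||q0 /set_mem q0S phimax] := @compact_EVT_max W R phi (slab t1 rho) _ (@slab_compact R n t1 rho).
- by exists (t1, rvec z1).
- apply: continuous_in_subspaceT => q /set_mem qS; have [lq zq] := slab_facts _ qS.
  have cu : {for q, continuous (fun q : W => u q.1 (cvec q.2))}.
    by apply: differentiable_continuous; have [] := jF_diff lq zq.
  have cN : {for q, continuous (fun q : W => normsq (cvec q.2))}.
    apply: differentiable_continuous.
    apply: (@differentiable_comp _ _ _ _ (fun q : W => q.2)
      (fun p : V => normsq (cvec p) : R^o)); first exact: snd_differentiable.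
    exact: normsq_differentiable.
  have cE : {for q, continuous (fun q : W => expR (- K * q.1))}.
    apply: continuous_comp; last exact: continuous_expR.
    by apply: cvgM; [exact: cvg_cst|exact: cvg_fst].
  by apply: cvgM => //; apply: cvgM => //; rewrite expr2; under eq_fun do rewrite expr2; exact: cvgM.
have [lq zq] := slab_facts _ q0S.
set t := q0.1 in lq; set z := cvec q0.2 in zq.
pose m := phi q0.
have m0 : 0 < m.
  apply: lt_le_trans (phimax _ _); last by rewrite inE; exact: q1S.
  rewrite /phi /= rvecK mulr_gt0 ?expR_gt0 // mulr_gt0 // exprn_gt0 //.
  by case/andP: z1_rho => lo _; exact: lt_le_trans ltr01 lo.
have N0 (x : 'rV[C]_n) : x != 0 -> 0 < normsq x by rewrite normsq_gt0.
have above s (x : 'rV[C]_n) : 0 <= s <= t1 -> x != 0 ->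
    u s x <= m * expR (K * s) * (normsq x)^-1 ^+ 2.
  move=> st1; move: x.
  apply: (orbP (fun x => u s x <= m * expR (K * s) * (normsq x)^-1 ^+ 2)) => [x x0|x xrho].
    have bx0 : hopf_map b x != 0.
      exact: hopf_map_neq0.
    have E := weight_inv (live1 _ st1) x0.
    have Hx y : y != 0 -> (u s y <= m * expR (K * s) * (normsq y)^-1 ^+ 2) =
        (normsq y ^+ 2 * u s y <= m * expR (K * s)).
      by move=> y0; rewrite exprVn ler_pdivlMr ?exprn_gt0 ?N0 // mulrC.
    by rewrite !Hx // E.
  have xS : slab t1 rho ((s, rvec x) : W) by split => /=; rewrite ?rvecK.
  have := phimax (s, rvec x); rewrite inE => /(_ xS).
  have Nx : 0 < normsq x by case/andP: xrho => lo _; exact: lt_le_trans ltr01 lo.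
  rewrite -/m /phi /= rvecK => H.
  rewrite exprVn ler_pdivlMr ?exprn_gt0 // mulrC -ler_pdivrMr ?expR_gt0 //.
  by rewrite -expRN -mulNr [X in X <= _]mulrC.
have at_max : u t z = m * expR (K * t) * (normsq z)^-1 ^+ 2.
  rewrite /m /phi -/t -/z mulNr expRN.
  have := N0 z zq; have := expR_gt0 (K * t); move: (expR _) (normsq z) (u t z) => e1 e2 e3 p1 p2.
  by field; rewrite !gt_eqF.
have u0 : 0 < u t z.
  rewrite at_max; apply: mulr_gt0; first by apply: mulr_gt0 => //; exact: expR_gt0.
  by rewrite exprn_gt0 // invr_gt0; exact: N0.
have [/andP[t0 tt1] _] := q0S; rewrite -/t in t0 tt1.
have t_gt0 : 0 < t.
  rewrite lt_def t0 andbT; apply: contraTneq u0 => t00.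
  rewrite -leNgt /u /sqdiff t00 init // big1 // => i _.
  by rewrite big1 // => j _; rewrite subrr mul0r.
have qS : S (t, z).
  rewrite /S /slab_pts /=; have -> // : (t, rvec z) = q0 :> W.
  by rewrite /z cvecK /t; case: (q0).
have time_le : K * u t z <= complex.Re (time_deriv (fun s => sqdiff g1 g2 s z) t).
  apply: (time_touching (c := m * (normsq z)^-1 ^+ 2)) => // [s /andP[s0 st]|].
    by rewrite mulrAC; apply: above => //; rewrite s0 (le_trans st).
  by rewrite mulrAC.
have space_le := touching_laplacian (c := m * expR (K * t)) lq zq
  (fun x x0 => above t x (introT andP (conj t0 tt1)) x0) at_max.
have := HKp _ qS; rewrite /= -/t -/z => par.
have bar := barrier_le _ qS; rewrite /= in bar.
have mE0 : 0 <= m * expR (K * t) by rewrite mulr_ge0 ?expR_ge0 // ltW.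
have sp2 := le_trans space_le (ler_wpM2l mE0 bar).
have E2 : m * expR (K * t) * (K2 * (normsq z)^-1 ^+ 2) = K2 * u t z.
  by rewrite at_max; ring.
rewrite E2 in sp2.
have := le_trans time_le (le_trans par (lerD sp2 (lexx (Kp * u t z)))).
by move/(no_growth u0).
Qed.

End Uniqueness.

(** * Metrics with unitary symmetry *)

Section ScaledUnitary.
Variables (C : numClosedFieldType) (n : nat).
Implicit Types (A G : 'M[C]_n) (u v w z : 'rV[C]_n).

Definition ctr m p (A : 'M[C]_(m, p)) : 'M[C]_(p, m) := (map_mx Num.conj A)^T.

Definition dotc u v : C := (u *m ctr v) 0 0.

Lemma mul_ctr u v : u *m ctr v = (dotc u v)%:M.
Proof. exact: mx11_scalar. Qed.

Lemma dotcE u v : dotc u v = \sum_k u 0 k * (v 0 k)^*.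
Proof. by rewrite /dotc mxE; apply: eq_bigr => k _; rewrite !mxE. Qed.

Lemma ctrM m p q (A : 'M[C]_(m, p)) (B : 'M[C]_(p, q)) : ctr (A *m B) = ctr B *m ctr A.
Proof. by rewrite /ctr map_mxM trmx_mul. Qed.

Lemma ctrK m p (A : 'M[C]_(m, p)) : ctr (ctr A) = A.
Proof. by apply/matrixP => i j; rewrite !mxE conjCK. Qed.

Lemma ctrB m p (A B : 'M[C]_(m, p)) : ctr (A - B) = ctr A - ctr B.
Proof. by apply/matrixP => i j; rewrite !mxE rmorphB. Qed.

Lemma ctrZ m p (c : C) (A : 'M[C]_(m, p)) : ctr (c *: A) = c^* *: ctr A.
Proof. by apply/matrixP => i j; rewrite !mxE rmorphM. Qed.

Lemma ctr1 : ctr 1%:M = 1%:M :> 'M[C]_n.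
Proof. by rewrite /ctr map_mx1 trmx1. Qed.

(** The group generated by [U(n)] and the homotheties; it acts transitively on
    [C^n] minus the origin. *)
Definition scaled_unitary (s : C) A := A *m ctr A = s%:M.

Lemma scaled_unitary_unitmx s A : s != 0 -> scaled_unitary s A -> A \in unitmx.
Proof.
move=> s0 sA; have : A *m (s^-1 *: ctr A) = 1%:M.
  by rewrite -scalemxAr sA scale_scalar_mx mulVf.
by move/mulmx1_unit => [].
Qed.

Lemma dotc_scaled_unitary s A u v : scaled_unitary s A ->
  dotc (u *m A) (v *m A) = s * dotc u v.
Proof.
move=> sA; rewrite /dotc ctrM mulmxA -(mulmxA u) sA mul_mx_scalar -scalemxAl.
by rewrite mxE.
Qed.

(** [hopf_g] in matrix form and with complex parameters, over an abstract field. *)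
Definition hopf_mx (a b : C) z : 'M[C]_n :=
  (a / dotc z z)%:M + (b / dotc z z ^+ 2) *: (ctr z *m z).

Lemma hopf_mx_pull a b s A z : s != 0 -> dotc z z != 0 -> scaled_unitary s A ->
  pull A (hopf_mx a b (z *m A)) = hopf_mx a b z.
Proof.
move=> s0 z0 sA; rewrite /hopf_mx (dotc_scaled_unitary z z sA) /pull -/(ctr A).
rewrite mulmxDr mulmxDl mul_mx_scalar -scalemxAl sA scale_scalar_mx.
rewrite -scalemxAr -scalemxAl ctrM !mulmxA sA mul_scalar_mx -!mulmxA sA.
rewrite mul_mx_scalar -scalemxAr -scalemxAl !scalerA.
congr (_%:M + _ *: _); field; first by rewrite z0.
by rewrite s0 z0.
Qed.

(** The reflection in the hyperplane orthogonal to [x - y]. It exchanges [x] and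
    [y] only if their inner product is real, which a change of phase arranges. *)
Lemma reflection x y : dotc x x = 1 -> dotc y y = 1 -> dotc x y = dotc y x ->
  exists2 A, scaled_unitary 1 A & x *m A = y.
Proof.
move=> xx yy xy; pose w := x - y; pose q := dotc w w.
have dB u v t : dotc (u - v) t = dotc u t - dotc v t.
  by rewrite /dotc mulmxBl !mxE.
have Bd u v t : dotc t (u - v) = dotc t u - dotc t v.
  by rewrite /dotc ctrB mulmxBr !mxE.
have qE : q = 2%:R * (1 - dotc x y).
  by rewrite /q /w dB !Bd xx yy -xy; ring.
have [q0|q0] := eqVneq q 0.
  exists 1%:M; first by rewrite /scaled_unitary ctr1 mulmx1.
  rewrite mulmx1; apply/eqP; rewrite -subr_eq0 -/w; apply/eqP/rowP => k.
  rewrite [RHS]mxE; apply/eqP; rewrite -normr_eq0 -sqrf_eq0.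
  have : \sum_k `|w 0 k| ^+ 2 == 0.
    suff -> : \sum_k `|w 0 k| ^+ 2 = q by rewrite q0.
    by rewrite /q dotcE; apply: eq_bigr => j _; exact: normCK.
  rewrite psumr_eq0 => [/allP H|j _]; last by rewrite exprn_ge0.
  exact: H (mem_index_enum k).
pose H : 'M[C]_n := 1%:M - (2%:R / q) *: (ctr w *m w).
have qr : q^* = q.
  rewrite /q dotcE rmorph_sum; apply: eq_bigr => k _.
  by rewrite rmorphM /= conjCK mulrC.
have Hc : ctr H = H.
  by rewrite /H ctrB ctr1 ctrZ ctrM ctrK fmorph_div /= qr conjC_nat.
have ww : w *m ctr w = q%:M by exact: mul_ctr.
exists H.
  have BB : (2%:R / q) *: (ctr w *m w) *m ((2%:R / q) *: (ctr w *m w)) =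
      (2%:R / q) *: (ctr w *m w) + (2%:R / q) *: (ctr w *m w).
    rewrite -scalemxAr -scalemxAl mulmxA -(mulmxA (ctr w)) ww mul_mx_scalar.
    rewrite -scalemxAl !scalerA -scalerDl; congr (_ *: _); field; exact: q0.
  rewrite /scaled_unitary Hc /H mulmxBr mulmx1 mulmxBl mul1mx BB.
  set B := _ *: _; have -> : B - (B + B) = - B by rewrite opprD addrA subrr sub0r.
  by rewrite opprK subrK.
rewrite /H mulmxBr mulmx1 -scalemxAr mulmxA mul_ctr mul_scalar_mx scalerA.
have -> : 2%:R / q * dotc x w = 1.
  have -> : dotc x w = 1 - dotc x y by rewrite /w Bd xx.
  rewrite qE; have : 1 - dotc x y != 0.
    by apply: contraNneq q0 => h; rewrite qE h mulr0.
  by move=> h; field; rewrite h.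
by rewrite scale1r /w opprB addrC subrK.
Qed.

End ScaledUnitary.

Section SymmetricMatrices.
Variables (C : numClosedFieldType) (n : nat).
Implicit Types (A G : 'M[C]_n.+1).

Let e0 : 'rV[C]_n.+1 := delta_mx 0 0.

Lemma dotc_e0 : dotc e0 e0 = 1.
Proof.
rewrite dotcE (bigD1 0) //= big1 ?addr0 => [|k k0]; rewrite !mxE ?eqxx ?conjC1 ?mulr1 //.
by rewrite (negPf k0) andbF mul0r.
Qed.

(** Sign changes of one coordinate other than the first make [G] diagonal, and
    transpositions of two such coordinates equate the corresponding entries.
    In dimension 1, [ord_max = 0] and the second parameter is 0. *)
Lemma stabilizer_matrix G :
  (forall A, scaled_unitary 1 A -> e0 *m A = e0 -> pull A G = G) ->
  G = hopf_mx (G ord_max ord_max) (G 0 0 - G ord_max ord_max) e0.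
Proof.
move=> inv.
have off i j : i != j -> G i j = 0.
  move=> ij; have [k k0 kij] : exists2 k, k != 0 & (k == i) != (k == j).
    have [i0|i0] := eqVneq i 0; last by exists i => //; rewrite eqxx (negPf ij).
    exists j; first by rewrite -i0 eq_sym.
    by rewrite eqxx [j == i]eq_sym (negPf ij).
  pose d : 'rV[C]_n.+1 := \row_l (if l == k then -1 else 1).
  have dd l : d 0 l * (d 0 l)^* = 1.
    by rewrite mxE; case: ifP => _; rewrite ?rmorphN1 ?conjC1 ?mulrNN mulr1.
  have su : scaled_unitary 1 (diag_mx d).
    apply/matrixP => a b; rewrite mul_diag_mx !mxE.
    have [->|ab] := eqVneq a b; last by rewrite !mulr0n conjC0 mulr0.
    by have := dd b; rewrite mxE !mulr1n => ->.
  have fix0 : e0 *m diag_mx d = e0.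
    apply/rowP => l; rewrite mul_mx_diag !mxE /=.
    by case: eqVneq => [->|_]; rewrite ?mul0r // [0 == k]eq_sym (negPf k0) mulr1.
  have := congr1 (fun M : 'M[C]_n.+1 => M i j) (inv _ su fix0).
  rewrite pullE (bigD1 i) //= [X in _ + X]big1 => [|p /negPf pi]; last first.
    by rewrite big1 // => q _; rewrite !mxE [i == p]eq_sym pi mulr0n !mul0r.
  rewrite addr0 (bigD1 j) //= [X in _ + X]big1 => [|q /negPf qj]; last first.
    by rewrite !mxE [j == q]eq_sym qj mulr0n conjC0 mulr0 mul0r.
  rewrite addr0 !mxE !eqxx !mulr1n [i == k]eq_sym [j == k]eq_sym.
  have neg (x : C) : - x = x -> x = 0.
    move=> /eqP; rewrite -subr_eq0 -opprD oppr_eq0 -mulr2n mulrn_eq0 /=.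
    by move/eqP.
  move: kij; case: (k == i); case: (k == j) => //= _.
    by rewrite conjC1 mulr1 mulN1r => /neg.
  by rewrite rmorphN1 mul1r mulN1r => /neg.
have dia i : i != 0 -> G i i = G ord_max ord_max.
  move=> i0; have [->//|im] := eqVneq i ord_max.
  have m0 : ord_max != 0 :> 'I_n.+1.
    apply: contraNneq im => m0; have nz : n = 0%N := congr1 val m0.
    rewrite -val_eqE /= eqn_leq -ltnS ltn_ord /=.
    exact: leq_trans (eq_leq nz) (leq0n _).
  pose s := tperm i ord_max.
  have sV : (perm_mx s)^T = perm_mx s :> 'M[C]_n.+1 by rewrite tr_perm_mx tpermV.
  have cP : ctr (perm_mx s) = perm_mx s :> 'M[C]_n.+1 by rewrite /ctr map_perm_mx sV.
  have su : scaled_unitary 1 (perm_mx s : 'M[C]_n.+1).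
    by rewrite /scaled_unitary cP -perm_mxM tperm2 perm_mx1.
  have fix0 : e0 *m perm_mx s = e0.
    by apply/rowP => l; rewrite -rowE !mxE eqxx /= [l == 0]eq_sym tpermD.
  have := congr1 (fun M : 'M[C]_n.+1 => M i i) (inv _ su fix0).
  rewrite /pull -/(ctr _) cP -row_permE -sV.
  have -> : row_perm s G *m (perm_mx s)^T = col_perm s (row_perm s G).
    by rewrite col_permE tr_perm_mx.
  by rewrite !mxE tpermL.
apply/matrixP => i j; rewrite /hopf_mx dotc_e0 expr1n !divr1 !mxE big_ord1 !mxE.
have [->|ij] := eqVneq i j; last first.
  rewrite off // mulr0n add0r.
  have [i0|i0] := eqVneq i 0; last by rewrite andbF conjC0 mul0r mulr0.
  have [j0|j0] := eqVneq j 0; last by rewrite andbF mulr0 mulr0.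
  by move: ij; rewrite i0 j0 eqxx.
rewrite mulr1n; have [->|j0] := eqVneq j 0.
  by rewrite conjC1 !mulr1 addrC subrK.
by rewrite conjC0 mul0r mulr0 addr0 dia.
Qed.

End SymmetricMatrices.

(** * The flow preserves unitary symmetry *)

Section FlowStaysHopf.
Variables (R : realType) (n : nat).
Local Notation C := R[i].
Implicit Types (z : 'rV[C]_n).

Lemma dotc_sqnorm z : dotc z z = sqnorm z.
Proof. by rewrite dotcE sqnorm_conj. Qed.

Lemma hopf_gE (alpha beta : R) z : hopf_g alpha beta z = hopf_mx alpha%:C beta%:C z.
Proof.
apply/matrixP => i j; rewrite !mxE big_ord1 !mxE dotc_sqnorm.
have E (F : fieldType) (b p w : F) : b * (p / w) = b / w * p by rewrite mulrA mulrAC.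
rewrite [X in _ + X = _]E; congr (_ + _).
by case: eqP => _; rewrite ?mulr1n ?mulr0n ?mul1r // mul0r mulr0.
Qed.

Lemma hopf_g_pull (alpha beta : R) (s : C) (A : 'M[C]_n) z :
  s != 0 -> z != 0 -> scaled_unitary s A ->
  pull A (hopf_g alpha beta (z *m A)) = hopf_g alpha beta z.
Proof.
move=> s0 z0 sA; rewrite !hopf_gE (hopf_mx_pull _ _ s0 _ sA) //.
by rewrite dotc_sqnorm sqnorm_neq0.
Qed.

Variables (a : 'rV[C]_n) (c1 c2 c3 c4 : R) (T : \bar R) (g : R -> metric R n).
Variables (alpha beta : R).
Hypothesis ha : hopf_multiplier a.
Hypothesis sol : hcf_solution a c1 c2 c3 c4 T g.
Hypothesis hT : (0%:E < T)%E.
Hypothesis init : forall z, z != 0 -> g 0 z = hopf_g alpha beta z.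

Lemma flow_symmetry (b : 'rV[C]_n) (s : C) (A : 'M[C]_n) :
  hopf_multiplier b -> hcf_solution b c1 c2 c3 c4 T g ->
  s != 0 -> scaled_unitary s A -> A *m diag_mx b = diag_mx b *m A ->
  forall t z, 0 <= t -> (t%:E < T)%E -> z != 0 -> pull A (g t (z *m A)) = g t z.
Proof.
move=> hb solb s0 sA Ab t z t0 tT z0.
have Au := scaled_unitary_unitmx s0 sA.
have psol := pullm_solution Au Ab solb.
apply: (hcf_unique hb psol solb _ t0 tT z0) => y y0.
by rewrite /pullm !init // ?mulmx_neq0 // (hopf_g_pull _ _ s0 y0 sA).
Qed.

(** Removes the restriction that symmetries commute with the deck
    transformation. The unitary matrix [diag (r / a_i)], with [r] the common
    modulus of the [a_i], does commute with [diag a], so it is a symmetry of the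
    flow; composing, the scalar [r] is a deck transformation as well, and every
    matrix commutes with it. *)
Lemma flow_dilation (i0 : 'I_n) :
  let b := const_mx (cabs (a 0 i0))%:C in
  hopf_multiplier b /\ hcf_solution b c1 c2 c3 c4 T g.
Proof.
set r := cabs (a 0 i0); have [a0 aeq a1] := ha.
have ar i : cabs (a 0 i) = r by apply: complexI; rewrite -!cabsE.
have an i : a 0 i != 0.
  apply: contraNneq a0 => ai0; apply/eqP/rowP => j; rewrite mxE; apply/eqP.
  by rewrite -normr_eq0 (aeq j i) ai0 normr0.
have r0 : r%:C != 0 :> C by rewrite fmorph_eq0 cabs_eq0.
have normr : `|r%:C : C| = r%:C by rewrite ger0_norm // lecR cabs_ge0.
move=> b; have hb : hopf_multiplier b.
  split=> [|i j|i]; rewrite ?mxE //; last first.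
    by rewrite normr /r -cabsE.
  by apply: contraNneq r0 => /rowP/(_ i0); rewrite !mxE => ->.
split=> //.
pose d : 'rV[C]_n := \row_i (r%:C / a 0 i).
have su : scaled_unitary 1 (diag_mx d).
  apply/matrixP => i j; rewrite mul_diag_mx !mxE.
  have [->|ij] := eqVneq i j; last by rewrite !mulr0n conjC0 mulr0.
  rewrite !mulr1n -normCK normf_div normr cabsE ar divff // expr1n //.
have comm (e f : 'rV[C]_n) : diag_mx e *m diag_mx f = diag_mx f *m diag_mx e.
  by rewrite !mul_diag_mx; apply/matrixP => i j; rewrite !mxE; case: eqVneq => [->|_];
     rewrite ?mulr1n ?mulr0n ?mulr0 // mulrC.
have prod : diag_mx a *m diag_mx d = diag_mx b.
  rewrite mul_diag_mx; apply/matrixP => i j; rewrite !mxE.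
  by case: eqVneq => _; rewrite ?mulr1n ?mulr0n ?mulr0 // mulrC divfK.
have inv := flow_symmetry ha sol (oner_neq0 C) su (comm d a).
have [sm eg] := sol; split=> // t t0 tT; have [[hg ig] E] := eg t t0 tT.
split=> //; split=> // z z0; apply/hopf_pull.
have /hopf_pull -> := ig z z0.
have az : hopf_map a z != 0 by exact: hopf_map_neq0.
by rewrite -(inv t _ t0 tT az) pull_comp prod !hopf_mapE -mulmxA prod.
Qed.

Lemma flow_unitary_symmetry (i0 : 'I_n) (s : C) (A : 'M[C]_n) :
  s != 0 -> scaled_unitary s A ->
  forall t z, 0 <= t -> (t%:E < T)%E -> z != 0 -> pull A (g t (z *m A)) = g t z.
Proof.
move=> s0 sA; have [hb solb] := flow_dilation i0.
apply: (flow_symmetry hb solb s0 sA).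
by rewrite diag_const_mx mul_mx_scalar mul_scalar_mx.
Qed.

End FlowStaysHopf.

Section HopfForm.
Variables (R : realType) (n : nat).
Local Notation C := R[i].
Implicit Types (z : 'rV[C]_n.+1).

(** A homothety and a change of phase turn [z] into a unit vector whose inner
    product with the base point is real; a reflection does the rest. *)
Lemma to_base_point z : z != 0 -> exists (s : C) (A : 'M[C]_n.+1),
  [/\ s != 0, scaled_unitary s A & z *m A = delta_mx 0 0].
Proof.
move=> z0; pose N := Num.sqrt (normsq z).
have N0 : 0 < N by rewrite sqrtr_gt0 normsq_gt0.
have [c [cn cre]] : exists c : C, `|c| = (N^-1)%:C /\ c * z 0 0 = (c * z 0 0)^*.
  have [zz|zz] := eqVneq (z 0 0) 0.
    exists (N^-1)%:C; rewrite zz mulr0 conjC0; split=> //.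
    by rewrite cabsE cabs_real // invr_ge0 ltW.
  exists ((N^-1)%:C * ((z 0 0)^* / `|z 0 0|)); split.
    rewrite normrM normf_div norm_conjC normr_id divff ?normr_eq0 // mulr1.
    by rewrite cabsE cabs_real // invr_ge0 ltW.
  have -> : (N^-1)%:C * ((z 0 0)^* / `|z 0 0|) * z 0 0 = (N^-1)%:C * `|z 0 0|.
    rewrite -mulrA; congr (_ * _); rewrite mulrAC [_^* * _]mulrC -normCK expr2 mulfK //.
    by rewrite normr_eq0.
  rewrite [in RHS]cabsE [in LHS]cabsE -rmorphM.
  by apply: complex_eqP => //=; rewrite oppr0.
have cc : c * c^* = (normsq z)^-1%:C.
  rewrite -normCK cn -rmorphXn; congr (_%:C).
  by rewrite exprVn sqr_sqrtr // normsq_ge0.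
pose x := c *: z; pose y : 'rV[C]_n.+1 := delta_mx 0 0.
have xx : dotc x x = 1.
  rewrite /dotc /x ctrZ -scalemxAl -scalemxAr scalerA cc mxE -/(dotc z z) dotc_sqnorm.
  by rewrite sqnormE -rmorphM mulVf // gt_eqF // normsq_gt0.
have xy : dotc x y = dotc y x.
  have d1 : dotc x y = x 0 0.
    rewrite dotcE (bigD1 0) //= big1 ?addr0 => [|k k0]; rewrite !mxE ?eqxx ?conjC1 ?mulr1 //.
    by rewrite (negPf k0) andbF conjC0 mulr0.
  have d2 : dotc y x = (x 0 0)^*.
    rewrite dotcE (bigD1 0) //= big1 ?addr0 => [|k k0]; rewrite !mxE ?eqxx ?mul1r //.
    by rewrite (negPf k0) andbF mul0r.
  by rewrite d1 d2 mxE.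
have [A0 sA xA] := reflection xx (dotc_e0 C n) xy.
have cc0 : c * c^* != 0.
  by rewrite cc fmorph_eq0 invr_eq0 normsq_eq0.
exists (c * c^*), (c *: A0); split=> //.
  by rewrite /scaled_unitary ctrZ -scalemxAl -scalemxAr scalerA sA scale_scalar_mx mulr1.
by rewrite -scalemxAr scalemxAl.
Qed.

(** Transitivity reduces the claim to the base point, where the stabilizer
    leaves two parameters; positivity of the form on the coordinate vectors
    gives the two inequalities. *)
Lemma symmetric_metric (h : metric R n.+1) :
  (forall z, z != 0 -> posdef (h z)) ->
  (forall (s : C) A, s != 0 -> scaled_unitary s A ->
     forall z, z != 0 -> pull A (h (z *m A)) = h z) ->
  exists alpha beta : R, [/\ 0 < alpha, - alpha < beta &
    forall z, z != 0 -> h z = hopf_g alpha beta z].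
Proof.
move=> ph inv; pose e0 : 'rV[C]_n.+1 := delta_mx 0 0.
have e00 : e0 != 0.
  by apply/eqP => /rowP/(_ 0); rewrite !mxE eqxx => /eqP; rewrite oner_eq0.
have H0 : h e0 = hopf_mx (h e0 ord_max ord_max) (h e0 0 0 - h e0 ord_max ord_max) e0.
  apply: stabilizer_matrix => A sA eA.
  by have := inv 1 A (oner_neq0 _) sA e0 e00; rewrite eA.
have diag_pos k : 0 < h e0 k k.
  have dk : delta_mx 0 k != 0 :> 'rV[C]_n.+1.
    by apply/eqP => /rowP/(_ k); rewrite !mxE !eqxx => /eqP; rewrite oner_eq0.
  have := ph e0 e00 _ dk; rewrite /herm_form (bigD1 k) //= [X in _ + X]big1 => [|i ik]; last first.
    by apply: big1 => j _; rewrite !mxE (negPf ik) andbF mulr0 mul0r.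
  rewrite addr0 (bigD1 k) //= [X in _ + X]big1 => [|j jk]; last first.
    by rewrite !mxE (negPf jk) andbF conjC0 mulr0.
  by rewrite !mxE !eqxx conjC1 !mulr1 addr0.
have real k : h e0 k k = (complex.Re (h e0 k k))%:C.
  by have := diag_pos k; case: (h e0 k k) => x y; rewrite ltcE /= => /andP[/eqP -> _].
have Rpos k : 0 < complex.Re (h e0 k k) by rewrite -ltcR -real.
pose x := complex.Re (h e0 ord_max ord_max).
pose y := complex.Re (h e0 0 0) - complex.Re (h e0 ord_max ord_max).
have yE : y%:C = h e0 0 0 - h e0 ord_max ord_max.
  by rewrite /y rmorphB /= -(real 0) -(real ord_max).
have He0 : h e0 = hopf_g x y e0 by rewrite hopf_gE yE /x -(real ord_max).
exists x, y; split; [exact: Rpos|by rewrite -subr_gt0 opprK /y subrK Rpos|].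
move=> z z0; have [s [A [s0 sA zA]]] := to_base_point z0.
by have := hopf_g_pull x y s0 z0 sA; rewrite zA -He0 -(inv s A s0 sA z z0) zA.
Qed.

End HopfForm.

(** * The Bismut connection of a Hermitian metric *)

Section BismutConnection.
Variables (R : realType) (n : nat).
Local Notation C := R[i].
Implicit Types (g : metric R n) (z : 'rV[C]_n) (Gam : connection R n) (A B D E : frame n).

Lemma barK A : bar (bar A) = A.
Proof. by case: A. Qed.

Lemma holo_bar A : holo (bar A) = ~~ holo A.
Proof. by case: A. Qed.

Lemma metric_cptC g A B : metric_cpt g A B = metric_cpt g B A.
Proof. by case: A => a; case: B => b. Qed.

Lemma metric_cpt_type g A B z : holo A = holo B -> metric_cpt g A B z = 0.
Proof. by case: A => a; case: B => b. Qed.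

Lemma metric_cpt_bar g A B z : (forall i j, g z j i = (g z i j)^*) ->
  metric_cpt g (bar A) (bar B) z = (metric_cpt g A B z)^*.
Proof. by move=> gz; case: A => a; case: B => b; rewrite //= conjC0. Qed.

Lemma metric_cpt_smooth g A B : hermitian_metric g -> zsmooth (metric_cpt g A B).
Proof.
move=> hg; case: A => a; case: B => b /=; try exact: csmooth0.
  exact: (hermitian_zsmooth a b hg).
exact: (hermitian_zsmooth b a hg).
Qed.

Lemma metric_cpt_deriv_bar g A B D z : hermitian_metric g -> z != 0 ->
  frame_deriv (bar A) (metric_cpt g (bar B) (bar D)) z =
  (frame_deriv A (metric_cpt g B D) z)^*.
Proof.
move=> hg z0; have [_ hs _] := hg.
rewrite -{2}(barK A) -frame_deriv_conj; last first.
  exact: zsmooth_zdiff (metric_cpt_smooth _ _ hg) z0.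
by apply: frame_deriv_punctured => // x x0; apply: metric_cpt_bar; exact: hs.
Qed.

Definition inverse_metric g : metric R n := fun z => (invmx (g z))^T.

Lemma inverse_metric_bar g A B z : hermitian_metric g -> z != 0 ->
  metric_cpt (inverse_metric g) (bar A) (bar B) z =
  (metric_cpt (inverse_metric g) A B z)^*.
Proof.
move=> hg z0; have [_ hs _] := hg; apply: metric_cpt_bar => i j.
have gT : map_mx Num.conj (g z) = (g z)^T.
  by apply/matrixP => p q; rewrite !mxE -hs.
have E : map_mx Num.conj (invmx (g z)) = (invmx (g z))^T by rewrite map_invmx gT trmx_inv.
by have := congr1 (fun M : 'M[C]_n => M j i) E; rewrite !mxE => ->.
Qed.

Lemma inverse_metricE g A B z : hermitian_metric g -> z != 0 ->
  \sum_E metric_cpt g A E z * metric_cpt (inverse_metric g) E B z = (A == B)%:R.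
Proof.
move=> hg z0; have gu := hermitian_unitmx hg z0.
rewrite big_frame; case: A => a; case: B => b /=.
- rewrite big1 ?add0r; last by move=> p _; rewrite mul0r.
  have := congr1 (fun M : 'M[C]_n => M a b) (mulmxV gu); rewrite !mxE => <-.
  by apply: eq_bigr => p _; rewrite mxE.
- by rewrite !big1 ?addr0 // => p _; rewrite ?mulr0 ?mul0r.
- by rewrite !big1 ?addr0 // => p _; rewrite ?mulr0 ?mul0r.
- rewrite [X in _ + X]big1 ?addr0; last by move=> p _; rewrite mul0r.
  have := congr1 (fun M : 'M[C]_n => M b a) (mulVmx gu); rewrite !mxE eq_sym => <-.
  by apply: eq_bigr => p _; rewrite mxE mulrC.
Qed.

Definition lower g Gam A B D z : C := \sum_E Gam A B E z * metric_cpt g E D z.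

(** The lowered Christoffel symbols [g(nabla_A e_B, e_D)] of the Bismut
    connection. For [A], [B] of the same type they are [d_B g(e_A, e_D)]: the
    connection differs from the Chern connection by the torsion of the latter. *)
Definition bismut_form g A B D z : C :=
  if holo B == holo D then 0
  else if holo A == holo B then frame_deriv B (metric_cpt g A D) z
  else frame_deriv A (metric_cpt g D B) z - frame_deriv D (metric_cpt g A B) z.

Lemma lower_type g Gam A B D z : hermitian_connection g Gam -> z != 0 ->
  holo B = holo D -> lower g Gam A B D z = 0.
Proof.
move=> hG z0 BD; apply: big1 => E _; have [ED|ED] := eqVneq (holo E) (holo D).
  by rewrite metric_cpt_type ?mulr0.
by rewrite (connection_type _ hG z0) ?mul0r // BD eq_sym.
Qed.

Lemma lower_compat g Gam A B D z : hermitian_connection g Gam -> z != 0 ->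
  frame_deriv A (metric_cpt g B D) z = lower g Gam A B D z + lower g Gam A D B z.
Proof.
move=> hG z0; have [_ -> _] := hG z z0; congr (_ + _).
by apply: eq_bigr => E _; rewrite metric_cptC.
Qed.

Lemma torsion_lowE g Gam A B D z :
  torsion_low g Gam A B D z = lower g Gam A B D z - lower g Gam B A D z.
Proof.
by rewrite /torsion_low /lower -sumrB; apply: eq_bigr => E _; rewrite mulrBl.
Qed.

(** With [L A B D = g(nabla_A e_B, e_D)], [L A B D] vanishes when [B] and [D]
    have the same type, and [L A B D + L A D B = d_A g(e_B, e_D)]. Writing that
    the torsion [L A B D - L B A D] is skew in its last two arguments, one of the
    four terms vanishes for reasons of type, which gives [L A B D] in terms of
    derivatives of the metric. *)
Lemma bismut_lower g Gam A B D z : bismut_connection g Gam -> z != 0 ->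
  lower g Gam A B D z = bismut_form g A B D z.
Proof.
move=> [hG sk] z0; pose L := fun A B D => lower g Gam A B D z.
have T0 X Y W : holo Y = holo W -> L X Y W = 0 by exact: lower_type.
have S X Y W : L X Y W - L Y X W = - (L X W Y - L W X Y).
  by rewrite /L -!torsion_lowE; have [_ ->] := sk z z0 X Y W.
rewrite /bismut_form -/(L A B D); have [BD|BD] := eqVneq (holo B) (holo D); first exact: T0.
have [AB|AB] := eqVneq (holo A) (holo B).
  have := S B A D; rewrite (T0 D B A) // subr0 (lower_compat _ _ _ hG z0) -/(L _ _ _).
  by move=> /eqP; rewrite -eqr_opp opprB opprK subr_eq addrC => /eqP.
have AD : holo A = holo D by move: AB BD; case: (holo A) (holo B) (holo D) => [] [] [].
have := S A B D; rewrite (T0 B A D) // subr0 => E1.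
have := S D B A; rewrite (T0 B D A) // subr0 => E2.
rewrite !(lower_compat _ _ _ hG z0) -!/(L _ _ _) (_ : L D A B + L D B A = L A D B).
  by rewrite addrAC subrr add0r.
by rewrite E2 opprB addrC subrK.
Qed.

Lemma bismut_christoffel g Gam A B D z : hermitian_metric g ->
  bismut_connection g Gam -> z != 0 ->
  Gam A B D z = \sum_E bismut_form g A B E z * metric_cpt (inverse_metric g) E D z.
Proof.
move=> hg hG z0.
rewrite (eq_bigr (fun E => \sum_F Gam A B F z *
   (metric_cpt g F E z * metric_cpt (inverse_metric g) E D z))); last first.
  by move=> E _; rewrite -(bismut_lower _ _ _ hG z0) mulr_suml; apply: eq_bigr => F _; rewrite mulrA.
rewrite exchange_big /= (bigD1 D) //= [X in _ + X]big1 => [|F FD].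
  by rewrite -mulr_sumr inverse_metricE // eqxx mulr1 addr0.
by rewrite -mulr_sumr inverse_metricE // (negPf FD) mulr0.
Qed.

Lemma bismut_form_bar g A B D z : hermitian_metric g -> z != 0 ->
  bismut_form g (bar A) (bar B) (bar D) z = (bismut_form g A B D z)^*.
Proof.
move=> hg z0; rewrite /bismut_form !holo_bar !(inj_eq negb_inj).
case: ifP => _; first by rewrite conjC0.
case: ifP => _; first exact: metric_cpt_deriv_bar.
by rewrite rmorphB /= !metric_cpt_deriv_bar.
Qed.

Lemma bismut_form_zdiff g A B D z : hermitian_metric g -> z != 0 ->
  zdiff (bismut_form g A B D) z.
Proof.
move=> hg z0; rewrite /bismut_form.
have S X Y W : zdiff (frame_deriv X (metric_cpt g Y W)) z.
  exact: zsmooth_zdiff (zsmooth_frame_deriv X (metric_cpt_smooth Y W hg)) z0.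
case: (holo B == holo D); first exact: cdiff_cst.
case: (holo A == holo B); first exact: S.
exact: (cdiffB (S A D B) (S D A B)).
Qed.

Lemma bismut_zdiff g Gam A B D z : hermitian_metric g -> bismut_connection g Gam ->
  z != 0 -> zdiff (Gam A B D) z.
Proof.
move=> hg hG z0; apply: (zdiff_punctured (f := fun x =>
   \sum_E bismut_form g A B E x * metric_cpt (inverse_metric g) E D x) z0).
  by move=> x x0; rewrite (bismut_christoffel _ _ _ hg hG x0).
apply: cdiff_sum => E; apply: cdiffM; first exact: bismut_form_zdiff.
case: E => a; case: D => b /=; try exact: cdiff_cst.
  have -> : (fun p => inverse_metric g (cvec p) a b) = (fun p => invmx (g (cvec p)) b a).
    by apply/funext => p; rewrite mxE.
  exact: zdiff_invmx.
have -> : (fun p => inverse_metric g (cvec p) b a) = (fun p => invmx (g (cvec p)) a b).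
  by apply/funext => p; rewrite mxE.
exact: zdiff_invmx.
Qed.

(** The formula forced by [bismut_lower] does define a Hermitian connection with
    skew torsion. *)
Lemma bismut_exists g : hermitian_metric g -> exists Gam, bismut_connection g Gam.
Proof.
move=> hg; pose gi := metric_cpt (inverse_metric g).
pose Gam : connection R n := fun A B D z => \sum_E bismut_form g A B E z * gi E D z.
have L A B D z : z != 0 -> lower g Gam A B D z = bismut_form g A B D z.
  move=> z0; rewrite /lower /Gam.
  rewrite (eq_bigr (fun E => \sum_F bismut_form g A B F z * (metric_cpt g D E z * gi E F z))).
    rewrite exchange_big /= (bigD1 D) //= [X in _ + X]big1 => [|F FD].
      by rewrite -mulr_sumr inverse_metricE // eqxx mulr1 addr0.
    by rewrite -mulr_sumr inverse_metricE // eq_sym (negPf FD) mulr0.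
  move=> E _; rewrite mulr_suml; apply: eq_bigr => F _.
  by rewrite -mulrA [gi F E z * _]mulrC /gi (metric_cptC _ F) (metric_cptC g E).
have sym A X Y z : frame_deriv A (metric_cpt g X Y) z = frame_deriv A (metric_cpt g Y X) z.
  by rewrite metric_cptC.
exists Gam; split=> z z0; last first.
  move=> A B D; rewrite !torsion_lowE !L //; split; first by rewrite opprB.
  rewrite /bismut_form; case: A => a; case: B => b; case: D => d /=;
    by rewrite ?subr0 ?sub0r ?oppr0 ?opprK ?opprB // (sym _ (inl _) (inr _)) ?(sym _ (inl _) (inr _)).
split=> [A B D|A B D|A B D].
- rewrite /Gam rmorph_sum /= (reindex_inj (can_inj barK)); apply: eq_bigr => E _ /=.
  by rewrite rmorphM /= bismut_form_bar // /gi inverse_metric_bar.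
- transitivity (lower g Gam A B D z + lower g Gam A D B z); last first.
    by congr (_ + _); apply: eq_bigr => E _; rewrite metric_cptC.
  rewrite !L // /bismut_form [holo D == _]eq_sym.
  case: eqP => [BD|BD].
    rewrite addr0 (frame_deriv_punctured (g := fun=> 0) _ z0) ?frame_deriv_cst //.
    by move=> x _; exact: metric_cpt_type.
  have [AB|AB] := eqVneq (holo A) (holo B).
    have /negPf -> : holo A != holo D by rewrite AB; apply/eqP.
    by rewrite addrC subrK.
  have -> : holo A == holo D by move: AB BD; case: (holo A) (holo B) (holo D) => [] [] [].
  by rewrite subrK sym.
rewrite /Gam mulr_sumr mulr_suml; apply: eq_bigr => E _.
rewrite /bismut_form; have [|BE] := eqVneq (holo B) (holo E); first by rewrite !mul0r mulr0.
have [ED|ED] := eqVneq (holo E) (holo D).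
  by rewrite /gi metric_cpt_type // !mulr0 mul0r.
suff -> : Jval R B = Jval R D by rewrite mulrC.
by rewrite /Jval; move: BE ED; case: (holo B) (holo E) (holo D) => [] [] [].
Qed.

End BismutConnection.

(** * Explicit Bismut curvature *)

Section HopfCurvature.
Variables (R : realType) (n : nat).
Local Notation C := R[i].
Implicit Types (z : 'rV[C]_n) (A : frame n).

(** Differentiability and value together, so that the derivative of an explicit
    expression is read off its structure. *)
Definition has_deriv A (f : 'rV[C]_n -> C) z c := zdiff f z /\ frame_deriv A f z = c.

Lemma has_deriv_cst A c z : has_deriv A (fun=> c) z 0.
Proof. by split; [exact: cdiff_cst|rewrite frame_deriv_cst]. Qed.

Lemma has_derivD A f f' g g' z : has_deriv A f z f' -> has_deriv A g z g' ->
  has_deriv A (fun x => f x + g x) z (f' + g').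
Proof.
move=> [df <-] [dg <-]; split; first exact: (cdiffD df dg).
exact: frame_derivD.
Qed.

Lemma has_derivM A f f' g g' z : has_deriv A f z f' -> has_deriv A g z g' ->
  has_deriv A (fun x => f x * g x) z (f' * g z + f z * g').
Proof.
move=> [df <-] [dg <-]; split; first exact: (cdiffM df dg).
exact: frame_derivM.
Qed.

Lemma has_derivN A f f' z : has_deriv A f z f' -> has_deriv A (fun x => - f x) z (- f').
Proof.
move=> df; have := has_derivM (has_deriv_cst A (-1) z) df.
rewrite mul0r add0r mulN1r; under [X in has_deriv _ X]eq_fun do rewrite mulN1r.
by [].
Qed.

Definition sg z : C := (sqnorm z)^-1.
(** [wv] and [uv] are the coefficients of the (1,0) and (0,1) parts of
    [d log |z|^2]. *)
Definition wv z (j : 'I_n) : C := (z 0 j)^* * sg z.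
Definition uv z (k : 'I_n) : C := z 0 k * sg z.
Definition dl (j k : 'I_n) : C := (j == k)%:R.
(** The projection of [T^{1,0}] onto the orthogonal complement of the radial field. *)
Definition proj z (j k : 'I_n) : C := dl j k - wv z j * z 0 k.

Lemma sum_wz z : z != 0 -> \sum_k wv z k * z 0 k = 1.
Proof.
move=> z0; rewrite (eq_bigr (fun k => z 0 k * (z 0 k)^* * sg z)).
  by rewrite -mulr_suml -sqnorm_conj mulfV // sqnorm_neq0.
by move=> k _; rewrite mulrC mulrA.
Qed.

Lemma deriv_sg A z : z != 0 -> has_deriv A sg z
  (match A with inl a => - (wv z a * sg z) | inr b => - (uv z b * sg z) end).
Proof.
move=> z0; split; first exact: zdiff_inv_sqnorm.
rewrite frame_deriv_inv_sqnorm //; case: A => a; rewrite /wv /uv /sg expr2 invfM;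
  by rewrite mulNr mulrA.
Qed.

Lemma deriv_z A k z : has_deriv A (fun x => x 0 k) z (if A is inl a then dl a k else 0).
Proof. by split; [exact: zdiff_coord|rewrite frame_deriv_coord]. Qed.

Lemma deriv_zc A k z : has_deriv A (fun x => (x 0 k)^*) z (if A is inr a then dl a k else 0).
Proof.
by split; [exact: (cdiff_conj (zdiff_coord k z))|rewrite frame_deriv_coord_conj].
Qed.

Lemma has_deriv_eq A f z c c' : has_deriv A f z c -> c = c' -> has_deriv A f z c'.
Proof. by move=> ? <-. Qed.

Lemma dlC j k : dl j k = dl k j.
Proof. by rewrite /dl eq_sym. Qed.

Lemma deriv_w A j z : z != 0 -> has_deriv A (fun x => wv x j) z
  (match A with inl a => - (wv z a * wv z j) | inr b => sg z * proj z j b end).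
Proof.
move=> z0; apply: has_deriv_eq (has_derivM (deriv_zc A j z) (deriv_sg A z0)) _.
have E1 (K : comNzRingType) (c w s : K) : 0 * s + c * - (w * s) = - (w * (c * s)) by ring.
have E2 (K : comNzRingType) (d c x s : K) : d * s + c * - (x * s * s) = s * (d - c * s * x).
  by ring.
case: A => a; first exact: E1.
by rewrite /proj dlC; exact: E2.
Qed.

Lemma deriv_u A k z : z != 0 -> has_deriv A (fun x => uv x k) z
  (match A with inl a => sg z * proj z a k | inr b => - (uv z b * uv z k) end).
Proof.
move=> z0; apply: has_deriv_eq (has_derivM (deriv_z A k z) (deriv_sg A z0)) _.
have E1 (K : comNzRingType) (c w s : K) : 0 * s + c * - (w * s) = - (w * (c * s)) by ring.
have E2 (K : comNzRingType) (d c x s : K) : d * s + c * - (x * s) = s * (d - x * c).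
  by ring.
case: A => a; last exact: E1.
exact: E2.
Qed.

Lemma deriv_proj A j k z : z != 0 -> has_deriv A (fun x => proj x j k) z
  (match A with inl a => - (wv z j * proj z a k) | inr b => - (sg z * proj z j b * z 0 k) end).
Proof.
move=> z0; apply: has_deriv_eq (has_derivD (has_deriv_cst A (dl j k) z)
  (has_derivN (has_derivM (deriv_w A j z0) (deriv_z A k z)))) _.
have E1 (K : comNzRingType) (w x c d : K) :
   0 - (- (w * x) * c + x * d) = - (x * (d - w * c)) by ring.
case: A => a; first exact: E1.
by rewrite mulr0 addr0 add0r.
Qed.

Variables (alpha beta : R).
Hypotheses (alpha0 : 0 < alpha).
Let q : C := (beta / alpha)%:C.

(** [nabla_A e_j = sum_k (hopf_gam A j k) e_k] on [T^{1,0}], for the Bismut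
    connection of [hopf_g]. Found by solving [hopf_gam_lower], which avoids
    inverting the metric. *)
Definition hopf_gam A (j k : 'I_n) z : C := match A with
  | inl a => q * (wv z a * proj z j k) - dl a k * wv z j
  | inr b => dl b j * uv z k - dl j k * uv z b - q * (uv z b * proj z j k)
  end.

Lemma hopf_g_coeff z i j :
  hopf_g alpha beta z i j = alpha%:C * (sg z * (dl i j + q * (wv z i * z 0 j))).
Proof.
have a0 : alpha%:C != 0 :> C by rewrite fmorph_eq0 gt_eqF.
have qE : beta%:C = alpha%:C * q.
  by rewrite /q rmorphM /= fmorphV mulrCA mulfV // mulr1.
rewrite mxE qE /wv /sg /dl expr2 invfM.
have E (K : comNzRingType) (y a d s b c w : K) :
  a * (d * s) + a * y * (c * w * (s * s)) = a * (s * (d + y * (c * s * w))) by ring.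
exact: E.
Qed.

Lemma sum_dl (G : 'I_n -> C) j : \sum_p dl j p * G p = G j.
Proof.
rewrite (bigD1 j) //= big1 ?addr0 => [|p pj]; first by rewrite /dl eqxx mul1r.
by rewrite /dl eq_sym (negPf pj) mul0r.
Qed.

(** The pairing with the radial field [sum_p z_p d/dz_p]: together with the
    values of [G], it is all that sums against [hopf_gam] involve. *)
Definition radial z (G : 'I_n -> C) : C := \sum_p z 0 p * G p.

Lemma sum_proj z (G : 'I_n -> C) j :
  \sum_p proj z j p * G p = G j - wv z j * radial z G.
Proof.
rewrite /radial mulr_sumr -[in RHS](sum_dl G j) -sumrB.
by apply: eq_bigr => p _; rewrite mulrBl mulrA.
Qed.

Lemma sum_hopf_gam A j z (G : 'I_n -> C) :
  \sum_p hopf_gam A j p z * G p = match A with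
  | inl a => q * (wv z a * (G j - wv z j * radial z G)) - wv z j * G a
  | inr b => dl b j * (sg z * radial z G) - uv z b * G j
             - q * (uv z b * (G j - wv z j * radial z G))
  end.
Proof.
rewrite -sum_proj; case: A => a /=.
  rewrite -[in RHS](sum_dl G a) !mulr_sumr -sumrB; apply: eq_bigr => p _.
  have E (K : comNzRingType) (r w P d v h : K) :
    (r * (w * P) - d * v) * h = r * (w * (P * h)) - v * (d * h) by ring.
  exact: E.
rewrite -[in X in _ - uv z a * X](sum_dl G j) /radial !mulr_sumr -!sumrB.
apply: eq_bigr => p _; rewrite /uv.
have E (K : comNzRingType) (d e t s u y h P : K) :
  (d * (t * s) - e * u - y * (u * P)) * h = d * (s * (t * h)) - u * (e * h) - y * (u * (P * h)).
  by ring.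
exact: E.
Qed.

Lemma radial_hopf_gam A k z : z != 0 ->
  radial z (fun p => hopf_gam A p k z) = if A is inl a then - dl a k else 0.
Proof.
move=> z0; have W : \sum_p z 0 p * wv z p = 1.
  by rewrite -(sum_wz z0); apply: eq_bigr => p _; rewrite mulrC.
have D : \sum_p z 0 p * dl p k = z 0 k.
  by rewrite -(sum_dl (fun p => z 0 p) k); apply: eq_bigr => p _; rewrite mulrC dlC.
have P0 : \sum_p z 0 p * proj z p k = 0.
  rewrite (eq_bigr (fun p => z 0 p * dl p k - z 0 p * wv z p * z 0 k)).
    by rewrite sumrB D -mulr_suml W mul1r subrr.
  by move=> p _; rewrite mulrBr mulrA.
rewrite /radial; case: A => a /=.
  rewrite (eq_bigr (fun p => q * wv z a * (z 0 p * proj z p k) - dl a k * (z 0 p * wv z p))).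
    by rewrite sumrB -!mulr_sumr P0 W mulr0 sub0r mulr1.
  move=> p _; have E (K : comNzRingType) (t r w P d v : K) :
    t * (r * (w * P) - d * v) = r * w * (t * P) - d * (t * v) by ring.
  exact: E.
rewrite (eq_bigr (fun p => uv z k * (z 0 p * dl a p) - uv z a * (z 0 p * dl p k)
   - q * uv z a * (z 0 p * proj z p k))).
  have D' : \sum_p z 0 p * dl a p = z 0 a.
    by rewrite -(sum_dl (fun p => z 0 p) a); apply: eq_bigr => p _; rewrite mulrC.
  rewrite !sumrB -!mulr_sumr P0 D D' mulr0 subr0 /uv.
  have E (K : comNzRingType) (x y s : K) : x * s * y - y * s * x = 0 by ring.
  exact: E.
move=> p _; move: (proj z p k) (uv z k) (uv z a) (dl a p) (dl p k) (z 0 p) q.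
have E (K : comNzRingType) (P u v d e y r : K) :
  y * (d * u - e * v - r * (v * P)) = u * (y * d) - v * (y * e) - r * v * (y * P) by ring.
by move=> *; exact: E.
Qed.

Lemma radial_hopf_g l z : z != 0 ->
  radial z (fun k => hopf_g alpha beta z k l) = alpha%:C * (sg z * ((1 + q) * z 0 l)).
Proof.
move=> z0; rewrite /radial.
rewrite (eq_bigr (fun k => alpha%:C * sg z * (dl l k * z 0 k) +
   alpha%:C * sg z * q * z 0 l * (wv z k * z 0 k))).
  rewrite big_split -!mulr_sumr sum_dl sum_wz // mulr1.
  have E (K : comNzRingType) (a s y r : K) : a * s * y + a * s * r * y = a * (s * ((1 + r) * y)).
    by ring.
  exact: E.
move=> k _; rewrite hopf_g_coeff (dlC k).
have E (K : comNzRingType) (y a s d r w t : K) :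
  y * (a * (s * (d + r * (w * t)))) = a * s * (d * y) + a * s * r * t * (w * y) by ring.
exact: E.
Qed.

Lemma deriv_hopf_g A i j z : z != 0 ->
  has_deriv A (fun y => hopf_g alpha beta y i j) z (match A with
   | inl a => alpha%:C * sg z * (q * (wv z i * dl a j) - wv z a * (dl i j + q * (wv z i * z 0 j))
                - q * (wv z a * wv z i * z 0 j))
   | inr b => alpha%:C * sg z * (q * (sg z * proj z i b * z 0 j)
                - uv z b * (dl i j + q * (wv z i * z 0 j)))
   end).
Proof.
move=> z0; under [X in has_deriv _ X]eq_fun do rewrite hopf_g_coeff.
apply: has_deriv_eq (has_derivM (has_deriv_cst A alpha%:C z) (has_derivM (deriv_sg A z0)
  (has_derivD (has_deriv_cst A (dl i j) z) (has_derivM (has_deriv_cst A q z)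
    (has_derivM (deriv_w A i z0) (deriv_z A j z)))))) _.
have E1 (K : comNzRingType) (u a w s d r v t e : K) :
  0 * u + a * (- (w * s) * (d + r * (v * t)) +
     s * (0 + (0 * (v * t) + r * (- (w * v) * t + v * e)))) =
  a * s * (r * (v * e) - w * (d + r * (v * t)) - r * (w * v * t)) by ring.
have E2 (K : comNzRingType) (u a w s d r v t p : K) :
  0 * u + a * (- (w * s) * (d + r * (v * t)) +
     s * (0 + (0 * (v * t) + r * (s * p * t + v * 0)))) =
  a * s * (r * (s * p * t) - w * (d + r * (v * t))) by ring.
case: A => a; [exact: E1|exact: E2].
Qed.

Lemma hopf_gam_lower A j l z : z != 0 ->
  \sum_k hopf_gam A j k z * hopf_g alpha beta z k l =
  bismut_form (hopf_g alpha beta) A (inl j) (inr l) z.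
Proof.
move=> z0; rewrite sum_hopf_gam radial_hopf_g // /bismut_form.
case: A => a /=; rewrite !hopf_g_coeff.
  have [_ ->] := deriv_hopf_g (inl j) a l z0.
  have E (K : comNzRingType) (al y s r wa wj dj da t : K) :
    r * (wa * (al * (s * (dj + r * (wj * t))) - wj * (al * (s * ((1 + r) * t)))))
      - wj * (al * (s * (da + r * (wa * t)))) =
    al * s * (r * (wa * dj) - wj * (da + r * (wa * t)) - r * (wj * wa * t)) by ring.
  exact: E.
have [_ ->] := deriv_hopf_g (inr a) j l z0; have [_ ->] := deriv_hopf_g (inr l) j a z0.
rewrite /proj /uv (dlC a j).
have E (K : comNzRingType) (al s r wj djl dja zl za : K) :
  dja * (s * (al * (s * ((1 + r) * zl)))) - za * s * (al * (s * (djl + r * (wj * zl))))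
  - r * (za * s * (al * (s * (djl + r * (wj * zl))) - wj * (al * (s * ((1 + r) * zl))))) =
  al * s * (r * (s * (dja - wj * za) * zl) - za * s * (djl + r * (wj * zl)))
  - al * s * (r * (s * (djl - wj * zl) * za) - zl * s * (dja + r * (wj * za))) by ring.
exact: E.
Qed.

Lemma deriv_hopf_gam A B j k z : z != 0 ->
  has_deriv A (hopf_gam B j k) z (match A, B with
  | inl a, inl b => q * (- (wv z a * wv z b) * proj z j k - wv z b * (wv z j * proj z a k))
                    + dl b k * (wv z a * wv z j)
  | inr a, inl b => q * (sg z * proj z b a * proj z j k - wv z b * (sg z * proj z j a * z 0 k))
                    - dl b k * (sg z * proj z j a)
  | inl a, inr b => dl b j * (sg z * proj z a k) - dl j k * (sg z * proj z a b)
       - q * (sg z * proj z a b * proj z j k - uv z b * (wv z j * proj z a k))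
  | inr a, inr b => - (dl b j * (uv z a * uv z k)) + dl j k * (uv z a * uv z b)
       + q * (uv z a * uv z b * proj z j k + uv z b * (sg z * proj z j a * z 0 k))
  end).
Proof.
move=> z0; have Dw := deriv_w A _ z0; have Du := deriv_u A _ z0.
have Dp := deriv_proj A j k z0; have K0 c := has_deriv_cst A c z.
case: B => b.
  have := has_derivD (has_derivM (K0 q) (has_derivM (Dw b) Dp))
    (has_derivN (has_derivM (K0 (dl b k)) (Dw j))).
  move=> H; apply: (has_deriv_eq H); case: A {H Dw Du Dp K0} => a.
    have E (K : comNzRingType) (r wa wb p x y d wj : K) :
      0 * x + r * (- (wa * wb) * p + wb * - y) - (0 * wj + d * - (wa * wj)) =
      r * (- (wa * wb) * p - wb * y) + d * (wa * wj) by ring.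
    exact: E.
  have E (K : comNzRingType) (r wa wb p x y d wj e : K) :
    0 * x + r * (e * p + wb * - y) - (0 * wj + d * wa) = r * (e * p - wb * y) - d * wa by ring.
  exact: E.
have := has_derivD (has_derivD (has_derivM (K0 (dl b j)) (Du k))
  (has_derivN (has_derivM (K0 (dl j k)) (Du b))))
    (has_derivN (has_derivM (K0 q) (has_derivM (Du b) Dp))).
move=> H; apply: (has_deriv_eq H); case: A {H Dw Du Dp K0} => a.
  have E (K : comNzRingType) (d e r x y t s1 s2 p u v : K) :
    0 * x + d * s1 - (0 * y + e * s2) - (0 * t + r * (s2 * p + u * - v)) =
    d * s1 - e * s2 - r * (s2 * p - u * v) by ring.
  exact: E.
have E (K : comNzRingType) (d e r x y t s1 s2 p u v : K) :
  0 * x + d * - s1 - (0 * y + e * - s2) - (0 * t + r * (- s2 * p + u * - v)) =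
  - (d * s1) + e * s2 + r * (s2 * p + u * v) by ring.
exact: E.
Qed.

(** The connection preserves [T^{1,0}], so the curvature there only involves
    [hopf_gam]. *)
Definition hopf_curv A B j k z : C :=
  frame_deriv A (hopf_gam B j k) z - frame_deriv B (hopf_gam A j k) z
  + \sum_p (hopf_gam B j p z * hopf_gam A p k z - hopf_gam A j p z * hopf_gam B p k z).

(** Once the sums are eliminated, a polynomial identity in the entries of the
    identity matrix, [wv], [z] and [|z|^-2]. The components along two vectors of
    the same type cancel, and those of mixed type only involve [proj]. *)
Lemma hopf_curvE A B j k z : z != 0 -> hopf_curv A B j k z = match A, B with
  | inl a, inr b => sg z * (proj z j b * proj z a k - (1 + 2%:R * q) * (proj z j k * proj z a b))
  | inr b, inl a => - (sg z * (proj z j b * proj z a k - (1 + 2%:R * q) * (proj z j k * proj z a b)))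
  | _, _ => 0
  end.
Proof.
have main a b : z != 0 -> hopf_curv (inl a) (inr b) j k z =
    sg z * (proj z j b * proj z a k - (1 + 2%:R * q) * (proj z j k * proj z a b)).
  move=> z0; rewrite /hopf_curv; have [_ ->] := deriv_hopf_gam (inl a) (inr b) j k z0.
  have [_ ->] := deriv_hopf_gam (inr b) (inl a) j k z0.
  rewrite sumrB !sum_hopf_gam !radial_hopf_gam // /hopf_gam /proj /uv (dlC b j) (dlC b a).
  have E (K : comNzRingType) (s r wa wj zk zb djb djk dak dab : K) :
    djb * (s * (dak - wa * zk)) - djk * (s * (dab - wa * zb)) -
    r * (s * (dab - wa * zb) * (djk - wj * zk) - zb * s * (wj * (dak - wa * zk))) -
    (r * (s * (dab - wa * zb) * (djk - wj * zk) - wa * (s * (djb - wj * zb) * zk)) -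
      dak * (s * (djb - wj * zb))) +
    (djb * (s * - dak) - zb * s * (r * (wa * (djk - wj * zk)) - dak * wj) -
       r * (zb * s * (r * (wa * (djk - wj * zk)) - dak * wj - wj * - dak)) -
     (r * (wa * (djb * (zk * s) - djk * (zb * s) - r * (zb * s * (djk - wj * zk)) - wj * 0)) -
      wj * (dab * (zk * s) - dak * (zb * s) - r * (zb * s * (dak - wa * zk))))) =
    s * ((djb - wj * zb) * (dak - wa * zk) - (1 + 2%:R * r) * ((djk - wj * zk) * (dab - wa * zb))).
    by ring.
  exact: E.
have skew A' B' : hopf_curv A' B' j k z = - hopf_curv B' A' j k z.
  rewrite /hopf_curv opprD opprB -sumrN; congr (_ + _).
  by apply: eq_bigr => p _; rewrite opprB.
move=> z0; case: A => a; case: B => b.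
- rewrite /hopf_curv; have [_ ->] := deriv_hopf_gam (inl a) (inl b) j k z0.
  have [_ ->] := deriv_hopf_gam (inl b) (inl a) j k z0.
  rewrite sumrB !sum_hopf_gam !radial_hopf_gam // /hopf_gam /proj.
  have E (K : comNzRingType) (s r wa wb wj zk djk dak dbk : K) :
    r * (- (wa * wb) * (djk - wj * zk) - wb * (wj * (dak - wa * zk))) + dbk * (wa * wj) -
    (r * (- (wb * wa) * (djk - wj * zk) - wa * (wj * (dbk - wb * zk))) + dak * (wb * wj)) +
    (r * (wb * (r * (wa * (djk - wj * zk)) - dak * wj - wj * - dak)) -
      wj * (r * (wa * (dbk - wb * zk)) - dak * wb) -
     (r * (wa * (r * (wb * (djk - wj * zk)) - dbk * wj - wj * - dbk)) -
      wj * (r * (wb * (dak - wa * zk)) - dbk * wa))) = 0 by ring.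
  exact: E.
- exact: main.
- by rewrite skew main.
- rewrite /hopf_curv; have [_ ->] := deriv_hopf_gam (inr a) (inr b) j k z0.
  have [_ ->] := deriv_hopf_gam (inr b) (inr a) j k z0.
  rewrite sumrB !sum_hopf_gam !radial_hopf_gam // /hopf_gam /proj /uv !(dlC _ j).
  have E (K : comNzRingType) (s r wj zk za zb djk dja djb : K) :
    - (djb * (za * s * (zk * s))) + djk * (za * s * (zb * s)) +
      r * (za * s * (zb * s) * (djk - wj * zk) + zb * s * (s * (dja - wj * za) * zk)) -
    (- (dja * (zb * s * (zk * s))) + djk * (zb * s * (za * s)) +
      r * (zb * s * (za * s) * (djk - wj * zk) + za * s * (s * (djb - wj * zb) * zk))) +
    (djb * (s * 0) - zb * s * (dja * (zk * s) - djk * (za * s) - r * (za * s * (djk - wj * zk)))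
       - r * (zb * s * (dja * (zk * s) - djk * (za * s) - r * (za * s * (djk - wj * zk)) - wj * 0))
     - (dja * (s * 0) - za * s * (djb * (zk * s) - djk * (zb * s) - r * (zb * s * (djk - wj * zk)))
       - r * (za * s * (djb * (zk * s) - djk * (zb * s) - r * (zb * s * (djk - wj * zk)) - wj * 0)))) = 0.
    by ring.
  exact: E.
Qed.

End HopfCurvature.

Section Curvature.
Variables (R : realType) (n : nat).
Local Notation C := R[i].
Implicit Types (g h : metric R n) (z : 'rV[C]_n) (Gam : connection R n) (A B D E : frame n).

Lemma curvatureC Gam A B D E z : curvature Gam A B D E z = - curvature Gam B A D E z.
Proof.
rewrite /curvature opprD opprB -sumrN; congr (_ + _).
by apply: eq_bigr => F _; rewrite opprB.
Qed.

Lemma curvature_type g Gam A B D E z : hermitian_connection g Gam -> z != 0 ->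
  holo D != holo E -> curvature Gam A B D E z = 0.
Proof.
move=> hG z0 DE.
have d0 X Y : frame_deriv X (Gam Y D E) z = 0.
  rewrite (frame_deriv_punctured (g := fun=> 0) _ z0) ?frame_deriv_cst // => x x0.
  exact: connection_type hG x0 DE.
rewrite /curvature !d0 subrr add0r; apply: big1 => F _.
have [DF|DF] := eqVneq (holo D) (holo F).
  by rewrite !(@connection_type _ _ g Gam _ F E) -?DF // !mulr0 subrr.
by rewrite !(@connection_type _ _ g Gam _ D F) // !mul0r subrr.
Qed.

Lemma curvature_bar g Gam A B D E z : hermitian_connection g Gam -> z != 0 ->
  (forall X Y W, zdiff (Gam X Y W) z) ->
  curvature Gam (bar A) (bar B) (bar D) (bar E) z = (curvature Gam A B D E z)^*.
Proof.
move=> hG z0 dG; have re x X Y W : x != 0 -> Gam (bar X) (bar Y) (bar W) x = (Gam X Y W x)^*.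
  by move=> x0; have [-> _ _] := hG x x0.
have dE X Y : frame_deriv (bar X) (Gam (bar Y) (bar D) (bar E)) z =
   (frame_deriv X (Gam Y D E) z)^*.
  rewrite -{2}(barK X) -frame_deriv_conj //.
  by apply: frame_deriv_punctured => // x; exact: re.
rewrite /curvature !dE rmorphD rmorphB rmorph_sum /=; congr (_ + _).
rewrite (reindex_inj (can_inj (@barK n))); apply: eq_bigr => F _ /=.
by rewrite rmorphB !rmorphM /= !re.
Qed.

Lemma curvature_low_bar g Gam A B D E z : hermitian_metric g ->
  hermitian_connection g Gam -> z != 0 -> (forall X Y W, zdiff (Gam X Y W) z) ->
  curvature_low g Gam (bar A) (bar B) (bar D) (bar E) z =
  (curvature_low g Gam A B D E z)^*.
Proof.
move=> hg hG z0 dG; have [_ hs _] := hg.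
rewrite /curvature_low (reindex_inj (can_inj (@barK n))) rmorph_sum; apply: eq_bigr => F _ /=.
by rewrite (curvature_bar _ _ _ _ hG z0 dG) metric_cpt_bar ?rmorphM //; exact: hs.
Qed.

Lemma sg_conj z : (sg z)^* = sg z.
Proof.
rewrite /sg fmorphV; congr (_^-1); apply: conj_Creal; apply: rpred_sum => i _.
by rewrite rpredX ?normr_real.
Qed.

Lemma proj_conj z j k : (proj z j k)^* = proj z k j.
Proof.
rewrite /proj /wv rmorphB !rmorphM /= sg_conj conjCK /dl conjC_nat.
by rewrite eq_sym; congr (_ - _); rewrite mulrC mulrA mulrAC.
Qed.

Variables (alpha beta : R) (h : metric R n).
Hypotheses (alpha0 : 0 < alpha) (hh : hermitian_metric h).
Hypothesis hE : forall z, z != 0 -> h z = hopf_g alpha beta z.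
Local Notation q := ((beta / alpha)%:C : C).

Section Gam.
Variables (Gam : connection R n) (z : 'rV[C]_n).
Hypotheses (hG : bismut_connection h Gam) (z0 : z != 0).

(** Both sides give the same form when lowered by the metric. *)
Lemma bismut_hopf_gam A j k y : y != 0 ->
  Gam A (inl j) (inl k) y = hopf_gam alpha beta A j k y.
Proof.
move=> y0; pose N := \matrix_(j, k) Gam A (inl j) (inl k) y.
pose M := \matrix_(j, k) hopf_gam alpha beta A j k y.
suff NM : N = M by have := congr1 (fun X : 'M[C]_n => X j k) NM; rewrite !mxE.
have hu := hermitian_unitmx hh y0; apply: (can_inj (mulmxK hu)).
apply/matrixP => i l; rewrite !mxE.
transitivity (lower h Gam A (inl i) (inr l) y).
  rewrite /lower big_frame [X in _ = _ + X]big1 ?addr0 => [|p _]; last by rewrite mulr0.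
  by apply: eq_bigr => p _; rewrite mxE.
rewrite (bismut_lower _ _ _ hG y0).
have dE X Y W : frame_deriv X (metric_cpt h Y W) y =
    frame_deriv X (metric_cpt (hopf_g alpha beta) Y W) y.
  by apply: frame_deriv_punctured => // x x0; case: Y => a; case: W => b /=; rewrite ?hE.
have -> : bismut_form h A (inl i) (inr l) y =
    bismut_form (hopf_g alpha beta) A (inl i) (inr l) y by rewrite /bismut_form !dE.
rewrite -hopf_gam_lower //.
by apply: eq_bigr => p _; rewrite -(hE y0) [in RHS]mxE.
Qed.

Lemma bismut_hopf_curv A B j k :
  curvature Gam A B (inl j) (inl k) z = hopf_curv alpha beta A B j k z.
Proof.
have [hc _] := hG.
have dE X Y : frame_deriv X (Gam Y (inl j) (inl k)) z =
    frame_deriv X (hopf_gam alpha beta Y j k) z.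
  by apply: frame_deriv_punctured => // x x0; exact: bismut_hopf_gam.
rewrite /curvature /hopf_curv !dE big_frame; congr (_ + _).
rewrite [X in _ + X]big1 ?addr0 => [|p _]; last first.
  by rewrite !(@connection_type _ _ h Gam _ (inl j)) // !mul0r subrr.
by apply: eq_bigr => p _; rewrite !bismut_hopf_gam.
Qed.

(** Since [proj] kills the radial direction, lowering its index by the metric
    only multiplies it by [alpha / |z|^2]. *)
Lemma bismut_hopf_low a b j l :
  curvature_low h Gam (inl a) (inr b) (inl j) (inr l) z =
  alpha%:C * (sg z * (sg z * (proj z j b * proj z a l
     - (1 + 2%:R * q) * (proj z j l * proj z a b)))).
Proof.
rewrite /curvature_low big_frame /= [X in _ + X]big1 ?addr0 => [|p _]; last by rewrite mulr0.
have low i : \sum_k proj z i k * h z k l = alpha%:C * (sg z * proj z i l).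
  rewrite sum_proj hE // radial_hopf_g // hopf_g_coeff // /proj.
  have E (K : comNzRingType) (s r c w d t : K) :
    c * (s * (d + r * (w * t))) - w * (c * (s * ((1 + r) * t))) = c * (s * (d - w * t)) by ring.
  exact: E.
rewrite (eq_bigr (fun k => sg z * proj z j b * (proj z a k * h z k l) -
   sg z * (1 + 2%:R * q) * proj z a b * (proj z j k * h z k l))).
  rewrite sumrB -!mulr_sumr !low.
  have E (K : comNzRingType) (s r c x y u v : K) :
    s * x * (c * (s * y)) - s * r * v * (c * (s * u)) = c * (s * (s * (x * y - r * (u * v)))).
    by ring.
  exact: E.
move=> k _; rewrite bismut_hopf_curv hopf_curvE //.
have E (K : comNzRingType) (s r x y u v w : K) :
  s * (x * y - r * (u * v)) * w = s * x * (y * w) - s * r * v * (u * w) by ring.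
exact: E.
Qed.

(** Type (1,1) in the first pair is [hopf_curvE], in the second pair it is
    [nabla J = 0]. Skewness in the second pair amounts, by reality of the
    connection, to the Hermitian symmetry of the array [bismut_hopf_low], which
    follows from that of [proj]. *)
Lemma bismut_hopf_Cplx : in_wedge11_wedge11 (fun A B D E => curvature_low h Gam A B D E z).
Proof.
have [hc _] := hG.
have dG X Y W : zdiff (Gam X Y W) z by exact: bismut_zdiff hh hG z0.
pose L A B D E := curvature_low h Gam A B D E z.
have skew A B D E : L A B D E = - L B A D E.
  by rewrite /L /curvature_low -sumrN; apply: eq_bigr => F _; rewrite curvatureC mulNr.
have re A B D E : L (bar A) (bar B) (bar D) (bar E) = (L A B D E)^*.
  exact: curvature_low_bar.
have CD A B D E : holo D = holo E -> L A B D E = 0.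
  move=> DE; apply: big1 => F _; have [FE|FE] := eqVneq (holo F) (holo E).
    by rewrite metric_cpt_type ?mulr0.
  by rewrite (curvature_type _ _ hc z0) ?mul0r // DE eq_sym.
have AB0 A B j E : holo A = holo B -> L A B (inl j) E = 0.
  move=> AB; apply: big1 => -[k|k] _; last by rewrite (curvature_type _ _ hc z0) // mul0r.
  rewrite bismut_hopf_curv hopf_curvE //.
  by case: A B AB => [a|a] [b|b] //= _; rewrite mul0r.
have AB A B D E : holo A = holo B -> L A B D E = 0.
  case: D => j; first exact: AB0.
  move=> eAB; rewrite -(barK A) -(barK B) -(barK E) -[inr j]/(bar (inl j)) re AB0 ?conjC0 //.
  by rewrite !holo_bar eAB.
have mixed a b j l : L (inl a) (inr b) (inl j) (inr l) = - L (inl a) (inr b) (inr l) (inl j).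
  have := re (inr a) (inl b) (inl l) (inr j); rewrite (skew (inr a)) rmorphN /= => ->; rewrite opprK.
  rewrite /L !bismut_hopf_low.
  have E (K : numClosedFieldType) (c s r x y u v : K) : c^* = c -> r^* = r -> s^* = s ->
    (c * (s * (s * (x * y - (1 + 2%:R * r) * (u * v)))))^* =
    c * (s * (s * (y^* * x^* - (1 + 2%:R * r) * (u^* * v^*)))).
    move=> ec er es; rewrite !rmorphM rmorphB !rmorphM rmorphD rmorphM /= conjC1 conjC_nat.
    by rewrite ec es er [y^* * _]mulrC.
  by rewrite E ?proj_conj ?sg_conj //; apply: complex_eqP => //=; rewrite oppr0.
split=> //.
move=> A B D E; have [DE|] := eqVneq (holo D) (holo E).
  by rewrite -/(L A B D E) -/(L A B E D) !CD ?oppr0.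
have [eAB|] := eqVneq (holo A) (holo B).
  by rewrite -/(L A B D E) -/(L A B E D) !AB ?oppr0.
rewrite -/(L A B D E) -/(L A B E D).
case: A => a; case: B => b //= _; case: D => d; case: E => e //= _.
- by rewrite mixed opprK.
- by rewrite skew [in RHS]skew mixed.
- by rewrite skew [in RHS]skew mixed opprK.
Qed.

End Gam.

Lemma hopf_bismut_Cplx : bismut_Cplx h.
Proof.
split; first exact: bismut_exists.
by move=> Gam hG z z0; exact: bismut_hopf_Cplx.
Qed.

End Curvature.

(** * The flow on a linear Hopf manifold *)

Theorem corollary1 (R : realType) (n : nat) (hn : (0 < n)%N)
    (a : 'rV[R[i]]_n) (ha : hopf_multiplier a)
    (alpha beta : R) (halpha : 0 < alpha) (hbeta : - alpha < beta)
    (c1 c2 c3 c4 : R) (T : \bar R) (hT : (0%:E < T)%E)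
    (g : R -> metric R n) (hg : hcf_on_hopf a c1 c2 c3 c4 T g)
    (hg0 : forall z : 'rV[R[i]]_n, z != 0 -> g 0 z = hopf_g alpha beta z) :
  forall t : R, 0 <= t -> (t%:E < T)%E -> bismut_Cplx (g t).
Proof.
case: n hn a ha g hg hg0 => // n _ a ha g hg hg0 t t0 tT.
have sol := hcf_on_hopf_solution hg.
have [_ /(_ t t0 tT) [[hh _] _]] := sol.
have [|s A s0 sA z z0|alpha' [beta' [alpha'0 _ hE]]] := @symmetric_metric R n (g t).
- by move=> z z0 v v0; have [_ _] := hh; exact.
- exact: (flow_unitary_symmetry ha sol hg0 ord0 s0 sA).
exact: hopf_bismut_Cplx alpha'0 hh hE.
Qed.
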